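(* Let $k$ be a field of characteristic $0$, let $\mathcal{P}oiss$ be the Poisson operad over $k$, and let $\mathcal{P}oiss^{\circlearrowright}$ be its wheeled completion. Then $\mathcal{P}oiss^{\circlearrowright}$ is not a wheeled Koszul operad, i.e. $H^*(Cob^{\circlearrowright}(\mathcal{P}oiss^{\circlearrowright}))$ is not isomorphic, as a wheeled operad, to the wheeled quadratic dual $(\mathcal{P}oiss^{\circlearrowright})^!$.
   Context: All vector spaces are finite dimensional over the field $k$, $\mathrm{char}(k)=0$; all operads $\mathcal P=\{\mathcal P(n)\}_{n\ge1}$ are symmetric $k$-linear operads with $\mathcal P(1)=k$, and partial compositions are written $\circ_i$. **Wheeled operads.** A wheeled operad $\mathcal P$ consists of an operad $\mathcal P_o=\{\mathcal P_o(n)\}_{n\ge1}$ (the operadic part), a collection of $S_n$-modules $\mathcal P_w=\{\mathcal P_w(n)\}_{n\ge0}$ (the wheeled part; its elements are thought of as having $n$ inputs and no output), compositions $\circ_i:\mathcal P_w(n)\otimes\mathcal P_o(m)\to\mathcal P_w(n+m-1)$, $1\le i\le n$, extending the composition of $\mathcal P_o$, and contractions $\xi_i:\mathcal P_o(n)\to\mathcal P_w(n-1)$, $1\le i\le n$ (thought of as joining the output to the $i$-th input), satisfying the cyclic property $\xi_{i+j-1}(\nu\circ_i\mu)=\xi_{i+j-1}(\mu\circ_j\nu)$, up to the evident relabelling of inputs, for $\nu\in\mathcal P_o(n)$, $\mu\in\mathcal P_o(m)$, $i\le n$, $j\le m$. An isomorphism of wheeled operads is a family of linear bijections on the operadic and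 wheeled parts that preserves the unit and commutes with the symmetric group actions, compositions and contractions. An ideal is a pair of collections of subspaces of $\mathcal P_o,\mathcal P_w$ that is stable under the symmetric groups, under contractions, and under composition with arbitrary elements of $\mathcal P$. The wheeled completion $\mathcal P^{\circlearrowright}$ of an operad $\mathcal P$ is the wheeled operad with $\mathcal P^{\circlearrowright}_o=\mathcal P$ and with $\mathcal P^{\circlearrowright}_w$ generated by all contractions $\xi_i(\nu)$, $\nu\in\mathcal P$, the contractions satisfying no relations other than the cyclic property, and with composition and symmetric group action extending those of $\mathcal P$. **Trees.** A reduced tree is a rooted tree all of whose vertices have at least two inputs. A wheeled tree is a graph obtained from a reduced tree by joining its output to one of its leaves. An outputless tree is a rooted tree whose root vertex has no output (and at least one input), all other vertices having at least two inputs. The leaves of a graph with $n$ leaves are labelled by $1,\dots,n$. **Quadratic wheeled operads.** For an $S_2$-module $E$, $Free(E)$ is the free operad on $E$ placed in arity 2, and $Free^{\circlearrowright}(E)$ is its wheeled completion (so $Free^{\circlearrowright}_w(E)(n)$, $n\ge1$, is spanned by binary wheeled trees with vertices decorated by $E$). For $R=R_o\oplus R_w\subset Free(E)(3)\oplus Free^{\circlearrowright}_w(E)(1)$ put $\mathcal Q^{\circlearrowright}(E,R)=Free^{\circlearrowright}(E)/\langle R\rangle$, where $\langle R\rangle$ is the ideal generated by $R$. If $\mathcal P=\mathcal Q(E,R_o)=Free(E)/\langle R_o\rangle$ is a quadratic operad, then $\mathcal P^{\circlearrowright}=\mathcal Q^{\circlearrowright}(E,R_o\oplus0)$. **Wheeled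 quadratic dual.** Put $E^\vee=E^*\otimes sgn$, where $sgn$ is the sign representation. The wheeled quadratic dual of $\mathcal P=\mathcal Q^{\circlearrowright}(E,R)$ is $\mathcal P^!=\mathcal Q^{\circlearrowright}(E^\vee,Ann(R))$. The operadic part of the annihilator $Ann(R)$ is formed with the pairing of $Free(E^\vee)(3)$ and $Free(E)(3)$ in which decorated trees of different shape (with labelled leaves) are orthogonal, and for $\sigma\in S_3$ the tree with top vertex $\alpha$, second vertex $\beta$ on its left input, and leaves labelled $\sigma(1),\sigma(2),\sigma(3)$ from left to right, paired with the same tree decorated by $\mu$ (top) and $\nu$, gives $sgn(\sigma)\alpha(\mu)\beta(\nu)$; when the second vertex is on the right input the value is $-sgn(\sigma)\alpha(\mu)\beta(\nu)$. The wheeled part is formed with a perfect pairing of $Free^{\circlearrowright}_w(E^\vee)(1)$ and $Free^{\circlearrowright}_w(E)(1)$; when $R_w=0$, as is the case for a wheeled completion, the wheeled part of $Ann(R)$ is all of $Free^{\circlearrowright}_w(E^\vee)(1)$. **Poisson operad.** $\mathcal{P}oiss=\mathcal Q(E,R_o)$, where $E$ is spanned by a symmetric operation $x\cdot y$ and an antisymmetric operation $[x,y]$, and $R_o$ is the $S_3$-module generated by the relations $(x_1\cdot x_2)\cdot x_3=x_1\cdot(x_2\cdot x_3)$, $[x_1,[x_2,x_3]]+[x_2,[x_3,x_1]]+[x_3,[x_1,x_2]]=0$ and $[x_1,x_2\cdot x_3]=x_2\cdot[x_1,x_3]+[x_1,x_2]\cdot x_3$. **Wheeled cobar complex.** Let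 $\mathcal P$ be a wheeled operad. Then $Cob^{\circlearrowright}(\mathcal P)=Free^{\circlearrowright}(\mathcal P_o(n)^*[-1],\mathcal P_w(m)^*\mid n\ge2,m\ge1)\otimes\det(T)\otimes sgn$. That is: its operadic part in arity $n$ is spanned by reduced trees $T$ with $n$ leaves, each vertex with $m$ inputs being decorated by an element of $\mathcal P_o(m)^*$ (in arity 1 there is only the trivial tree, which is the unit). Its wheeled part in arity $n$ is spanned by wheeled trees with $n$ leaves decorated in the same way, together with outputless trees with $n$ leaves whose root vertex (with $m\ge1$ inputs) is decorated by an element of $\mathcal P_w(m)^*$ and whose other vertices are decorated by elements of $\mathcal P_o(\cdot)^*$. Decorations are linear at each vertex. Each decorated graph $T$ is tensored with $\det(T)$, the top exterior power of the vector space spanned by the internal edges of $T$ (edges closing a wheel included), and $S_n$ acts by permuting leaf labels, twisted by the sign representation. The composition $\circ_i$ grafts the output of one graph onto the $i$-th leaf of the other: $(T\otimes\omega)\circ_i(T'\otimes\omega')=(T\circ_iT')\otimes e\wedge\omega\wedge\omega'$, where $e$ is the new edge; the contraction $\xi_i$ joins the output of a tree to its $i$-th leaf. The degree is the number of vertices decorated by elements of $\mathcal P_o(\cdot)^*$. The differential $d$, of degree $+1$, is dual to contracting a single internal edge: an edge between two distinct vertices is contracted using the composition of $\mathcal P$, and an edge forming a loop at a single vertex is contracted using the contraction $\xi_i$ of $\mathcal P$. Thus $d(T\otimes\omega)$ is the sum over all ways of creating one new edge $e$, with wedge factor $e\wedge\omega$; one has $d^2=0$. The cohomology $H^*(Cob^{\circlearrowright}(\mathcal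 P))$ carries the wheeled operad structure induced from $Cob^{\circlearrowright}(\mathcal P)$. **Wheeled Koszulness.** A quadratic wheeled operad $\mathcal P$ is called wheeled Koszul if $H^*(Cob^{\circlearrowright}(\mathcal P))\cong\mathcal P^!$, where $\cong$ denotes isomorphism of wheeled operads. *)

(* Defs.v *)
From HB Require Import structures.
From mathcomp Require Import fingroup perm.
From mathcomp Require Import all_boot all_algebra.
From mathcomp Require Import boolp classical_sets functions.
From mathcomp Require Import finmap monalg.

Set Implicit Arguments.
Unset Strict Implicit.
Unset Printing Implicit Defensive.

Import GRing.Theory.

Local Open Scope classical_set_scope.
Local Open Scope quotient_scope.
Local Open Scope ring_scope.

Section Span.
Variables (k : fieldType) (V : lmodType k).

Definition is_subspace (S : set V) : Prop :=
  S 0 /\ forall (a : k) x y, S x -> S y -> S (a *: x + y).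

Definition lspan (A : set V) : set V :=
  [set x | forall S, is_subspace S -> A `<=` S -> S x].

Lemma lspan_subspace A : is_subspace (lspan A).
Proof.
split=> [S [] //|a x y hx hy S sS AS]; have [_ h] := sS.
by apply: h; [exact: hx|exact: hy].
Qed.

End Span.

(* subquot A B is the image of span A in V / span B; when A and B are
   subspaces with B inside A this is A / B. *)
Section Subquotient.
Variables (k : fieldType) (V : lmodType k) (A B : set V).

Definition in_span : V -> bool := fun x => `[< lspan A x >].

Fact in_span_closed : submod_closed in_span.
Proof.
have [h0 h] := lspan_subspace A; split; first exact/asboolP.
by move=> a x y /asboolP hx /asboolP hy; apply/asboolP; apply: h.
Qed.
HB.instance Definition _ :=
  GRing.isSubmodClosed.Build k V in_span in_span_closed.

Record span_of := SpanOf { span_val :> V; _ : span_val \in in_span }.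
HB.instance Definition _ := [isSub for span_val].
HB.instance Definition _ := [Choice of span_of by <:].
HB.instance Definition _ := [SubChoice_isSubLmodule of span_of by <:].

Definition sqrel (x y : span_of) : bool :=
  `[< lspan B (span_val x - span_val y) >].

Fact sqrel_equiv : equiv_class_of sqrel.
Proof.
have [h0 h] := lspan_subspace B.
have hN x : lspan B x -> lspan B (- x).
  by move=> hx; rewrite -scaleN1r -[_ *: _]addr0; apply: h.
split=> [x|x y|y x z].
- by apply/asboolP; rewrite subrr.
- by apply/asboolP/asboolP => /hN; rewrite opprB.
- move=> /asboolP h1 /asboolP h2; apply/asboolP.
  by have := h 1 _ _ h1 h2; rewrite scale1r addrA subrK.
Qed.
Canonical sqrel_equivRel := EquivRelPack sqrel_equiv.

Definition subquot := {eq_quot sqrel}.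
HB.instance Definition _ := EqQuotient.on subquot.
HB.instance Definition _ := Choice.on subquot.

(* [cls v] is the class of v, meaningful for v in the span of A;
   [rep q] is a representative of q. *)
Definition cls (v : V) : subquot :=
  \pi_subquot (odflt 0 (insub v)).
Definition rep (q : subquot) : V := span_val (repr q).

Implicit Types (q : subquot) (x y : span_of).

Definition sqadd q1 q2 : subquot := \pi_subquot (repr q1 + repr q2).
Definition sqscale (a : k) q : subquot := \pi_subquot (a *: repr q).
Definition sqopp q : subquot := sqscale (-1) q.

Fact span_valD x y : span_val (x + y) = span_val x + span_val y.
Proof. exact: (raddfD \val). Qed.

Fact span_valZ a x : span_val (a *: x) = a *: span_val x.
Proof. by rewrite -[LHS]/(\val (a *: x)) linearZ. Qed.

Fact sq_eq x y :
  lspan B (span_val x - span_val y) -> \pi_subquot x = \pi_subquot y.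
Proof. by move=> h; apply/eqmodP/asboolP. Qed.

Fact sq_repr x : lspan B (span_val (repr (\pi_subquot x)) - span_val x).
Proof.
by have /eqmodP/asboolP := reprK (\pi_subquot x).
Qed.

Fact sq_piD x y : \pi_subquot (x + y) = sqadd (\pi_subquot x) (\pi_subquot y).
Proof.
symmetry; apply: sq_eq; rewrite !span_valD opprD addrACA.
have [_ h] := lspan_subspace B.
by have := h 1 _ _ (sq_repr x) (sq_repr y); rewrite scale1r.
Qed.

Fact sq_piZ a x : \pi_subquot (a *: x) = sqscale a (\pi_subquot x).
Proof.
symmetry; apply: sq_eq; have [h0 h] := lspan_subspace B.
by have := h a _ _ (sq_repr x) h0; rewrite addr0 scalerBr !span_valZ.
Qed.

Fact sq_piP q : exists x, q = \pi_subquot x.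
Proof. by exists (repr q); rewrite reprK. Qed.

Fact sqaddA : associative sqadd.
Proof.
move=> q1 q2 q3.
have [x ->] := sq_piP q1; have [y ->] := sq_piP q2; have [z ->] := sq_piP q3.
by rewrite -(sq_piD y z) -(sq_piD x) addrA (sq_piD _ z) (sq_piD x y).
Qed.
Fact sqaddC : commutative sqadd.
Proof.
move=> q1 q2; have [x ->] := sq_piP q1; have [y ->] := sq_piP q2.
by rewrite -(sq_piD x y) addrC (sq_piD y x).
Qed.
Fact sqadd0 : left_id (\pi_subquot 0) sqadd.
Proof. by move=> q; have [x ->] := sq_piP q; rewrite -(sq_piD 0 x) add0r. Qed.
Fact sqaddN : left_inverse (\pi_subquot 0) sqopp sqadd.
Proof.
move=> q; have [x ->] := sq_piP q.
by rewrite /sqopp -(sq_piZ _ x) -(sq_piD _ x) scaleN1r addNr.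
Qed.
HB.instance Definition _ :=
  GRing.isZmodule.Build subquot sqaddA sqaddC sqadd0 sqaddN.

Fact sqscaleA a b q : sqscale a (sqscale b q) = sqscale (a * b) q.
Proof.
by have [x ->] := sq_piP q; rewrite -(sq_piZ b x) -(sq_piZ a) scalerA (sq_piZ _ x).
Qed.
Fact sqscale1 : left_id 1 sqscale.
Proof. by move=> q; have [x ->] := sq_piP q; rewrite -(sq_piZ 1 x) scale1r. Qed.
Fact sqscaleDr : right_distributive sqscale +%R.
Proof.
move=> a q1 q2; have [x ->] := sq_piP q1; have [y ->] := sq_piP q2.
rewrite -[_ + _ in LHS]/(sqadd _ _) -[RHS]/(sqadd _ _) -(sq_piD x y).
by rewrite -!sq_piZ scalerDr sq_piD.
Qed.
Fact sqscaleDl q : {morph sqscale^~ q : a b / a + b}.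
Proof.
move=> a b; have [x ->] := sq_piP q.
by rewrite -[RHS]/(sqadd _ _) -!sq_piZ scalerDl sq_piD.
Qed.
HB.instance Definition _ := GRing.Zmodule_isLmodule.Build k subquot
  sqscaleA sqscale1 sqscaleDr sqscaleDl.

End Subquotient.

(* Only the operations are recorded: every object below is built explicitly.
   [ocomp i x y] is x o_(i+1) y, arities n+1 and m+1 giving n+m+1; arity 0 of
   the operadic part is never used.  [oact s x] is x with its (l+1)-st input
   relabelled s l + 1. *)
Record operad (k : fieldType) := Operad {
  opart :> nat -> lmodType k;
  ounit : opart 1%N;
  oact : forall n, 'S_n -> opart n -> opart n;
  ocomp : forall n m, 'I_n.+1 -> opart n.+1 -> opart m.+1 -> opart (n + m).+1
}.

Record wheeled_operad (k : fieldType) := WheeledOperad {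
  operadic :> operad k;
  wpart : nat -> lmodType k;
  wact : forall n, 'S_n -> wpart n -> wpart n;
  wcomp : forall n m,
    'I_n.+1 -> wpart n.+1 -> operadic m.+1 -> wpart (n + m).+1;
  contraction : forall n, 'I_n.+1 -> operadic n.+1 -> wpart n
}.

Arguments oact {k o n}.
Arguments ocomp {k o n m}.
Arguments wact {k w n}.
Arguments wcomp {k w n m}.
Arguments contraction {k w n}.

Definition wheeled_iso (k : fieldType) (P Q : wheeled_operad k) : Prop :=
  exists (f : forall n, {linear P n -> Q n})
         (g : forall n, {linear wpart P n -> wpart Q n}),
    (forall n, bijective (f n.+1)) /\ (forall n, bijective (g n)) /\
    [/\ f 1%N (ounit P) = ounit Q,
        forall n (s : 'S_n.+1) x, f _ (oact s x) = oact s (f _ x),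
        forall n (s : 'S_n) u, g _ (wact s u) = wact s (g _ u),
        forall n m (i : 'I_n.+1) (x : P n.+1) (y : P m.+1),
          f _ (ocomp i x y) = ocomp i (f _ x) (f _ y) &
        forall n m (i : 'I_n.+1) (u : wpart P n.+1) (y : P m.+1),
          g _ (wcomp i u y) = wcomp i (g _ u) (f _ y)] /\
    (forall n (i : 'I_n.+1) (x : P n.+1),
       g _ (contraction i x) = contraction i (f _ x)).

Section Ideals.
Variable k : fieldType.

Definition is_operad_ideal (P : operad k) (I : forall n, set (P n)) : Prop :=
  [/\ forall n, is_subspace (I n),
      forall n (s : 'S_n) x, I n x -> I n (oact s x),
      forall n m (i : 'I_n.+1) (x : P n.+1) (y : P m.+1),
        I _ x -> I _ (ocomp i x y) &
      forall n m (i : 'I_n.+1) (x : P n.+1) (y : P m.+1),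
        I _ y -> I _ (ocomp i x y)].

Definition operad_ideal (P : operad k) (R : set (P 3%N)) n : set (P n) :=
  [set x | forall I, is_operad_ideal I -> R `<=` I 3%N -> I n x].

Definition is_wheeled_ideal (P : wheeled_operad k)
    (I : forall n, set (P n)) (J : forall n, set (wpart P n)) : Prop :=
  is_operad_ideal I /\
  [/\ forall n, is_subspace (J n),
      forall n (s : 'S_n) u, J n u -> J n (wact s u),
      forall n m (i : 'I_n.+1) (u : wpart P n.+1) (y : P m.+1),
        J _ u -> J _ (wcomp i u y),
      forall n m (i : 'I_n.+1) (u : wpart P n.+1) (y : P m.+1),
        I _ y -> J _ (wcomp i u y) &
      forall n (i : 'I_n.+1) (x : P n.+1), I _ x -> J _ (contraction i x)].

Section Generated.
Variables (P : wheeled_operad k) (Ro : set (P 3%N)) (Rw : set (wpart P 1%N)).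

Definition wheeled_ideal_o n : set (P n) :=
  [set x | forall I J, is_wheeled_ideal I J ->
                       Ro `<=` I 3%N -> Rw `<=` J 1%N -> I n x].

Definition wheeled_ideal_w n : set (wpart P n) :=
  [set u | forall I J, is_wheeled_ideal I J ->
                       Ro `<=` I 3%N -> Rw `<=` J 1%N -> J n u].

End Generated.

Definition quot_operad (P : operad k) (I : forall n, set (P n)) : operad k :=
  @Operad k (fun n => subquot [set: P n] (I n))
    (cls _ _ (ounit P))
    (fun n s x => cls _ _ (oact s (rep x)))
    (fun n m i x y => cls _ _ (ocomp i (rep x) (rep y))).

Definition quot_wheeled (P : wheeled_operad k)
    (I : forall n, set (P n)) (J : forall n, set (wpart P n)) :
    wheeled_operad k :=
  @WheeledOperad k (quot_operad I)
    (fun n => subquot [set: wpart P n] (J n))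
    (fun n s u => cls _ _ (wact s (rep u)))
    (fun n m i u y => cls _ _ (wcomp i (rep u) (rep y)))
    (fun n i x => cls _ _ (contraction i (rep x))).

End Ideals.

(* By equivariance every contraction is xi_(n+1) of an operation with n+1
   inputs, up to relabelling.  So the wheeled part in arity n is P(n+1), with x
   standing for xi_(n+1)(x), modulo the cyclic property
     xi(x o_(a+1) y) = xi(y o_(b+1) x),  x in P(a+1), y in P(b+1),
   and its relabellings.  The inputs left on the right-hand side are the b ones
   of y followed by the a ones of x, hence [is_block_swap]. *)
Section Completion.
Variables (k : fieldType) (P : operad k).

Definition is_block_swap a b n (r : 'S_n.+1) : Prop :=
  forall p : 'I_n.+1, r p =
    (if p < b then p + a else if p < b + a then p - b else p)%N :> nat.

Definition cyclic_relation n : set (P n.+1) :=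
  [set z | exists (a b : nat) (eab : (a + b)%N = n) (eba : (b + a)%N = n)
                  (x : P a.+1) (y : P b.+1) (r : 'S_n.+1) (s : 'S_n),
     is_block_swap a b r /\
     z = oact (lift_perm ord_max ord_max s)
           (ecast j (P j.+1) eab (ocomp ord_max x y)
            - oact r (ecast j (P j.+1) eba (ocomp ord_max y x)))].

Definition completion_part n : lmodType k :=
  subquot [set: P n.+1] (@cyclic_relation n).

(* lift_perm i ord_max 1 moves the i-th input to the last place and keeps the
   other ones in order. *)
Definition completion : wheeled_operad k :=
  @WheeledOperad k P completion_part
    (fun n s u => cls _ _ (oact (lift_perm ord_max ord_max s) (rep u)))
    (fun n m i u y =>
       cls _ (@cyclic_relation (n + m).+1)
         (@ocomp k P n.+1 m (lift ord_max i) (rep u) y))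
    (fun n i x => cls _ _ (oact (lift_perm i ord_max (perm_one _)) x)).

End Completion.

Record S2module (k : fieldType) := S2Module {
  s2car :> vectType k;
  s2swap : 'End(s2car);
  s2swapK : (s2swap \o s2swap)%VF = \1%VF
}.

(* The S_n-action on leaf labels 1, ..., n; the label 0 is fixed. *)
Definition relabel_by n (s : 'S_n) (l : nat) : nat :=
  if l is l'.+1 then oapp (fun i : 'I_n => (s i).+1) l (insub l') else 0%N.

(* Planar binary trees whose vertices are decorated by T. *)
Inductive btree (T : Type) :=
  | BLeaf of nat
  | BNode of T & btree T & btree T.
Arguments BLeaf {T}.
HB.instance Definition _ (T : Type) := gen_eqMixin (btree T).
HB.instance Definition _ (T : Type) := gen_choiceMixin (btree T).

Fixpoint bleaves T (t : btree T) : seq nat :=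
  match t with
  | BLeaf l => [:: l]
  | BNode _ t1 t2 => bleaves t1 ++ bleaves t2
  end.

Fixpoint bbind T (f : nat -> btree T) (t : btree T) : btree T :=
  match t with
  | BLeaf l => f l
  | BNode x t1 t2 => BNode x (bbind f t1) (bbind f t2)
  end.

Definition bplug T (l : nat) (b t : btree T) : btree T :=
  bbind (fun l' => if l' == l then b else BLeaf l') t.

Definition brelabel T (f : nat -> nat) : btree T -> btree T :=
  bbind (fun l => BLeaf (f l)).

(* Grafting of b, with m+1 leaves, on the leaf labelled i. *)
Definition bgraft T (m i : nat) (t b : btree T) : btree T :=
  bbind (fun l => if (l < i)%N then BLeaf l
                  else if l == i then brelabel (fun j => j + i.-1)%N b
                  else BLeaf (l + m)) t.

Section FreeOperad.
Variables (k : fieldType) (E : S2module k).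

Local Notation trees := {malg k[btree E]}.

Definition lin1 (f : btree E -> btree E) (x : trees) : trees :=
  \sum_(t <- enum_fset (msupp x)) x@_t *: << f t >>.

Definition lin2 (f : btree E -> btree E -> btree E) (x y : trees) : trees :=
  \sum_(t <- enum_fset (msupp x)) \sum_(u <- enum_fset (msupp y))
    (x@_t * y@_u) *: << f t u >>.

Definition labelled_trees n : set trees :=
  [set << t >> | t in [set t : btree E | perm_eq (bleaves t) (iota 1 n)]].

(* Linearity in each decoration, and equivariance at each vertex; the vertex
   is located by a tree c having a unique leaf labelled l. *)
Definition tree_relations : set trees :=
  [set z | exists (c : btree E) (l : nat) (a : k) (x y : E) (t u : btree E),
     count_mem l (bleaves c) = 1%N /\
     z = << bplug l (BNode (a *: x + y) t u) c >>
         - a *: << bplug l (BNode x t u) c >> - << bplug l (BNode y t u) c >>]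
  `|`
  [set z | exists (c : btree E) (l : nat) (x : E) (t u : btree E),
     count_mem l (bleaves c) = 1%N /\
     z = << bplug l (BNode (s2swap E x) t u) c >>
         - << bplug l (BNode x u t) c >>].

Definition free_part n : lmodType k :=
  subquot (labelled_trees n) tree_relations.

Definition free_cls n (x : trees) : free_part n := cls _ _ x.

Definition free_operad : operad k :=
  @Operad k free_part
    (free_cls 1%N << BLeaf 1 >>)
    (fun n s x => free_cls n (lin1 (brelabel (relabel_by s)) (rep x)))
    (fun n m i x y =>
       free_cls (n + m).+1 (lin2 (bgraft m i.+1) (rep x) (rep y))).

Definition quadratic_operad (R : set (free_operad 3%N)) : operad k :=
  quot_operad (operad_ideal R).

Definition free_wheeled : wheeled_operad k := completion free_operad.

Definition quadratic_wheeled
    (Ro : set (free_wheeled 3%N)) (Rw : set (wpart free_wheeled 1%N)) :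
    wheeled_operad k :=
  quot_wheeled (wheeled_ideal_o Ro Rw) (wheeled_ideal_w Ro Rw).

End FreeOperad.

Fixpoint inversions (s : seq nat) : nat :=
  if s is x :: s' then (count (fun y => y < x) s' + inversions s')%N else 0%N.

Section Dual.
Variables (k : fieldType) (E : S2module k).

Definition dual_swap_fun (f : 'Hom(E, k^o)) : 'Hom(E, k^o) :=
  - (f \o s2swap E)%VF.

Fact dual_swap_fun_linear : linear dual_swap_fun.
Proof.
move=> a f g; rewrite /dual_swap_fun comp_lfunDl -comp_lfunZl.
by rewrite opprD scalerN.
Qed.
HB.instance Definition _ := GRing.isLinear.Build k _ _ _
  dual_swap_fun dual_swap_fun_linear.

Fact dual_swapK :
  (linfun dual_swap_fun \o linfun dual_swap_fun)%VF = \1%VF.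
Proof.
apply/lfunP=> f; rewrite comp_lfunE !lfunE /= /dual_swap_fun.
by rewrite comp_lfunNl opprK -comp_lfunA s2swapK comp_lfun1r.
Qed.

(* E^* tensored with the sign representation. *)
Definition S2dual : S2module k := S2Module dual_swapK.

(* The decorations (top, second) of the tree t once redrawn, by equivariance
   at its two vertices, as the planar tree whose second vertex is the left
   (resp. right) input of the top one, has leaves a, b from left to right, and
   whose remaining leaf is c; None if t has another shape. *)
Definition redraw (left : bool) (a b c : nat) (t : btree E) : option (E * E) :=
  let go left' (x y : E) a' b' c' :=
    let x' := if left == left' then x else s2swap E x in
    if c != c' then None
    else if (a == a') && (b == b') then Some (x', y)
    else if (a == b') && (b == a') then Some (x', s2swap E y)
    else None in
  match t with
  | BNode x (BNode y (BLeaf a') (BLeaf b')) (BLeaf c') => go true x y a' b' c'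
  | BNode x (BLeaf c') (BNode y (BLeaf a') (BLeaf b')) => go false x y a' b' c'
  | _ => None
  end.

Definition word_sign (s : seq nat) : k := (-1) ^+ inversions s.

Definition tree_pairing (s : btree S2dual) (t : btree E) : k :=
  let value (f g : 'Hom(E, k^o)) o : k :=
    if o is Some (x, y) then f x * g y else 0 in
  match s with
  | BNode f (BNode g (BLeaf a) (BLeaf b)) (BLeaf c) =>
      word_sign [:: a; b; c] * value f g (redraw true a b c t)
  | BNode f (BLeaf c) (BNode g (BLeaf a) (BLeaf b)) =>
      - word_sign [:: c; a; b] * value f g (redraw false a b c t)
  | _ => 0
  end.

Definition pairing (x : free_operad S2dual 3%N) (y : free_operad E 3%N) : k :=
  \sum_(s <- enum_fset (msupp (rep x))) \sum_(t <- enum_fset (msupp (rep y)))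
    (rep x)@_s * (rep y)@_t * tree_pairing s t.

Definition annihilator (R : set (free_operad E 3%N)) :
    set (free_operad S2dual 3%N) :=
  [set x | forall y, R y -> pairing x y = 0].

(* The wheeled quadratic dual of the wheeled completion of Free(E)/<R>, i.e.
   of the wheeled operad presented by R in the operadic part and 0 in the
   wheeled part: the wheeled part of the annihilator is everything. *)
Definition completion_dual (R : set (free_operad E 3%N)) : wheeled_operad k :=
  @quadratic_wheeled k S2dual (annihilator R) [set: wpart (free_wheeled S2dual) 1%N].

End Dual.

Section Poisson.
Variable k : fieldType.

Local Notation E := 'rV[k]_2.

Definition pois_swap_fun (x : E) : E :=
  \row_j (if j == ord0 then x 0 j else - x 0 j).

Fact pois_swap_fun_linear : linear pois_swap_fun.
Proof.
move=> a x y; apply/rowP=> j; rewrite !mxE; case: ifP => // _.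
by rewrite opprD mulrN.
Qed.
HB.instance Definition _ := GRing.isLinear.Build k _ _ _
  pois_swap_fun pois_swap_fun_linear.

Fact pois_swapK : (linfun pois_swap_fun \o linfun pois_swap_fun)%VF = \1%VF.
Proof.
apply/lfunP=> x; rewrite comp_lfunE !lfunE /=; apply/rowP=> j.
by rewrite !mxE; case: (j == ord0); rewrite ?opprK.
Qed.

Definition pois_gen : S2module k := S2Module pois_swapK.

Local Notation tree := (btree pois_gen).
Local Notation "s *t t" := (BNode (delta_mx 0 0 : pois_gen) s t)
  (at level 40, left associativity).
Local Notation "[[ s , t ]]" := (BNode (delta_mx 0 1 : pois_gen) s t).
Local Notation x1 := (BLeaf 1 : tree).
Local Notation x2 := (BLeaf 2 : tree).
Local Notation x3 := (BLeaf 3 : tree).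

Definition pois_basic_relations : set (free_operad pois_gen 3%N) :=
  [set free_cls 3 (<< (x1 *t x2) *t x3 >> - << x1 *t (x2 *t x3) >>);
       free_cls 3 (<< [[x1, [[x2, x3]] ]] >> + << [[x2, [[x3, x1]] ]] >>
                            + << [[x3, [[x1, x2]] ]] >>);
       free_cls 3 (<< [[x1, x2 *t x3]] >> - << x2 *t [[x1, x3]] >>
                            - << [[x1, x2]] *t x3 >>)].

Definition pois_relations : set (free_operad pois_gen 3%N) :=
  lspan [set z | exists (s : 'S_3) x, pois_basic_relations x /\ z = oact s x].

Definition poisson : operad k := quadratic_operad pois_relations.

End Poisson.

(* Planar representatives of reduced trees with vertices decorated by P.  A
   vertex carries the name e of its outgoing edge, its decoration p with m+2
   inputs, and the list of the m+2 subtrees attached to these inputs.  The name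
   carried by the root of a tree with output is irrelevant. *)
Inductive tree (k : fieldType) (P : wheeled_operad k) :=
  | Leaf of nat
  | Node (e m : nat) of P m.+2 & seq (tree P).

(* [Wheel t] is the tree t, one leaf of which has label 0, with its output
   joined to that leaf; the name carried by the root of t is that of the closing
   edge.  [Wheel (Leaf 0)] is the circle without vertices.  [Outputless w ts] is
   an outputless tree with root decoration w. *)
Inductive wgraph (k : fieldType) (P : wheeled_operad k) :=
  | Wheel of tree P
  | Outputless (m : nat) of wpart P m.+1 & seq (tree P).

Arguments Leaf {k P}.

Section Cobar.
Variables (k : fieldType) (P : wheeled_operad k).

Local Notation tree := (tree P).
Local Notation wgraph := (wgraph P).
Local Notation "t # i" := (nth (Leaf 0) t i) (at level 10).

Fixpoint leaves (t : tree) : seq nat :=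
  match t with
  | Leaf l => [:: l]
  | Node _ _ _ ts => flatten (map leaves ts)
  end.

Fixpoint names (t : tree) : seq nat :=
  match t with
  | Leaf _ => [::]
  | Node e _ _ ts => e :: flatten (map names ts)
  end.

Fixpoint arity_ok (t : tree) : bool :=
  match t with
  | Leaf _ => true
  | Node _ m _ ts => (size ts == m.+2) && all arity_ok ts
  end.

Fixpoint bind (f : nat -> tree) (t : tree) : tree :=
  match t with
  | Leaf l => f l
  | Node e _ p ts => Node e p (map (bind f) ts)
  end.

Definition relabel (f : nat -> nat) : tree -> tree := bind (fun l => Leaf (f l)).

Definition plug (l : nat) (b : tree) : tree -> tree :=
  bind (fun l' => if l' == l then b else Leaf l').

Fixpoint rename (f : nat -> nat) (t : tree) : tree :=
  match t with
  | Leaf l => Leaf l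
  | Node e _ p ts => Node (f e) p (map (rename f) ts)
  end.

Definition permute m (s : 'S_m) (ts : seq tree) : seq tree :=
  [seq ts # (s i) | i : 'I_m].

Definition remove_nth (i : nat) (ts : seq tree) := take i ts ++ drop i.+1 ts.

Definition has_name (e : nat) (t : tree) : bool :=
  if t is Node e' _ _ _ then e == e' else false.

(* Contraction of the edge named e, between two distinct vertices. *)
Fixpoint contract (e : nat) (t : tree) : tree :=
  match t with
  | Leaf l => Leaf l
  | Node f m p ts =>
      let i := find (has_name e) ts in
      match ts # i with
      | Leaf _ => Node f p (map (contract e) ts)
      | Node _ m' q us =>
          @Node k P f (m + m'.+1) (@ocomp k P m.+1 m'.+1 (inord i) p q)
            (take i ts ++ us ++ drop i.+1 ts)
      end
  end.

Definition hook (ts : seq tree) : nat := find (fun t => 0%N \in leaves t) ts.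

(* [Wheel t] and [Wheel (rotate t)] are the same graph, the latter being cut
   at the previous edge of the cycle; t is unchanged if the cycle is a loop. *)
Definition rotate (t : tree) : tree :=
  match t with
  | Leaf l => Leaf l
  | Node e _ p ts =>
      let i := hook ts in
      match ts # i with
      | Leaf _ => t
      | Node _ _ _ _ =>
          plug 0 (Node e p (set_nth (Leaf 0) ts i (Leaf 0))) (ts # i)
      end
  end.

(* The number of vertices of the cycle of [Wheel t]. *)
Fixpoint cycle_length (t : tree) : nat :=
  match t with
  | Leaf _ => 0
  | Node _ _ _ ts =>
      if 0%N \in leaves t then (sumn (map cycle_length ts)).+1 else 0%N
  end.

Definition wcontract (e : nat) (g : wgraph) : wgraph :=
  match g with
  | Wheel (Leaf l) => g
  | Wheel ((Node f m p ts) as t) =>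
      if e != f then Wheel (contract e t)
      else let i := hook ts in
        match ts # i with
        | Leaf _ =>
            @Outputless k P m (@contraction k P m.+1 (inord i) p)
              (remove_nth i ts)
        | Node _ _ _ _ => Wheel (contract e (rotate t))
        end
  | Outputless m w ts =>
      let i := find (has_name e) ts in
      match ts # i with
      | Leaf _ => Outputless w (map (contract e) ts)
      | Node _ m' q us =>
          @Outputless k P (m + m'.+1) (@wcomp k P m m'.+1 (inord i) w q)
            (take i ts ++ us ++ drop i.+1 ts)
      end
  end.

Definition wleaves (g : wgraph) : seq nat :=
  match g with
  | Wheel t => leaves t
  | Outputless _ _ ts => flatten (map leaves ts)
  end.

Definition wnames (g : wgraph) : seq nat :=
  match g with
  | Wheel t => names t
  | Outputless _ _ ts => flatten (map names ts)
  end.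

Definition wbind (f : nat -> tree) (g : wgraph) : wgraph :=
  match g with
  | Wheel t => Wheel (bind f t)
  | Outputless _ w ts => Outputless w (map (bind f) ts)
  end.

Definition wrelabel (f : nat -> nat) : wgraph -> wgraph :=
  wbind (fun l => Leaf (f l)).

Definition wplug (l : nat) (b : tree) : wgraph -> wgraph :=
  wbind (fun l' => if l' == l then b else Leaf l').

Definition wrename (f : nat -> nat) (g : wgraph) : wgraph :=
  match g with
  | Wheel t => Wheel (rename f t)
  | Outputless _ w ts => Outputless w (map (rename f) ts)
  end.

(* [subtree e t] is the subtree of t above the edge e, and [prune e l t] is t
   with this subtree replaced by a leaf labelled l. *)
Fixpoint subtrees (e : nat) (t : tree) : seq tree :=
  match t with
  | Leaf _ => [::]
  | Node f _ _ ts =>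
      if e == f then [:: t] else flatten (map (subtrees e) ts)
  end.

Definition subtree (e : nat) (t : tree) : tree := head (Leaf 0) (subtrees e t).

Definition wsubtree (e : nat) (g : wgraph) : tree :=
  match g with
  | Wheel t => subtree e t
  | Outputless _ _ ts => head (Leaf 0) (flatten (map (subtrees e) ts))
  end.

Fixpoint prune (e l : nat) (t : tree) : tree :=
  match t with
  | Leaf l' => Leaf l'
  | Node f _ p ts => if e == f then Leaf l else Node f p (map (prune e l) ts)
  end.

Definition wprune (e l : nat) (g : wgraph) : wgraph :=
  match g with
  | Wheel t => Wheel (prune e l t)
  | Outputless _ w ts => Outputless w (map (prune e l) ts)
  end.

(* [tree_ok n t o]: t is a reduced tree with leaves 1, ..., n and o lists its
   internal edges.  The closing edge of the circle, whose determinant line is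
   spanned by that edge, is left out of o. *)
Definition tree_ok (n : nat) (t : tree) (o : seq nat) : bool :=
  [&& arity_ok t, perm_eq (leaves t) (iota 1 n), uniq (names t)
    & perm_eq (behead (names t)) o].

Definition graph_ok (n : nat) (g : wgraph) (o : seq nat) : bool :=
  [&& match g with
      | Wheel t => arity_ok t && perm_eq (leaves t) (iota 0 n.+1)
      | Outputless m _ ts =>
          [&& size ts == m.+1, all arity_ok ts
            & perm_eq (flatten (map leaves ts)) (iota 1 n)]
      end, uniq (wnames g) & perm_eq (wnames g) o].

(* The space of graphs decorated by the duals of the components of P and
   tensored with det is realized as the space of functions of a graph decorated
   by elements of P and of an ordering o of its internal edges (standing for
   their wedge product) which are multilinear in the decorations, compatible
   with the isomorphisms of graphs and alternating in o.  Everything being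
   finite dimensional and the number of graphs with n leaves being finite, this
   identifies the tensor product of the P(m)^* over the vertices with the
   multilinear forms on the product of the P(m). *)
Definition tree_cochain : lmodType k := tree -> seq nat -> k^o.
Definition graph_cochain : lmodType k := wgraph -> seq nat -> k^o.

(* The sign of the permutation taking the ordering o' to o. *)
Definition reorder_sign (o o' : seq nat) : k :=
  (-1) ^+ inversions [seq index e o' | e <- o].

Definition cobar_o (n : nat) : set tree_cochain :=
  [set phi : tree_cochain |
    (forall t o, phi t o != 0 -> tree_ok n t o) /\
    [/\ (forall c l e m (a : k) (p q : P m.+2) ts o,
           count_mem l (leaves c) = 1%N ->
           phi (plug l (Node e (a *: p + q) ts) c) o =
           a * phi (plug l (Node e p ts) c) o + phi (plug l (Node e q ts) c) o),
        (forall c l e m (s : 'S_m.+2) (p : P m.+2) ts o,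
           count_mem l (leaves c) = 1%N -> size ts = m.+2 ->
           phi (plug l (Node e (oact s p) ts) c) o =
           phi (plug l (Node e p (permute s ts)) c) o),
        (forall f t o, injective f ->
           phi (rename f t) (map f o) = phi t o) &
        (forall t o o', perm_eq o o' -> phi t o = reorder_sign o o' * phi t o')]].

Definition cobar_w (n : nat) : set graph_cochain :=
  [set phi : graph_cochain |
    (forall g o, phi g o != 0 -> graph_ok n g o) /\
    [/\ (forall c l e m (a : k) (p q : P m.+2) ts o,
           count_mem l (wleaves c) = 1%N ->
           phi (wplug l (Node e (a *: p + q) ts) c) o =
           a * phi (wplug l (Node e p ts) c) o
           + phi (wplug l (Node e q ts) c) o),
        (forall m (a : k) (u v : wpart P m.+1) ts o,
           phi (Outputless (a *: u + v) ts) o =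
           a * phi (Outputless u ts) o + phi (Outputless v ts) o),
        (forall c l e m (s : 'S_m.+2) (p : P m.+2) ts o,
           count_mem l (wleaves c) = 1%N -> size ts = m.+2 ->
           phi (wplug l (Node e (oact s p) ts) c) o =
           phi (wplug l (Node e p (permute s ts)) c) o) &
        (forall m (s : 'S_m.+1) (u : wpart P m.+1) ts o, size ts = m.+1 ->
           phi (Outputless (wact s u) ts) o =
           phi (Outputless u (permute s ts)) o)] /\
    [/\ (forall t t' o,
           count_mem 0%N (leaves t) = 1%N -> count_mem 0%N (leaves t') = 1%N ->
           phi (Wheel (plug 0 t t')) o = phi (Wheel (plug 0 t' t)) o),
        (forall f g o, injective f ->
           phi (wrename f g) (map f o) = phi g o) &
        (forall g o o', perm_eq o o' -> phi g o = reorder_sign o o' * phi g o')]].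

Definition omit (j : nat) (o : seq nat) : seq nat := take j o ++ drop j.+1 o.

(* Dual to the contraction of an edge e, the wedge factor being e /\ o. *)
Definition d_o (n : nat) (phi : tree_cochain) : tree_cochain := fun t o =>
  if tree_ok n t o
  then \sum_(j < size o) (-1) ^+ j * phi (contract (nth 0%N o j) t) (omit j o)
  else 0.

Definition d_w (n : nat) (phi : graph_cochain) : graph_cochain := fun g o =>
  if graph_ok n g o
  then \sum_(j < size o) (-1) ^+ j * phi (wcontract (nth 0%N o j) g) (omit j o)
  else 0.

(* The sign representations sgn_n form the operadic suspension: grafting a tree
   with m leaves on the i-th leaf gives (-1)^((i-1)(m-1)), and joining the i-th
   of n leaves to the output gives (-1)^(n-i); this is what makes the operations
   below equivariant for the action twisted by the sign.  The new edge e of a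
   grafting of T' on T is inserted in the position o /\ e /\ o', i.e. e /\ o /\ o'
   with the Koszul sign (-1)^|o|, and the one of a contraction comes first.
   With these signs the wheeled operad axioms hold without extra signs in the top
   degrees (all vertices of T, T' binary), where the quadratic dual lives; in
   lower degrees they hold up to Koszul signs. *)

Definition cobar_unit : tree_cochain := fun t o =>
  if (t, o) is (Leaf 1, [::]) then 1 else 0.

Definition cobar_act n (s : 'S_n) (phi : tree_cochain) : tree_cochain :=
  fun t o => (-1) ^+ s * phi (relabel (relabel_by (perm_inv s)) t) o.

Definition cobar_wact n (s : 'S_n) (phi : graph_cochain) : graph_cochain :=
  fun g o => (-1) ^+ s * phi (wrelabel (relabel_by (perm_inv s)) g) o.

(* The coefficient of a graph in a grafting is obtained by cutting it at its
   internal edges e.  The leaves i+1, ..., i+m+1 are those of the grafted tree;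
   if the subtree above e has other leaves then the second factor vanishes, as
   its relabelled leaves are not 1, ..., m+1.  Grafting the trivial tree, or
   grafting on it, creates no edge. *)
Definition outer_label (i m l : nat) : nat := if (l <= i)%N then l else (l - m)%N.
Definition inner_label (i l : nat) : nat := (l - i)%N.

Definition cobar_comp n m (i : 'I_n.+1) (phi psi : tree_cochain) :
    tree_cochain := fun t o =>
  if m == 0%N then phi t o * psi (Leaf 1) [::]
  else if n == 0%N then phi (Leaf 1) [::] * psi t o
  else if tree_ok (n + m).+1 t o then
    (-1) ^+ (i * m) * \sum_(e <- o)
      (let t1 := prune e i.+1 (relabel (outer_label i m) t) in
       let t2 := relabel (inner_label i) (subtree e t) in
       let o1 := [seq f <- o | f \in names t1] in
       let o2 := [seq f <- o | (f \in names t2) && (f != e)] in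
       reorder_sign o (o1 ++ e :: o2) * phi t1 o1 * psi t2 o2)
  else 0.

Definition cobar_wcomp n m (i : 'I_n.+1) (phi : graph_cochain)
    (psi : tree_cochain) : graph_cochain := fun g o =>
  if m == 0%N then phi g o * psi (Leaf 1) [::]
  else if graph_ok (n + m).+1 g o then
    (-1) ^+ (i * m) * \sum_(e <- o)
      (let g1 := wprune e i.+1 (wrelabel (outer_label i m) g) in
       let t2 := relabel (inner_label i) (wsubtree e g) in
       let o1 := [seq f <- o | f \in wnames g1] in
       let o2 := [seq f <- o | (f \in names t2) && (f != e)] in
       reorder_sign o (o1 ++ e :: o2) * phi g1 o1 * psi t2 o2)
  else 0.

(* The coefficient of a wheeled tree in a contraction is obtained by cutting its
   cycle at each of its edges. *)
Definition unhook_label (i l : nat) : nat :=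
  if l == 0%N then i.+1 else if (l <= i)%N then l else l.+1.

Definition cobar_contraction n (i : 'I_n.+1) (phi : tree_cochain) :
    graph_cochain := fun g o =>
  if graph_ok n g o then
    match g with
    | Wheel (Leaf _) => phi (Leaf 1) [::]
    | Wheel t =>
        (-1) ^+ (n - i) * \sum_(j < cycle_length t)
          (let t' := iter j rotate t in
           let e := head 0%N (names t') in
           reorder_sign o (e :: rem e o) *
           phi (relabel (unhook_label i) t') (rem e o))
    | Outputless _ _ _ => 0
    end
  else 0.

Definition cocycles_o n : set tree_cochain :=
  [set phi | cobar_o n phi /\ d_o n phi = 0].
Definition coboundaries_o n : set tree_cochain := [set d_o n phi | phi in cobar_o n].
Definition cocycles_w n : set graph_cochain :=
  [set phi | cobar_w n phi /\ d_w n phi = 0].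
Definition coboundaries_w n : set graph_cochain := [set d_w n phi | phi in cobar_w n].

Definition cohomology_o n : lmodType k := subquot (cocycles_o n) (coboundaries_o n).
Definition cohomology_w n : lmodType k := subquot (cocycles_w n) (coboundaries_w n).

Definition cobar_cohomology : wheeled_operad k :=
  @WheeledOperad k
    (@Operad k cohomology_o
      (cls _ _ cobar_unit)
      (fun n s x => cls _ _ (cobar_act s (rep x)))
      (fun n m i x y => cls _ _ (cobar_comp m i (rep x) (rep y))))
    cohomology_w
    (fun n s u => cls _ _ (cobar_wact s (rep u)))
    (fun n m i u y => cls _ _ (cobar_wcomp m i (rep u) (rep y)))
    (fun n i x => cls _ _ (cobar_contraction i (rep x))).

End Cobar.

(* P' is the wheeled quadratic dual of P; it depends on a quadratic presentation
   of P, hence is passed explicitly. *)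
Definition wheeled_koszul (k : fieldType) (P P' : wheeled_operad k) : Prop :=
  wheeled_iso (cobar_cohomology P) P'.

(* Main.v *)
Require Import Defs.
From mathcomp Require Import all_boot all_algebra.
From HB Require Import structures.
From mathcomp Require Import fingroup perm.
From mathcomp Require Import all_boot all_algebra ring zify.
From mathcomp Require Import boolp classical_sets functions.
From mathcomp Require Import finmap monalg.

(** A wheel can be cut open, so every element of the wheeled part of a quadratic
    wheeled operad is a contraction
    ([quadratic_contraction_surjective]).  Hence, if Poiss were wheeled Koszul
    after wheeled completion, then every class in the wheeled cohomology of its
    cobar complex would be a contraction.  This fails in arity 3 and degree 2.

    Write m for the product, h for the bracket and w for the contraction of h at
    its last input, that is the trace of ad.  The trace vanishes on commutators,
    so w o [x, y], the trace of [ad x, ad y], is zero ([wcomp_brac]); and the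
    Leibniz rule makes the cyclic sum of [x1, x2 x3] zero ([leibniz_rot]).
    Therefore the cyclic sum of the outputless trees w o (h o_2 m) has zero
    boundary: pairing with it ([test_cycle]) kills the coboundaries
    ([test_cycle_coboundary]).  The pairing also kills contractions, which are
    supported on wheeled trees.  It remains to find a cocycle on which it is
    nonzero.

    The cocycle [phi] is symmetric in the leaves and sees the decorations through
    a few functionals: the coefficients M of m and H of h on P(2), and on P(3)
    two triples of functionals, Y on the part with one bracket and D on the Lie
    part, indexed by the inputs and permuted by S_3 without signs.  On a wheel
    with a ternary vertex p and a binary vertex q attached to its input j the
    value is 2 D_j(p) M(q) if q is outside of the cycle, and
    H_i(q) Y_j(p) - 2 M(q) D_j(p) if q is on the cycle and i is its input on the
    cycle; on the outputless trees above it is - 2 H(h) M(m) times the value of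
    H on w.  By the table of D and Y on the composites of two binary operations
    ([compD], [compY]) the coboundary of [phi] vanishes on wheeled binary trees
    with three vertices ([shape3_cocycle]), which are the only graphs where it
    could be nonzero.  The value of [phi] on the cycle is - 6
    ([test_cycle_phi]). *)

Set Implicit Arguments.
Unset Strict Implicit.
Unset Printing Implicit Defensive.

Import GRing.Theory.

Local Open Scope classical_set_scope.
Local Open Scope quotient_scope.
Local Open Scope ring_scope.

(** * Spans, subquotients and linear extensions *)

Section Spans.
Variables (k : fieldType) (V W : lmodType k).
Implicit Types (A B S : set V).

Lemma sub_lspan A : A `<=` lspan A.
Proof. by move=> x Ax S _; apply. Qed.

Lemma lspan_le A S : is_subspace S -> A `<=` S -> lspan A `<=` S.
Proof. by move=> sS AS x; apply. Qed.

Lemma lspan0 A : lspan A 0.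
Proof. by case: (lspan_subspace A). Qed.

Lemma lspanDZ A a x y : lspan A x -> lspan A y -> lspan A (a *: x + y).
Proof. by case: (lspan_subspace A) => _; apply. Qed.

Lemma lspanD A x y : lspan A x -> lspan A y -> lspan A (x + y).
Proof. by move=> Ax Ay; rewrite -[x]scale1r; apply: lspanDZ. Qed.

Lemma lspanZ A a x : lspan A x -> lspan A (a *: x).
Proof. by move=> Ax; rewrite -[_ *: _]addr0; apply: lspanDZ => //; apply: lspan0. Qed.

Lemma lspanB A x y : lspan A x -> lspan A y -> lspan A (x - y).
Proof. by move=> Ax Ay; rewrite -scaleN1r; apply: lspanD => //; apply: lspanZ. Qed.

Lemma subspace_preim (L : {linear V -> W}) (S : set W) :
  is_subspace S -> is_subspace [set x | S (L x)].
Proof.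
by move=> [S0 SS]; split=> [|a x y] /=; rewrite ?linear0 // linearP; apply: SS.
Qed.

Lemma subspace0 : is_subspace [set 0 : W].
Proof. by split=> // a x y /= -> ->; rewrite scaler0 addr0. Qed.

End Spans.

Section Classes.
Variables (k : fieldType) (V : lmodType k) (A B : set V).

Local Notation cls := (cls A B).

Lemma rep_span (q : subquot A B) : lspan A (rep q).
Proof. by rewrite /rep; case: (repr q) => v /= /asboolP. Qed.

Lemma cls_repr (q : subquot A B) : cls (rep q) = q.
Proof.
by rewrite /Defs.cls /rep -[span_val _]/(\val _) valK /= reprK.
Qed.

Lemma clsE v (Av : in_span A v) : cls v = \pi_(subquot A B) (SpanOf Av).
Proof. by rewrite /Defs.cls insubT. Qed.

Lemma rep_cls v : lspan A v -> lspan B (rep (cls v) - v).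
Proof. by move=> /asboolP Av; rewrite (clsE Av); apply: sq_repr. Qed.

Lemma cls_eq u v : lspan A u -> lspan A v -> lspan B (u - v) -> cls u = cls v.
Proof.
by move=> /asboolP Au /asboolP Av uv; rewrite (clsE Au) (clsE Av); apply: sq_eq.
Qed.

(** A vector u outside of the span of A has the class of 0 by convention. *)
Lemma cls_eq0 u : lspan B u -> cls u = 0.
Proof.
have e0 : cls 0 = 0.
  have A0 : in_span A 0 by apply/asboolP; apply: lspan0.
  by rewrite (clsE A0); congr (\pi _); apply: val_inj.
case: (asboolP (lspan A u)) => Au Bu.
  by rewrite -e0; apply: cls_eq => //; [apply: lspan0|rewrite subr0].
rewrite -e0 /Defs.cls insubN ?insubT //; first by apply/asboolP; apply: lspan0.
  move=> A0 /=; congr (\pi _); exact: val_inj.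
exact/asboolP.
Qed.

Lemma cls_lin a u v : lspan A u -> lspan A v ->
  cls (a *: u + v) = a *: cls u + cls v.
Proof.
move=> Au Av; move/asboolP: (Au) => Iu; move/asboolP: (Av) => Iv.
have /asboolP Iuv := lspanDZ a Au Av.
rewrite (clsE Iu) (clsE Iv) (clsE Iuv) -[RHS]/(sqadd (sqscale _ _) _).
rewrite -sq_piZ -sq_piD; congr (\pi _); apply: val_inj.
by rewrite -[RHS]/(span_val _) span_valD span_valZ.
Qed.

(** The second alternative is the case of a vector v outside of the span of A,
    whose class is 0 by convention. *)
Lemma cls_eq_inv u v : lspan A u -> cls u = cls v -> lspan B (u - v) \/ lspan B u.
Proof.
move=> Au uv; case: (asboolP (lspan A v)) => Av.
  left; have := lspanB (rep_cls Av) (rep_cls Au).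
  by rewrite uv opprB [X in lspan _ X]addrC addrA subrK.
right; have v0 : cls v = cls 0.
  rewrite /Defs.cls insubN; last exact/asboolP.
  have A0 : in_span A 0 by apply/asboolP; apply: lspan0.
  by rewrite insubT /=; congr (\pi _); apply: val_inj.
have := lspanB (rep_cls (@lspan0 k V A)) (rep_cls Au).
by rewrite uv v0 opprB [X in lspan _ X]addrC addrA subrK subr0.
Qed.

Lemma clsW (q : subquot A B) : exists2 v, lspan A v & q = cls v.
Proof. by exists (rep q); rewrite ?cls_repr //; apply: rep_span. Qed.

Lemma rep_lin a (q r : subquot A B) :
  lspan B (rep (a *: q + r) - (a *: rep q + rep r)).
Proof.
rewrite -[X in rep (X)](_ : cls (a *: rep q + rep r) = _); last first.
  by rewrite cls_lin ?cls_repr //; apply: rep_span.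
by apply: rep_cls; apply: lspanDZ; apply: rep_span.
Qed.

End Classes.
Arguments rep_cls {k V A B v}.
Arguments rep_lin {k V A B}.
Arguments cls_eq {k V A B u v}.

Section LinearExtension.
Variables (k : fieldType) (K : choiceType) (V : lmodType k) (f : K -> V).

Definition lext (z : {malg k[K]}) : V :=
  \sum_(t <- enum_fset (msupp z)) z@_t *: f t.

Lemma lextE (D : {fset K}) z : (msupp z `<=` D)%fset ->
  lext z = \sum_(t <- enum_fset D) z@_t *: f t.
Proof.
move=> zD; rewrite /lext (big_fset_incl _ zD) // => t _ tz.
by rewrite mcoeff_outdom ?scale0r.
Qed.

Fact lext_linear : linear lext.
Proof.
move=> a x y; pose D := (msupp x `|` msupp y `|` msupp (a *: x + y))%fset.
rewrite (@lextE D x) ?(@lextE D y) ?(@lextE D (a *: x + y)).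
- rewrite scaler_sumr -big_split; apply: eq_bigr => t _.
  by rewrite mcoeffD mcoeffZ scalerDl scalerA.
- exact: fsubsetUr.
- by apply/fsubsetP => t ty; rewrite !inE ty orbT.
- by apply/fsubsetP => t tx; rewrite !inE tx.
Qed.
HB.instance Definition _ :=
  GRing.isLinear.Build k {malg k[K]} V *:%R lext lext_linear.

Lemma lextU t : lext << t >> = f t.
Proof.
rewrite (@lextE [fset t]%fset); last exact: msuppU_le.
by rewrite big_seq_fset1 mcoeffUU scale1r.
Qed.

End LinearExtension.

(** * Planar binary trees and grafting *)

Section BinaryTrees.
Variable T : Type.
Implicit Types (t u b c : btree T) (f g : nat -> btree T).

Lemma bleaves_bind f t :
  bleaves (bbind f t) = flatten [seq bleaves (f l) | l <- bleaves t].
Proof. by elim: t => [l|x t IHt u IHu] /=; rewrite ?cats0 // map_cat flatten_cat IHt IHu. Qed.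

Lemma bleaves_relabel (f : nat -> nat) t :
  bleaves (brelabel f t) = map f (bleaves t).
Proof. by elim: t => //= x t -> u ->; rewrite map_cat. Qed.

Lemma bbind_bind f g t : bbind g (bbind f t) = bbind (fun l => bbind g (f l)) t.
Proof. by elim: t => //= x t -> u ->. Qed.

Lemma eq_in_bbind f g t : {in bleaves t, f =1 g} -> bbind f t = bbind g t.
Proof.
elim: t => [l|x t IHt u IHu] /= fg; first by apply: fg; rewrite inE.
by rewrite IHt ?IHu // => l lt; apply: fg; rewrite mem_cat lt ?orbT.
Qed.

Lemma bbind_leaf t : bbind BLeaf t = t.
Proof. by elim: t => //= x t -> u ->. Qed.

Lemma bplug_id l b t : l \notin bleaves t -> bplug l b t = t.
Proof.
move=> lt; rewrite -[RHS]bbind_leaf; apply: eq_in_bbind => l' l't.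
by case: eqP => // e; rewrite -e l't in lt.
Qed.

Definition fresh (s : seq nat) : nat := (sumn s).+1.

Lemma fresh_notin s : fresh s \notin s.
Proof.
apply/negP => /(nthP 0%N) [i si E].
suff : (nth 0 s i <= sumn s)%N by rewrite E ltnn.
elim: s i si {E} => // x s IHs [|i] /= si; first exact: leq_addr.
by apply: leq_trans (leq_addl _ _); apply: IHs.
Qed.

(** The other leaves of a context may be replaced by trees having leaves with
    the label of its hole; giving the hole a fresh label keeps it unique. *)
Lemma bbind_plug g l c : count_mem l (bleaves c) = 1%N ->
  exists c' l', count_mem l' (bleaves c') = 1%N /\
    forall b, bbind g (bplug l b c) = bplug l' (bbind g b) c'.
Proof.
move=> lc; pose L := fresh (bleaves (bbind g c)).
exists (bbind (fun l' => if l' == l then BLeaf L else g l') c), L; split.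
  have gL l' : l' \in bleaves c -> L \notin bleaves (g l').
    move=> l'c; apply: contra (fresh_notin (bleaves (bbind g c))) => Lg.
    by rewrite {2}bleaves_bind; apply/flattenP; exists (bleaves (g l')) => //; apply: map_f.
  rewrite bleaves_bind count_flatten -[RHS]lc -sumn_count -map_comp.
  congr (sumn _); apply/eq_in_map => l' l'c /=.
  by case: eqP => _ /=; rewrite ?eqxx //; apply/count_memPn; apply: gL.
move=> b; rewrite /bplug !bbind_bind; apply: eq_in_bbind => l' l'c /=.
case: eqP => _ /=; first by rewrite eqxx.
rewrite -[RHS]/(bplug L (bbind g b) (g l')) bplug_id //.
apply: contra (fresh_notin (bleaves (bbind g c))) => Lg.
by rewrite {2}bleaves_bind; apply/flattenP; exists (bleaves (g l')) => //; apply: map_f.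
Qed.

Lemma bplug_plug L t l c :
  count_mem L (bleaves t) = 1%N -> count_mem l (bleaves c) = 1%N ->
  exists c' l', count_mem l' (bleaves c') = 1%N /\
    forall b, bplug L (bplug l b c) t = bplug l' b c'.
Proof.
move=> Lt lc; pose M := fresh (bleaves t ++ bleaves c).
have /negP Mtc := fresh_notin (bleaves t ++ bleaves c).
have Mt : M \notin bleaves t by apply/negP => h; apply: Mtc; rewrite mem_cat h.
have Mc : M \notin bleaves c by apply/negP => h; apply: Mtc; rewrite mem_cat h orbT.
exists (bplug L (bplug l (BLeaf M) c) t), M; split.
  rewrite bleaves_bind count_flatten -[RHS]Lt -sumn_count -map_comp.
  congr (sumn _); apply/eq_in_map => l' l't /=.
  case: eqP => _ /=; last first.
    by rewrite addn0; case: eqP => // e; rewrite -e l't in Mt.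
  rewrite bleaves_bind count_flatten -[RHS]lc -sumn_count -map_comp.
  congr (sumn _); apply/eq_in_map => j jc /=.
  case: eqP => _ /=; rewrite ?eqxx // addn0.
  by case: eqP => // e; rewrite -e jc in Mc.
move=> b; rewrite /bplug !bbind_bind; apply: eq_in_bbind => l' l't /=.
case: eqP => _ /=; last by case: eqP => // e; rewrite -e l't in Mt.
rewrite bbind_bind; apply: eq_in_bbind => j jc /=.
by case: eqP => _ /=; rewrite ?eqxx //; case: eqP => // e; rewrite -e jc in Mc.
Qed.

Lemma relabel_by_iota n (s : 'S_n) :
  perm_eq (map (relabel_by s) (iota 1 n)) (iota 1 n).
Proof.
have E (h : 'I_n -> 'I_n) :
    [seq (h i).+1 | i : 'I_n] = map succn (map val (map h (enum 'I_n))).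
  by rewrite /image_mem -!map_comp.
have E1 : iota 1 n = [seq (i : 'I_n).+1 | i : 'I_n].
  by rewrite (E id) map_id val_enum_ord -[1%N]addn0 iotaDl.
have E2 : map (relabel_by s) (iota 1 n) = [seq (s i).+1 | i : 'I_n].
  rewrite E1 /image_mem -map_comp; apply: eq_map => i /=.
  by rewrite (valK i).
rewrite E2 E1 (E s) (E id) !perm_map // map_id.
apply: uniq_perm; rewrite ?enum_uniq //.
  by rewrite map_inj_uniq ?enum_uniq //; apply: perm_inj.
move=> i; rewrite mem_enum; apply/mapP; exists (perm_inv s i); rewrite ?mem_enum //.
by rewrite permKV.
Qed.

(** Grafting in the i-th leaf inserts the m+1 new labels in place of i and
    shifts the labels above i by m. *)
Lemma bgraft_iota n m i t b : (0 < i <= n.+1)%N ->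
  perm_eq (bleaves t) (iota 1 n.+1) -> perm_eq (bleaves b) (iota 1 m.+1) ->
  perm_eq (bleaves (bgraft m i t b)) (iota 1 (n + m).+1).
Proof.
case: i => // i /andP[_ ilen] pt pb; rewrite /bgraft bleaves_bind.
set F := (X in map X _).
apply: perm_trans (perm_flatten (perm_map F pt)) _.
have [r En] : exists r, n = (i + r)%N by exists (n - i)%N; rewrite subnKC.
rewrite {}En {ilen} -addnS -!addnA (_ : (i + (r + m)).+1 = i + (m.+1 + r))%N; last first.
  by rewrite addSn addnS (addnC m).
rewrite !iotaD /= map_cat flatten_cat /= perm_cat //.
  rewrite (_ : map F _ = [seq [:: l] | l <- iota 1 i]) ?flatten_seq1 //.
  apply/eq_in_map => l; rewrite mem_iota => /andP[l1 li].
  by rewrite /F /= -[(l < i.+1)%N]/(l < 1 + i)%N li.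
rewrite add1n -cat_cons -[_ :: iota _ _]/(iota i.+1 m.+1); apply: perm_cat.
  rewrite /F ltnn eqxx bleaves_relabel /=.
  apply: perm_trans (perm_map _ pb) _.
  rewrite (_ : map _ _ = iota i.+1 m.+1) //.
  by rewrite -[i.+1]addn1 iotaDl; apply: eq_map => l; rewrite addnC.
rewrite (_ : map F _ = [seq [:: l] | l <- iota (i.+1 + m.+1) r]) ?flatten_seq1 //.
rewrite [(i.+1 + _)%N]addnC addSnnS.
rewrite iotaDl -map_comp; apply/eq_in_map => l; rewrite mem_iota => /andP[l1 _].
by rewrite /F /= ltnNge (ltnW l1) /= gtn_eqF // addnC.
Qed.
End BinaryTrees.

(** * The operations of the free operad *)

Section FreeOperadOperations.
Variables (k : fieldType) (E : S2module k).
Local Notation trees := {malg k[btree E]}.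
Local Notation rels := (tree_relations (E := E)).
Local Notation labelled := (@labelled_trees k E).
Implicit Types (F : btree E -> btree E) (v w : trees).

Lemma lin1E F v : lin1 F v = lext (fun t => << F t >> : trees) v.
Proof. by []. Qed.

Lemma lin2E (F : btree E -> btree E -> btree E) v w :
  lin2 F v w = lext (fun t => lext (fun u => << F t u >> : trees) w) v.
Proof.
rewrite /lin2 /lext; apply: eq_bigr => t _; rewrite scaler_sumr.
by apply: eq_bigr => u _; rewrite scalerA.
Qed.

Lemma lin2_flip (F : btree E -> btree E -> btree E) v w :
  lin2 F v w = lext (fun u => lext (fun t => << F t u >> : trees) v) w.
Proof.
rewrite /lin2 exchange_big /lext; apply: eq_bigr => t _; rewrite scaler_sumr.
by apply: eq_bigr => u _; rewrite scalerA mulrC.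
Qed.

Lemma lext_in (V : lmodType k) (S : set V) (f : btree E -> V) v :
  is_subspace S -> (forall t, S (f t)) -> S (lext f v).
Proof.
move=> [S0 SD] Sf; rewrite /lext; elim/big_rec: _ => // t x _ Sx.
exact: SD.
Qed.

(** The operations of the free operad act on trees through such maps, which
    move a vertex without changing its decoration; this is what makes them
    respect the relations at a vertex. *)
Definition context_map F := forall c l, count_mem l (bleaves c) = 1%N ->
  exists c' l' h, count_mem l' (bleaves c') = 1%N /\
    forall x t u, F (bplug l (BNode x t u) c) = bplug l' (BNode x (h t) (h u)) c'.

(** A function of trees that is multilinear and equivariant at every vertex
    factors through the free operad. *)
Lemma lext_relations (V : lmodType k) (f : btree E -> V) :
  (forall c l a x y t u, count_mem l (bleaves c) = 1%N ->
     f (bplug l (BNode (a *: x + y) t u) c) =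
     a *: f (bplug l (BNode x t u) c) + f (bplug l (BNode y t u) c)) ->
  (forall c l x t u, count_mem l (bleaves c) = 1%N ->
     f (bplug l (BNode (s2swap E x) t u) c) = f (bplug l (BNode x u t) c)) ->
  forall v, lspan rels v -> lext f v = 0.
Proof.
move=> flin fswap; apply: (lspan_le (S := [set v | lext f v = 0])).
  exact: (subspace_preim (lext f) (subspace0 _)).
move=> z [] [c [l]] => [[a [x [y [t [u [cl ->]]]]]]|[x [t [u [cl ->]]]]] /=.
  by rewrite !linearB linearZ /= !lextU flin // addrAC addrK subrr.
by rewrite linearB /= !lextU fswap // subrr.
Qed.

Lemma context_map_relations F v : context_map F ->
  lspan rels v -> lspan rels (lin1 F v).
Proof.
move=> cF; apply: (lspan_le (S := [set v | lspan rels (lin1 F v)])).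
  exact: (subspace_preim (lext _) (lspan_subspace rels)).
move=> z [] [c [l]] => [[a [x [y [t [u [cl ->]]]]]]|[x [t [u [cl ->]]]]] /=;
  have [c' [l' [h [cl' Fh]]]] := cF _ _ cl; apply: sub_lspan; rewrite lin1E.
  rewrite !linearB linearZ /= !lextU !Fh; left.
  by exists c', l', a, x, y, (h t), (h u).
by rewrite linearB /= !lextU !Fh; right; exists c', l', x, (h t), (h u).
Qed.

Lemma bbind_context g : context_map (bbind g).
Proof.
by move=> c l /(bbind_plug g)[c' [l' [cl' H]]]; exists c', l', (bbind g).
Qed.

Lemma bplug_bbind_context L s g : count_mem L (bleaves s) = 1%N ->
  context_map (fun b => bplug L (bbind g b) s).
Proof.
move=> sL c l cl; have [c' [l' [cl' H]]] := bbind_plug g cl.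
have [c2 [l2 [cl2 H2]]] := bplug_plug sL cl'.
by exists c2, l2, (bbind g); split=> // x t u; rewrite H H2.
Qed.

(** The leaf i is the only one where the second tree is inserted, hence
    grafting is multilinear in the vertices of that tree; the label L is out
    of reach of the shifted labels. *)
Lemma bgraft_context n m i s : (0 < i <= n.+1)%N ->
  perm_eq (bleaves s) (iota 1 n.+1) -> context_map (bgraft m i s).
Proof.
move=> ilen ps c l cl; pose L := ((sumn (bleaves s)) + m).+2.
pose s' := bbind (fun l => if (l < i)%N then BLeaf l
                  else if l == i then BLeaf L else BLeaf (l + m)%N) s : btree E.
have Lbig j : j \in bleaves s -> (j + m < L)%N.
  move=> js; rewrite ltnS; apply: leqW; rewrite leq_add2r; rewrite (perm_mem ps) mem_iota in js.
  rewrite (perm_sumn ps) -/(sumn (iota 1 n.+1)).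
  elim: {ps s' L cl} n.+1 1%N js => [|N IHN] q.
    by rewrite addn0 => /andP[a b]; rewrite ltnNge a in b.
  move=> /=; rewrite -addSnnS => /andP[qj jq].
  case: (ltngtP q j) qj => // [qj|<-] _; last exact: leq_addr.
  by apply: leq_trans (leq_addl _ _); apply: IHN; rewrite qj.
have sL : count_mem L (bleaves s') = 1%N.
  rewrite bleaves_bind count_flatten -map_comp.
  have -> : 1%N = sumn [seq (pred1 i j : nat) | j <- bleaves s].
    rewrite sumn_count (permP ps) count_uniq_mem ?iota_uniq // mem_iota.
    by rewrite add1n ltnS ilen.
  congr (sumn _); apply/eq_in_map => j js /=; have := Lbig _ js.
  case: (ltngtP j i) => [ji|ij|ji] /=; rewrite ?eqxx // addn0.
    by move=> jL; rewrite ltn_eqF // (leq_ltn_trans _ jL) // leq_addr.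
  by move=> jL; rewrite ltn_eqF.
have [c' [l' [h [cl' H]]]] := bplug_bbind_context (fun j => BLeaf (j + i.-1)%N) sL cl.
exists c', l', h; split=> // x t u; rewrite -H /bgraft [in RHS]/bplug [RHS]bbind_bind.
apply: eq_in_bbind => j js; have := Lbig _ js.
case: (ltngtP j i) => [ji|ij|->] /=; rewrite ?eqxx //.
  by move=> jL; rewrite ltn_eqF // (leq_ltn_trans _ jL) // leq_addr.
by move=> jL; rewrite ltn_eqF.
Qed.

Lemma lin1_labelled n F v :
  (forall t, perm_eq (bleaves t) (iota 1 n) -> perm_eq (bleaves (F t)) (iota 1 n)) ->
  lspan (labelled n) v -> lspan (labelled n) (lin1 F v).
Proof.
move=> nF; apply: (lspan_le (S := [set v | lspan _ (lin1 F v)])).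
  exact: (subspace_preim (lext _) (lspan_subspace _)).
move=> _ [t /= pt <-]; rewrite lin1E lextU; apply: sub_lspan.
by exists (F t) => //; apply: nF.
Qed.

Lemma bgraft_labelled n m (i : 'I_n.+1) v w :
  lspan (labelled n.+1) v -> lspan (labelled m.+1) w ->
  lspan (labelled (n + m).+1) (lin2 (bgraft m i.+1) v w).
Proof.
move=> + wm; rewrite lin2E; move: v.
apply: (lspan_le (S := [set v | lspan _ (lext _ v)])).
  exact: (subspace_preim (lext _) (lspan_subspace _)).
move=> _ [t /= pt <-]; rewrite lextU.
move: w wm; apply: (lspan_le (S := [set w | lspan _ (lext _ w)])).
  exact: (subspace_preim (lext _) (lspan_subspace _)).
move=> _ [u /= pu <-]; rewrite lextU; apply: sub_lspan.
by exists (bgraft m i.+1 t u) => //=; apply: bgraft_iota => //; apply: ltn_ord.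
Qed.

Lemma free_oactE n (s : 'S_n) v : lspan (labelled n) v ->
  oact s (free_cls n v : free_operad E n) =
  free_cls n (lin1 (brelabel (relabel_by s)) v).
Proof.
move=> nv; have nr := rep_span (free_cls n v).
have lab (t : btree E) : perm_eq (bleaves t) (iota 1 n) ->
    perm_eq (bleaves (brelabel (relabel_by s) t)) (iota 1 n).
  by move=> pt; rewrite bleaves_relabel (perm_trans (perm_map _ pt)) // relabel_by_iota.
apply: cls_eq; [exact: lin1_labelled|exact: lin1_labelled|].
rewrite !lin1E -linearB; apply: context_map_relations; first exact: bbind_context.
exact: rep_cls.
Qed.

(** Both representatives can be replaced one after the other: the relations in
    the first factor are preserved by grafting any tree, those in the second
    factor by grafting on a tree with labels 1, ..., n+1, which has a single
    leaf i. *)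
Lemma free_ocompE n m (i : 'I_n.+1) v w :
  lspan (labelled n.+1) v -> lspan (labelled m.+1) w ->
  ocomp i (free_cls n.+1 v : free_operad E _) (free_cls m.+1 w) =
  free_cls (n + m).+1 (lin2 (bgraft m i.+1) v w).
Proof.
move=> nv mw; have nr := rep_span (free_cls n.+1 v).
have mr := rep_span (free_cls m.+1 w).
apply: cls_eq; [exact: bgraft_labelled|exact: bgraft_labelled|].
set v' := rep _ in nr *; set w' := rep _ in mr *.
have -> : lin2 (bgraft m i.+1) v' w' - lin2 (bgraft m i.+1) v w =
  lin2 (bgraft m i.+1) (v' - v) w' + lin2 (bgraft m i.+1) v (w' - w).
  have -> : lin2 (bgraft m i.+1) (v' - v) w' =
      lin2 (bgraft m i.+1) v' w' - lin2 (bgraft m i.+1) v w'.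
    by rewrite !lin2E linearB.
  have -> : lin2 (bgraft m i.+1) v (w' - w) =
      lin2 (bgraft m i.+1) v w' - lin2 (bgraft m i.+1) v w.
    by rewrite !lin2_flip linearB.
  by rewrite addrA subrK.
apply: lspanD.
  have : lspan rels (v' - v) by apply: rep_cls.
  move: (v' - v) => z rz; rewrite lin2_flip.
  apply: lext_in => [|u]; first exact: lspan_subspace.
  exact: (context_map_relations (bbind_context _)).
have : lspan rels (w' - w) by apply: rep_cls.
move: (w' - w) => z rz.
move: nv {nr v'}; rewrite lin2E; move: v.
apply: (lspan_le (S := [set v | lspan rels (lext _ v)])).
  exact: (subspace_preim (lext _) (lspan_subspace _)).
move=> _ [t /= pt <-]; rewrite lextU.
apply: context_map_relations rz; apply: bgraft_context pt; exact: ltn_ord.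
Qed.

End FreeOperadOperations.

(** * Coordinates of Poisson monomials in low arity *)

Section TreeCoordinates.
Variable k : fieldType.
Local Notation E := (pois_gen k).
Implicit Types (t u b c : btree E).

Definition prod_coef (x : E) : k := (x : 'rV[k]_2) 0 0.
Definition brac_coef (x : E) : k := (x : 'rV[k]_2) 0 1.

Lemma prod_coefD a (x y : E) :
  prod_coef (a *: x + y) = a * prod_coef x + prod_coef y.
Proof. by rewrite /prod_coef !mxE. Qed.

Lemma brac_coefD a (x y : E) :
  brac_coef (a *: x + y) = a * brac_coef x + brac_coef y.
Proof. by rewrite /brac_coef !mxE. Qed.

Lemma prod_coef_swap (x : E) : prod_coef (s2swap E x) = prod_coef x.
Proof. by rewrite /prod_coef /= lfunE /= mxE. Qed.

Lemma brac_coef_swap (x : E) : brac_coef (s2swap E x) = - brac_coef x.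
Proof. by rewrite /brac_coef /= lfunE /= mxE. Qed.

(** The functions coefA, coefM, coefH, coefU and coefN give the coefficients
    of x_i, x_i x_j, [x_i, x_j], x_i [x_j, x_l] and [x_i, [x_j, x_l]] in a
    tree read as a Poisson monomial, expanded with the Leibniz rule.  The
    Jacobi identity is not imposed, so only some combinations of the last
    coefficients have a meaning in the Poisson operad. *)
Definition coefA (i : nat) t : k^o := if t is BLeaf l then (l == i)%:R else 0.

Definition coefM i j t : k^o :=
  if t is BNode x s u then
    prod_coef x * (coefA i s * coefA j u + coefA j s * coefA i u) else 0.

Definition coefH i j t : k^o :=
  if t is BNode x s u then
    brac_coef x * (coefA i s * coefA j u - coefA j s * coefA i u) else 0.

Definition coefU i j l t : k^o :=
  if t is BNode x s u then
    prod_coef x * (coefA i s * coefH j l u + coefH j l s * coefA i u)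
    + brac_coef x * (coefA j s * coefM i l u - coefA l s * coefM i j u
                     - coefM i l s * coefA j u + coefM i j s * coefA l u) else 0.

Definition coefN i j l t : k^o :=
  if t is BNode x s u then
    brac_coef x * (coefA i s * coefH j l u - coefH j l s * coefA i u) else 0.

(** As trees are not vectors, linearity at a vertex is expressed through all
    the coefficients at once; this makes it stable under adding further
    vertices. *)
Definition combination (a : k) t t1 t2 : Prop :=
  [/\ forall i, coefA i t = a * coefA i t1 + coefA i t2,
      forall i j, coefM i j t = a * coefM i j t1 + coefM i j t2,
      forall i j, coefH i j t = a * coefH i j t1 + coefH i j t2,
      forall i j l, coefU i j l t = a * coefU i j l t1 + coefU i j l t2 &
      forall i j l, coefN i j l t = a * coefN i j l t1 + coefN i j l t2].

Lemma combination_plug a l b b1 b2 c : count_mem l (bleaves c) = 1%N ->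
  combination a b b1 b2 ->
  combination a (bplug l b c) (bplug l b1 c) (bplug l b2 c).
Proof.
move=> + H; elim: c => [l'|x s IHs u IHu] /=.
  by rewrite /bplug /=; case: eqP.
rewrite count_cat => lsu.
have [ls|ls] := boolP (l \in bleaves s).
  have {}lsu : (count_mem l (bleaves s) = 1 /\ count_mem l (bleaves u) = 0)%N.
    move: ls lsu; rewrite -has_pred1 has_count.
    by case: (count _ _) => [|[|n]] //= _; case: (count _ _).
  case: lsu => /IHs [hA hM hH hU hN] /count_memPn lu.
  rewrite /bplug /= -!/(bplug _ _ _) !(bplug_id _ lu).
  split=> *; rewrite /= ?mulr0 ?addr0 // ?hA ?hM ?hH; ring.
have {}lsu : count_mem l (bleaves u) = 1%N by rewrite (count_memPn ls) in lsu.
case: (IHu lsu) => [hA hM hH hU hN].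
rewrite /bplug /= -!/(bplug _ _ _) !(bplug_id _ ls).
split=> *; rewrite /= ?mulr0 ?addr0 // ?hA ?hM ?hH; ring.
Qed.

Lemma combination_lin a x y t u :
  combination a (BNode (a *: x + y) t u) (BNode x t u) (BNode y t u).
Proof.
by split=> *; rewrite /= ?prod_coefD ?brac_coefD ?mulr0 ?addr0 //; ring.
Qed.

Lemma combination_swap x t u :
  combination 0 (BNode (s2swap E x) t u) (BNode x u t) (BNode x u t).
Proof.
by split=> *; rewrite /= ?prod_coef_swap ?brac_coef_swap ?mulr0 ?addr0 //; ring.
Qed.

Section Relabelling.
Variables (f : nat -> nat) (f_inj : injective f).

Lemma coefA_relabel i t : coefA (f i) (brelabel f t) = coefA i t.
Proof. by case: t => //= l; rewrite (inj_eq f_inj). Qed.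

Lemma coefM_relabel i j t : coefM (f i) (f j) (brelabel f t) = coefM i j t.
Proof. by case: t => //= x s u; rewrite -!/(brelabel f _) !coefA_relabel. Qed.

Lemma coefH_relabel i j t : coefH (f i) (f j) (brelabel f t) = coefH i j t.
Proof. by case: t => //= x s u; rewrite -!/(brelabel f _) !coefA_relabel. Qed.

Lemma coefU_relabel i j l t :
  coefU (f i) (f j) (f l) (brelabel f t) = coefU i j l t.
Proof.
case: t => //= x s u; rewrite -!/(brelabel f _).
by rewrite !coefA_relabel !coefH_relabel !coefM_relabel.
Qed.

Lemma coefN_relabel i j l t :
  coefN (f i) (f j) (f l) (brelabel f t) = coefN i j l t.
Proof.
by case: t => //= x s u; rewrite -!/(brelabel f _) !coefA_relabel !coefH_relabel.
Qed.

End Relabelling.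

(** Positions r are counted from 0 while the leaf r carries the label r+1.  In
    coordY and coordD, the sum over the two orderings of the inputs other than
    r makes a permutation of the inputs act on the index r alone, without
    signs. *)
Definition coordM (r : 'I_2) t : k^o := \sum_(j < 2 | j != r) coefM j.+1 r.+1 t.
Definition coordH (r : 'I_2) t : k^o := \sum_(j < 2 | j != r) coefH j.+1 r.+1 t.
Definition coordY (r : 'I_3) t : k^o :=
  \sum_(j < 3 | j != r) \sum_(l < 3 | (l != r) && (l != j)) coefU j.+1 l.+1 r.+1 t.
(** These combinations of the coefficients of [x_j, [x_l, x_r]] vanish on the
    Jacobi relation and, having sum zero, are two independent functionals on
    the Lie part of arity 3. *)
Definition coordD (r : 'I_3) t : k^o :=
  \sum_(j < 3 | j != r) \sum_(l < 3 | (l != r) && (l != j)) coefN j.+1 l.+1 r.+1 t.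

Definition coordA (r : 'I_1) t : k^o := coefA r.+1 t.

Definition coordinates n (F : 'I_n -> btree E -> k^o) : Prop :=
  (forall r a t t1 t2, combination a t t1 t2 -> F r t = a * F r t1 + F r t2) /\
  (forall (s : 'S_n) r t, F (s r) (brelabel (relabel_by s) t) = F r t).

Lemma relabel_byS n (s : 'S_n) (i : 'I_n) : relabel_by s i.+1 = (s i).+1.
Proof. by rewrite /relabel_by (valK i). Qed.

Lemma relabel_by_inj n (s : 'S_n) : injective (relabel_by s).
Proof.
apply: (can_inj (g := relabel_by (perm_inv s))) => -[|l] //=.
case: insubP => [i il il'|ln] /=; last by rewrite insubN.
by rewrite (valK (s i)) /= permK il'.
Qed.

Lemma reindex_neq n (s : 'S_n) (r : 'I_n) (G : 'I_n -> k) :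
  \sum_(j | j != s r) G j = \sum_(j | j != r) G (s j).
Proof.
rewrite (reindex_inj (@perm_inj _ s)) /=.
by apply: eq_bigl => j; rewrite (inj_eq perm_inj).
Qed.

Lemma reindex_neq2 n (s : 'S_n) (r : 'I_n) (G : 'I_n -> 'I_n -> k) :
  \sum_(j | j != s r) \sum_(l | (l != s r) && (l != j)) G j l =
  \sum_(j | j != r) \sum_(l | (l != r) && (l != j)) G (s j) (s l).
Proof.
rewrite reindex_neq; apply: eq_bigr => j _.
rewrite (reindex_inj (@perm_inj _ s)) /=.
by apply: eq_bigl => l; rewrite !(inj_eq perm_inj).
Qed.

Lemma coordinates_coordA : coordinates coordA.
Proof.
split=> [r a t t1 t2 [h _ _ _ _]|s r t]; first exact: h.
rewrite /coordA -relabel_byS.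
by rewrite coefA_relabel //; apply: relabel_by_inj.
Qed.

Lemma coordinates_coordM : coordinates coordM.
Proof.
split=> [r a t t1 t2 [_ h _ _ _]|s r t].
  by rewrite /coordM mulr_sumr -big_split; apply: eq_bigr => j _; apply: h.
rewrite /coordM reindex_neq; apply: eq_bigr => j _.
by rewrite -!relabel_byS coefM_relabel //; apply: relabel_by_inj.
Qed.

Lemma coordinates_coordH : coordinates coordH.
Proof.
split=> [r a t t1 t2 [_ _ h _ _]|s r t].
  by rewrite /coordH mulr_sumr -big_split; apply: eq_bigr => j _; apply: h.
rewrite /coordH reindex_neq; apply: eq_bigr => j _.
by rewrite -!relabel_byS coefH_relabel //; apply: relabel_by_inj.
Qed.

Lemma coordinates_coordY : coordinates coordY.
Proof.
split=> [r a t t1 t2 [_ _ _ h _]|s r t].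
  rewrite /coordY mulr_sumr -big_split; apply: eq_bigr => j _.
  by rewrite mulr_sumr -big_split; apply: eq_bigr => l _; apply: h.
rewrite /coordY reindex_neq2; apply: eq_bigr => j _; apply: eq_bigr => l _.
by rewrite -!relabel_byS coefU_relabel //; apply: relabel_by_inj.
Qed.

Lemma coordinates_coordD : coordinates coordD.
Proof.
split=> [r a t t1 t2 [_ _ _ _ h]|s r t].
  rewrite /coordD mulr_sumr -big_split; apply: eq_bigr => j _.
  by rewrite mulr_sumr -big_split; apply: eq_bigr => l _; apply: h.
rewrite /coordD reindex_neq2; apply: eq_bigr => j _; apply: eq_bigr => l _.
by rewrite -!relabel_byS coefN_relabel //; apply: relabel_by_inj.
Qed.

Local Notation FP := (free_operad E).
Local Notation labelled := (@labelled_trees k E).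

Definition lval (f : btree E -> k^o) (v : {malg k[btree E]}) : k := lext f v.

Lemma lvalP f a v w : lval f (a *: v + w) = a * lval f v + lval f w.
Proof. by rewrite /lval linearP. Qed.

Lemma lvalU f t : lval f << t >> = f t.
Proof. by rewrite /lval lextU. Qed.

Section FreeCoordinates.
Variables (n : nat) (F : 'I_n -> btree E -> k^o) (cF : coordinates F).

Definition free_coord (r : 'I_n) (x : FP n) : k := lval (F r) (rep x).

Lemma coordinates_relations r v :
  lspan (tree_relations (E := E)) v -> lext (F r) v = 0.
Proof.
case: cF => cF1 _; apply: lext_relations => [c l a x y t u cl|c l x t u cl].
  by apply: cF1; apply: combination_plug cl _; apply: combination_lin.
rewrite (cF1 _ 0 _ (bplug l (BNode x u t) c) (bplug l (BNode x u t) c)) ?mul0r ?add0r //.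
by apply: combination_plug cl _; apply: combination_swap.
Qed.

Lemma free_coord_cls r v : lspan (labelled n) v ->
  free_coord r (free_cls n v) = lval (F r) v.
Proof.
move=> nv; have := coordinates_relations r (rep_cls nv).
by rewrite linearB => /eqP; rewrite subr_eq0 => /eqP.
Qed.

Lemma free_coordP r a (x y : FP n) :
  free_coord r (a *: x + y) = a * free_coord r x + free_coord r y.
Proof.
have := coordinates_relations r (rep_lin a x y).
by rewrite linearB linearP => /eqP; rewrite subr_eq0 => /eqP.
Qed.

Lemma free_coord_oact (s : 'S_n) r x :
  free_coord (s r) (oact s x) = free_coord r x.
Proof.
have [v nv ->] := clsW x; rewrite -/(free_cls n v) free_oactE //.
rewrite !free_coord_cls //; last first.
  apply: lin1_labelled nv => t pt.
  by rewrite bleaves_relabel (perm_trans (perm_map _ pt)) // relabel_by_iota.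
rewrite /lval lin1E; move: v nv; set L := lext (fun t => << brelabel _ t >>).
apply: (lspan_le (S := [set v | lext (F (s r)) (L v) = lext (F r) v])).
  split=> [|a v w /= Ev Ew]; first by rewrite /L /= !linear0.
  by rewrite /L !linearP /= -/L Ev Ew.
by move=> _ [t _ <-] /=; rewrite /L !lextU; case: cF.
Qed.

End FreeCoordinates.

End TreeCoordinates.
Arguments coordA {k}.
Arguments coordM {k}.
Arguments coordH {k}.
Arguments coordY {k}.
Arguments coordD {k}.
Arguments coordinates_coordA {k}.
Arguments coordinates_coordM {k}.
Arguments coordinates_coordH {k}.
Arguments coordinates_coordY {k}.
Arguments coordinates_coordD {k}.

(** * Coordinates of composites *)

Section PoissonCoordinates.
Variable k : fieldType.
Local Notation E := (pois_gen k).
Local Notation FP := (free_operad E).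
Local Notation trees := {malg k[btree E]}.
Local Notation labelled := (@labelled_trees k E).
Implicit Types (t u b c : btree E) (v w : trees).

Lemma size_bleaves t : (0 < size (bleaves t))%N.
Proof. by elim: t => //= x s IHs u _; rewrite size_cat ltn_addr. Qed.

Lemma size_bleaves1 t : size (bleaves t) = 1%N -> exists l, t = BLeaf l.
Proof.
case: t => [l|x s u] /=; first by exists l.
rewrite size_cat; move: (size_bleaves s) (size_bleaves u).
by case: (size _) => [|[|n]] //; case: (size _).
Qed.

Lemma labelled1 t : perm_eq (bleaves t) (iota 1 1) -> t = BLeaf 1.
Proof.
move=> pt; have [l El] : exists l, t = BLeaf l by apply: size_bleaves1; rewrite (perm_size pt).
by move: pt; rewrite El /= => /perm_mem/(_ l); rewrite !inE eqxx => /esym/eqP->.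
Qed.

Lemma labelled2 t : perm_eq (bleaves t) (iota 1 2) ->
  exists x, t = BNode x (BLeaf 1) (BLeaf 2) \/ t = BNode x (BLeaf 2) (BLeaf 1).
Proof.
case: t => [l /perm_size//|x s u] /= pt; exists x.
have := perm_size pt; rewrite size_cat /=.
move: (size_bleaves s) (size_bleaves u) => s0 u0 su.
have [l El] : exists l, s = BLeaf l.
  by apply: size_bleaves1; move: s0 u0 su; case: (size _) => [|[|n]] //; case: (size _) => //= ?; rewrite addnS.
have [j Ej] : exists l, u = BLeaf l.
  by apply: size_bleaves1; move: s0 u0 su; case: (size _) => [|[|n]] //; case: (size _) => // -[|?] //=; rewrite !addnS.
rewrite {s0 u0 su}El {}Ej in pt *.
have := perm_mem pt 1%N; have := perm_mem pt 2%N; rewrite !inE /=.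
case: (eqVneq 1%N l) => [<- /= /eqP<- _|_]; first by left.
by case: (eqVneq 1%N j) => //= <-; rewrite orbF => /eqP<-; right.
Qed.

(** The values of coordD and coordY at the input r of a composite p o_(i+1) q
    of binary operations, as multiples of H(p) H(q) and as combinations of hm
    = H(p) M(q) and mh = M(p) H(q). *)
Definition compD (i r : nat) : k :=
  match i, r with 0, 0 => 1 | 0, 1 => -1 | 0, _ => 0
                | _, 0 => 0 | _, 1 => -1 | _, _ => 1 end.

Definition compY (i r : nat) (hm mh : k) : k :=
  match i, r with
  | 0, 0 => - hm - mh | 0, 1 => mh - hm | 0, _ => hm + hm
  | _, 0 => - (hm + hm) | _, 1 => hm - mh | _, _ => hm + mh end.

Lemma bilinear_span n m (B : trees -> trees -> k) :
  (forall a v v' w, B (a *: v + v') w = a * B v w + B v' w) ->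
  (forall a v w w', B v (a *: w + w') = a * B v w + B v w') ->
  (forall t u, perm_eq (bleaves t) (iota 1 n) -> perm_eq (bleaves u) (iota 1 m) ->
     B << t >> << u >> = 0) ->
  forall v w, lspan (labelled n) v -> lspan (labelled m) w -> B v w = 0.
Proof.
move=> Bl Br B0 v w + mw; move: v.
apply: (lspan_le (S := [set v | B v w = 0])).
  split=> [|a v v' /= Bv Bv'] /=; last by rewrite Bl Bv Bv' mulr0 addr0.
  by have := Bl (-1) 0 0 w; rewrite scaler0 addr0 mulN1r addNr.
move=> _ [t /= pt <-]; move: w mw.
apply: (lspan_le (S := [set w | B _ w = 0])).
  split=> [|a v v' /= Bv Bv'] /=; last by rewrite Br Bv Bv' mulr0 addr0.
  by have := Br (-1) << t >> 0 0; rewrite scaler0 addr0 mulN1r addNr.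
by move=> _ [u /= pu <-]; apply: B0.
Qed.

Lemma sum_ord2 (P : pred 'I_2) (F : 'I_2 -> k) :
  \sum_(j < 2 | P j) F j =
    (if P (Ordinal (isT : (0 < 2)%N)) then F (Ordinal (isT : (0 < 2)%N)) else 0)
  + (if P (Ordinal (isT : (1 < 2)%N)) then F (Ordinal (isT : (1 < 2)%N)) else 0).
Proof.
rewrite big_mkcond !big_ord_recl big_ord0 /= addr0.
rewrite (_ : Ordinal (isT : (0 < 2)%N) = ord0); last exact: val_inj.
by rewrite (_ : Ordinal (isT : (1 < 2)%N) = lift ord0 ord0); last exact: val_inj.
Qed.

Lemma sum_ord3 (P : pred 'I_3) (F : 'I_3 -> k) :
  \sum_(j < 3 | P j) F j =
    (if P (Ordinal (isT : (0 < 3)%N)) then F (Ordinal (isT : (0 < 3)%N)) else 0)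
  + (if P (Ordinal (isT : (1 < 3)%N)) then F (Ordinal (isT : (1 < 3)%N)) else 0)
  + (if P (Ordinal (isT : (2 < 3)%N)) then F (Ordinal (isT : (2 < 3)%N)) else 0).
Proof.
rewrite big_mkcond !big_ord_recl big_ord0 /= addr0 addrA.
rewrite (_ : Ordinal (isT : (0 < 3)%N) = ord0); last exact: val_inj.
rewrite (_ : Ordinal (isT : (1 < 3)%N) = lift ord0 ord0); last exact: val_inj.
rewrite (_ : Ordinal (isT : (2 < 3)%N) = lift ord0 (lift ord0 ord0)) //.
exact: val_inj.
Qed.

Lemma coordD_bgraft (i : 'I_2) r t u :
  perm_eq (bleaves t) (iota 1 2) -> perm_eq (bleaves u) (iota 1 2) ->
  coordD r (bgraft 1 i.+1 t u) = compD i r * (coordH ord_max t * coordH ord_max u).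
Proof.
move=> /labelled2[x Et] /labelled2[y Eu].
rewrite /coordD /coordH; case: i => [[|[|//]] Hi]; case: r => [[|[|[|//]]] Hr];
rewrite !sum_ord3 ?sum_ord2 /=;
case: Et => ->; case: Eu => -> /=; ring.
Qed.

Lemma coordY_bgraft (i : 'I_2) r t u :
  perm_eq (bleaves t) (iota 1 2) -> perm_eq (bleaves u) (iota 1 2) ->
  coordY r (bgraft 1 i.+1 t u) =
    compY i r (coordH ord_max t * coordM ord_max u) (coordM ord_max t * coordH ord_max u).
Proof.
move=> /labelled2[x Et] /labelled2[y Eu].
rewrite /coordY /coordH /coordM; case: i => [[|[|//]] Hi]; case: r => [[|[|[|//]]] Hr];
rewrite !sum_ord3 ?sum_ord2 /=;
case: Et => ->; case: Eu => -> /=; ring.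
Qed.

Lemma free_clsP n a v w : lspan (labelled n) v -> lspan (labelled n) w ->
  free_cls n (a *: v + w) = a *: free_cls n v + free_cls n w.
Proof. exact: cls_lin. Qed.

Lemma free_clsW n (x : FP n) : exists2 v, lspan (labelled n) v & x = free_cls n v.
Proof. exact: clsW. Qed.

Lemma lspan_labelled1 v : lspan (labelled 1%N) v -> v = lval (coordA ord0) v *: << BLeaf 1 >>.
Proof.
pose S : set trees := [set v | v = lval (coordA ord0) v *: << BLeaf 1 >>].
move=> v1; suff : S v by [].
move: v v1; apply: lspan_le => [|_ [t /labelled1 -> <-]] /=.
  split=> [|a x y Ex Ey]; first by rewrite /S /= /lval linear0 scale0r.
  by rewrite /S /= lvalP scalerDl -scalerA -Ex -Ey.
by rewrite /S /= lvalU /coordA /coefA eqxx scale1r.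
Qed.

Lemma free_unitW (x : FP 1%N) :
  x = free_cls 1%N (free_coord coordA ord0 x *: << BLeaf 1 >>).
Proof.
have [v v1 ->] := free_clsW x.
by rewrite (free_coord_cls coordinates_coordA) // -lspan_labelled1.
Qed.

Lemma unit_labelled a : lspan (labelled 1%N) (a *: << BLeaf 1 >>).
Proof. by apply: lspanZ; apply: sub_lspan; exists (BLeaf 1). Qed.

(** The arity 1 of the free operad is spanned by the unit. *)
Lemma free_comp_unit n (i : 'I_n.+1) (x : FP n.+1) (y : FP 1%N) :
  ocomp i x y = free_cls (n + 0).+1 (free_coord coordA ord0 y *: rep x).
Proof.
rewrite [in LHS](free_unitW y) -[in LHS](cls_repr x) free_ocompE //.
- congr (free_cls _ _); rewrite lin2_flip linearZ /= lextU; congr (_ *: _).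
  rewrite /lext [RHS](monalgE (rep x)); apply: eq_bigr => t _.
  rewrite (_ : bgraft _ _ _ _ = t).
    by apply/malgP => u; rewrite mcoeffZ !mcoeffU mulr_natr.
  rewrite /bgraft -[RHS]bbind_leaf; apply: eq_in_bbind => l _.
  by rewrite addn0; case: ltnP => // _; case: eqP => // ->.
- exact: rep_span.
- exact: unit_labelled.
Qed.

Lemma free_unit_comp n (i : 'I_1) (x : FP 1%N) (y : FP n.+1) :
  ocomp i x y = free_coord coordA ord0 x *: y.
Proof.
rewrite [in LHS](free_unitW x) -[y in LHS](cls_repr y) free_ocompE //.
- rewrite -[y in RHS](cls_repr y) -[_ *: _ in RHS]addr0.
  rewrite -[X in _ + X](_ : free_cls n.+1 0 = 0); last by apply: cls_eq0; apply: lspan0.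
  rewrite -free_clsP ?addr0; [|exact: rep_span|exact: lspan0].
  congr (free_cls _ _); rewrite lin2E linearZ /= lextU; congr (_ *: _).
  rewrite /lext [RHS](monalgE (rep y)); apply: eq_bigr => t _.
  rewrite (_ : bgraft _ _ _ _ = t).
    by apply/malgP => u; rewrite mcoeffZ !mcoeffU mulr_natr.
  rewrite /bgraft /= ord1 /= -[RHS]bbind_leaf /brelabel; apply: eq_in_bbind => l _.
  by rewrite addn0.
- exact: unit_labelled.
- exact: rep_span.
Qed.

Lemma free_coordD_ocomp (i : 'I_2) r (x y : FP 2%N) :
  free_coord coordD r (ocomp i x y : FP 3%N) =
    compD i r * (free_coord coordH ord_max x * free_coord coordH ord_max y).
Proof.
have [v v2 ->] := free_clsW x; have [w w2 ->] := free_clsW y.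
rewrite (free_ocompE i v2 w2) !(free_coord_cls coordinates_coordH) //.
rewrite (free_coord_cls coordinates_coordD); last apply: (bgraft_labelled i v2 w2).
apply/eqP; rewrite -subr_eq0; apply/eqP; rewrite lin2E.
(* Both sides are bilinear, and the formula is known on trees. *)
pose B v w := lval (coordD r) (lext (fun t => lext (fun u => << bgraft 1 i.+1 t u >>) w) v)
  - compD i r * (lval (coordH ord_max) v * lval (coordH ord_max) w).
apply: (bilinear_span (B := B)) v2 w2 => [a u u' t|a u t t'|t u pt pu]; rewrite /B.
- by rewrite linearP !lvalP; ring.
- by rewrite -!lin2E !lin2_flip linearP !lvalP; ring.
- by rewrite !lextU !lvalU coordD_bgraft // subrr.
Qed.

Lemma free_coordY_ocomp (i : 'I_2) r (x y : FP 2%N) :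
  free_coord coordY r (ocomp i x y : FP 3%N) =
    compY i r (free_coord coordH ord_max x * free_coord coordM ord_max y)
              (free_coord coordM ord_max x * free_coord coordH ord_max y).
Proof.
have [v v2 ->] := free_clsW x; have [w w2 ->] := free_clsW y.
rewrite (free_ocompE i v2 w2) !(free_coord_cls coordinates_coordH) //.
rewrite !(free_coord_cls coordinates_coordM) //.
rewrite (free_coord_cls coordinates_coordY); last exact: (bgraft_labelled i v2 w2).
apply/eqP; rewrite -subr_eq0; apply/eqP; rewrite lin2E.
pose B v w := lval (coordY r) (lext (fun t => lext (fun u => << bgraft 1 i.+1 t u >>) w) v)
  - compY i r (lval (coordH ord_max) v * lval (coordM ord_max) w)
              (lval (coordM ord_max) v * lval (coordH ord_max) w).
have compYP (a b1 b2 c1 c2 : k) : compY i r (a * b1 + b2) (a * c1 + c2) =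
    a * compY i r b1 c1 + compY i r b2 c2.
  by case: i {B} => [[|[|//]] Hi]; case: r => [[|[|[|//]]] Hr] /=; ring.
apply: (bilinear_span (B := B)) v2 w2 => [a u u' t|a u t t'|t u pt pu]; rewrite /B.
- by rewrite linearP !lvalP !mulrDl -!mulrA compYP; ring.
- by rewrite -!lin2E !lin2_flip linearP !lvalP !mulrDr !(mulrCA _ a) compYP; ring.
- by rewrite !lextU !lvalU coordY_bgraft // subrr.
Qed.

End PoissonCoordinates.

(** * The ideal of Poisson relations *)

Section PoissonIdeal.
Variable k : fieldType.
Local Notation E := (pois_gen k).
Local Notation FP := (free_operad E).
Local Notation P := (poisson k).

(** The common kernel of the coordinates in arities up to 3, and everything
    above: an ideal because a composite of arity at most 3 involves at most
    two binary operations, or an operation of arity 1. *)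
Definition coord_kernel n : set (FP n) :=
  match n return set (FP n) with
  | 1 => [set x | forall r, free_coord coordA r x = 0]
  | 2 => [set x | forall r, free_coord coordM r x = 0 /\ free_coord coordH r x = 0]
  | 3 => [set x | forall r, free_coord coordY r x = 0 /\ free_coord coordD r x = 0]
  | _ => setT
  end.

Lemma coord_kernel_big n (x : FP n) : (3 < n)%N -> coord_kernel x.
Proof. by case: n x => [|[|[|[|n]]]]. Qed.

Lemma coord_kernel_subspace n : is_subspace (@coord_kernel n).
Proof.
have ker0 m (F : 'I_m -> btree E -> k^o) (cF : coordinates F) r : free_coord F r 0 = 0.
  by have := free_coordP cF r (-1) 0 0; rewrite scaler0 addr0 mulN1r addNr.
have kerP m (F : 'I_m -> btree E -> k^o) (cF : coordinates F) r a x y :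
  free_coord F r x = 0 -> free_coord F r y = 0 -> free_coord F r (a *: x + y) = 0.
  by move=> Fx Fy; rewrite free_coordP // Fx Fy mulr0 addr0.
case: n => [|[|[|[|n]]]] //=; split=> [r|a x y Kx Ky r] /=;
  rewrite ?ker0 ?kerP //; try exact: coordinates_coordA; try exact: coordinates_coordM;
  try exact: coordinates_coordH; try exact: coordinates_coordY; try exact: coordinates_coordD;
  by case: (Kx r); case: (Ky r).
Qed.

Lemma coord_kernelZ n a (x : FP n) : coord_kernel x -> coord_kernel (a *: x).
Proof.
by move=> Kx; have [K0 KP] := coord_kernel_subspace n; rewrite -[_ *: _]addr0; apply: KP.
Qed.

Lemma coord_kernel_oact n (s : 'S_n) (x : FP n) :
  coord_kernel x -> coord_kernel (oact s x).
Proof.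
case: n s x => [|[|[|[|n]]]] //= s x Kx r; rewrite -(permKV s r);
  rewrite !free_coord_oact //; try exact: coordinates_coordA; try exact: coordinates_coordM;
  try exact: coordinates_coordH; try exact: coordinates_coordY; exact: coordinates_coordD.
Qed.

Lemma free_clsZ n a (x : FP n) : free_cls n (a *: rep x) = a *: x.
Proof.
have e0 : free_cls n 0 = 0 :> FP n by apply: cls_eq0; apply: lspan0.
rewrite -[a *: rep x]addr0 free_clsP ?e0 ?addr0.
- by rewrite [X in _ *: X](cls_repr x).
- exact: rep_span.
- exact: lspan0.
Qed.

(** The only case that is not a composition with a multiple of the unit is
    that of two binary operations, where the composition table applies. *)
Lemma coord_kernel_ideal : is_operad_ideal coord_kernel.
Proof.
have base (x y : FP 2%N) (i : 'I_2) :
    (coord_kernel x \/ coord_kernel y) -> coord_kernel (ocomp i x y : FP 3%N).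
  move=> K r; rewrite free_coordD_ocomp free_coordY_ocomp.
  by case: K => /(_ ord_max) [-> ->]; case: i => [[|[|//]] Hi];
    case: r => [[|[|[|//]]] Hr] /=; split; ring.
split; [exact: coord_kernel_subspace|exact: coord_kernel_oact| |].
- move=> n m i x y; case: n i x => [|n] i x Kx.
    rewrite [X in coord_kernel X](free_unit_comp i x y) (Kx ord0) scale0r.
    by case: (coord_kernel_subspace m.+1).
  case: m y => [|m] y.
    by rewrite free_comp_unit addn0 free_clsZ; apply: coord_kernelZ.
  case: n i x Kx => [|n] i x Kx; last by apply: coord_kernel_big; rewrite !addSn addnS.
  case: m y => [|m] y //=; apply: base; by left.
- move=> n m i x y Ky; case: n i x => [|n] i x.
    by rewrite [X in coord_kernel X](free_unit_comp i x y); apply: coord_kernelZ.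
  case: m y Ky => [|m] y Ky.
    rewrite free_comp_unit addn0 free_clsZ (Ky ord0) scale0r.
    by case: (coord_kernel_subspace n.+2).
  case: n i x => [|n] i x; last by apply: coord_kernel_big; rewrite !addSn addnS.
  case: m y Ky => [|m] y Ky //=; apply: base; by right.
Qed.

Lemma pois_relations_kernel : @pois_relations k `<=` @coord_kernel 3.
Proof.
apply: lspan_le; first exact: coord_kernel_subspace.
move=> _ [s [x [Rx ->]]]; apply: coord_kernel_oact.
have lab t : perm_eq (bleaves t) (iota 1 3) -> lspan (@labelled_trees k E 3) << t >>.
  by move=> pt; apply: sub_lspan; exists t.
case: Rx => [[|]|] ->  r; rewrite !free_coord_cls;
  try exact: coordinates_coordY; try exact: coordinates_coordD;
  try by [repeat (apply: lspanB || apply: lspanD); apply: lab].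
all: rewrite /lval ?(linearB, linearD) /= !lextU.
all: rewrite /coordY /coordD !sum_ord3; case: r => [[|[|[|//]]] Hr] /=.
all: rewrite /prod_coef /brac_coef !mxE /=; split; ring.
Qed.

Lemma operad_ideal_is_ideal (Q : operad k) (R : set (Q 3%N)) :
  is_operad_ideal (operad_ideal R).
Proof.
split=> [n|n s x Ix|n m i x y Ix|n m i x y Iy].
- split=> [I [h _ _ _] _|a x y Ix Iy I iI RI]; first by case: (h n).
  by case: (iI) => /(_ n) [_ h] _ _ _; apply: h; [apply: Ix|apply: Iy].
- by move=> I iI RI; case: (iI) => _ h _ _; apply: h; apply: Ix.
- by move=> I iI RI; case: (iI) => _ _ h _; apply: h; apply: Ix.
- by move=> I iI RI; case: (iI) => _ _ _ h; apply: h; apply: Iy.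
Qed.

Lemma lspan_operad_ideal (Q : operad k) (R : set (Q 3%N)) n :
  lspan (@operad_ideal k Q R n) `<=` @operad_ideal k Q R n.
Proof.
by apply: lspan_le => //; case: (operad_ideal_is_ideal R).
Qed.

Lemma poisson_ideal_kernel n : lspan (operad_ideal (@pois_relations k) (n := n)) `<=` @coord_kernel n.
Proof.
move=> x /lspan_operad_ideal; apply; first exact: coord_kernel_ideal.
exact: pois_relations_kernel.
Qed.

End PoissonIdeal.

(** * Relations among Poisson operations *)

Section FreeOperadLinearity.
Variables (k : fieldType) (E : S2module k).
Local Notation FP := (free_operad E).

Let FW n (x : FP n) : exists2 v, lspan (@labelled_trees k E n) v & x = free_cls n v.
Proof. exact: clsW. Qed.

Let clsP n a v w : lspan (@labelled_trees k E n) v -> lspan (@labelled_trees k E n) w ->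
  free_cls n (a *: v + w) = a *: free_cls n v + free_cls n w :> FP n.
Proof. exact: cls_lin. Qed.

Lemma relabel_labelled n (s : 'S_n) (v : {malg k[btree E]}) :
  lspan (@labelled_trees k E n) v ->
  lspan (@labelled_trees k E n) (lin1 (brelabel (relabel_by s)) v).
Proof.
apply: lin1_labelled => t pt.
by rewrite bleaves_relabel (perm_trans (perm_map _ pt)) // relabel_by_iota.
Qed.

Lemma free_oact1 n (x : FP n) : oact 1%g x = x.
Proof.
have [v nv ->] : exists2 v, lspan (@labelled_trees k E n) v & x = free_cls n v.
  exact: clsW.
rewrite free_oactE //; congr (free_cls n _).
rewrite /lin1 [RHS]monalgE; apply: eq_bigr => t _.
rewrite (_ : brelabel _ t = t).
  by apply/malgP => u; rewrite mcoeffZ !mcoeffU mulr_natr.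
rewrite -[RHS]bbind_leaf; apply: eq_in_bbind => -[|l] _ //=.
by case: insubP => //= i _ <-; rewrite perm1.
Qed.

Lemma free_oactP n (s : 'S_n) a (x y : FP n) :
  oact s (a *: x + y) = a *: oact s x + oact s y.
Proof.
have [v nv ->] := FW x; have [w nw ->] := FW y.
rewrite -clsP // !free_oactE //; last exact: lspanDZ.
rewrite -clsP; [|exact: relabel_labelled|exact: relabel_labelled].
by rewrite !lin1E linearP.
Qed.

Lemma free_ocompPl n m (i : 'I_n.+1) a (x x' : FP n.+1) (y : FP m.+1) :
  ocomp i (a *: x + x') y = a *: ocomp i x y + ocomp i x' y.
Proof.
have [v nv ->] := FW x; have [v' nv' ->] := FW x'; have [w nw ->] := FW y.
rewrite -clsP // !free_ocompE //; last exact: lspanDZ.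
rewrite -clsP; [|exact: bgraft_labelled|exact: bgraft_labelled].
by rewrite !lin2E linearP.
Qed.

Lemma free_ocompPr n m (i : 'I_n.+1) a (x : FP n.+1) (y y' : FP m.+1) :
  ocomp i x (a *: y + y') = a *: ocomp i x y + ocomp i x y'.
Proof.
have [v nv ->] := FW x; have [w nw ->] := FW y; have [w' nw' ->] := FW y'.
rewrite -clsP // !free_ocompE //; last exact: lspanDZ.
rewrite -clsP; [|exact: bgraft_labelled|exact: bgraft_labelled].
by rewrite !lin2_flip linearP.
Qed.

Variable R : set (FP 3%N).
Local Notation Q := (quadratic_operad R).
Definition qcls n (x : FP n) : Q n := cls _ _ x.

Lemma qclsP n a (x y : FP n) : qcls (a *: x + y) = a *: qcls x + qcls y.
Proof. by apply: cls_lin; apply: sub_lspan. Qed.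

Lemma qcls_eq0 n (x : FP n) : operad_ideal R x -> qcls x = 0.
Proof. by move=> Ix; apply: cls_eq0; apply: sub_lspan. Qed.

Lemma qcls_rep n (x : FP n) : operad_ideal R (rep (qcls x) - x).
Proof. by apply: lspan_operad_ideal; apply: rep_cls; apply: sub_lspan. Qed.

Lemma qcls_eq n (x y : FP n) : operad_ideal R (x - y) -> qcls x = qcls y.
Proof.
by move=> Ixy; apply: cls_eq; [exact: sub_lspan|exact: sub_lspan|exact: sub_lspan].
Qed.

Lemma qcls_oact n (s : 'S_n) (x : FP n) : oact s (qcls x) = qcls (oact s x).
Proof.
apply: qcls_eq; have [_ Ia _ _] := operad_ideal_is_ideal R.
have := Ia _ s _ (qcls_rep x).
by rewrite addrC -scaleN1r free_oactP scaleN1r addrC.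
Qed.

Lemma qcls_ocomp n m (i : 'I_n.+1) (x : FP n.+1) (y : FP m.+1) :
  ocomp i (qcls x) (qcls y) = qcls (ocomp i x y).
Proof.
apply: qcls_eq; have [Is _ Il Ir] := operad_ideal_is_ideal R.
have hl := Il _ _ i _ (rep (qcls y)) (qcls_rep x).
have hr := Ir _ _ i x _ (qcls_rep y).
move: hl hr; rewrite addrC -scaleN1r free_ocompPl scaleN1r => hl.
rewrite addrC -scaleN1r free_ocompPr scaleN1r => hr.
have [_ /(_ 1 _ _ hl hr)] := Is (n + m).+1.
by rewrite scale1r addrC -addrA addNKr addrC.
Qed.

End FreeOperadLinearity.

Section PoissonRelations.
Variable k : fieldType.
Local Notation E := (pois_gen k).
Local Notation FP := (free_operad E).
Local Notation P := (poisson k).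
Local Notation rels := (tree_relations (E := E)).
Local Notation qcls := (qcls (@pois_relations k)).
Local Notation vprod := (delta_mx 0 0 : E).
Local Notation vbrac := (delta_mx 0 1 : E).
Local Notation times s t := (BNode vprod s t).
Local Notation bracket s t := (BNode vbrac s t).
Local Notation x1 := (BLeaf 1 : btree E).
Local Notation x2 := (BLeaf 2 : btree E).
Local Notation x3 := (BLeaf 3 : btree E).

Definition tcls n (t : btree E) : P n := qcls (free_cls n << t >>).

Definition pois_prod : P 2%N := tcls 2 (times x1 x2).
Definition pois_brac : P 2%N := tcls 2 (bracket x1 x2).

Lemma labelledU n t : perm_eq (bleaves t) (iota 1 n) ->
  lspan (@labelled_trees k E n) << t >>.
Proof. by move=> pt; apply: sub_lspan; exists t. Qed.

Lemma tcls_oact n (s : 'S_n) t : perm_eq (bleaves t) (iota 1 n) ->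
  oact s (tcls n t) = tcls n (brelabel (relabel_by s) t).
Proof.
move=> pt; rewrite /tcls [LHS]qcls_oact free_oactE; last exact: labelledU.
by rewrite lin1E lextU.
Qed.

Lemma tcls_ocomp n m (i : 'I_n.+1) t u :
  perm_eq (bleaves t) (iota 1 n.+1) -> perm_eq (bleaves u) (iota 1 m.+1) ->
  ocomp i (tcls n.+1 t) (tcls m.+1 u) = tcls (n + m).+1 (bgraft m i.+1 t u).
Proof.
move=> pt pu; rewrite /tcls [LHS]qcls_ocomp free_ocompE; [|exact: labelledU|exact: labelledU].
by rewrite lin2E !lextU.
Qed.

(** Antisymmetry at a vertex combines the equivariance relation with the
    linearity relations for h + (- h) and for 0 + 0. *)
Lemma brac_anti c l t u : count_mem l (bleaves c) = 1%N ->
  lspan rels (<< bplug l (bracket t u) c >> + << bplug l (bracket u t) c >>).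
Proof.
move=> cl.
have h2 : lspan rels (<< bplug l (BNode (s2swap E vbrac) t u) c >> - << bplug l (bracket u t) c >>).
  by apply: sub_lspan; right; exists c, l, vbrac, t, u.
have hs : s2swap E vbrac = - vbrac.
  by rewrite /= lfunE /=; apply/rowP => j; rewrite !mxE; case: j => [[|[|//]] Hj] /=; rewrite ?mulr0n ?oppr0.
have h1 : lspan rels (<< bplug l (BNode (1 *: vbrac + - vbrac) t u) c >>
    - 1 *: << bplug l (bracket t u) c >> - << bplug l (BNode (- vbrac) t u) c >>).
  by apply: sub_lspan; left; exists c, l, 1, vbrac, (- vbrac), t, u.
have h0 : lspan rels << bplug l (BNode (0 : E) t u) c >>.
  have /(lspanZ (-1)) : lspan rels (<< bplug l (BNode (1 *: (0 : E) + 0) t u) c >>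
      - 1 *: << bplug l (BNode (0 : E) t u) c >> - << bplug l (BNode (0 : E) t u) c >>).
    by apply: sub_lspan; left; exists c, l, 1, 0, 0, t, u.
  by rewrite !scale1r addr0 subrr add0r scaleN1r opprK.
rewrite !scale1r subrr in h1; rewrite hs in h2.
have := lspanB (lspanB h0 h1) h2.
set A := << _ >>; set B := << _ >>; set C := << _ >>; set D := << _ >>.
by rewrite -[A - B - C]addrA -opprD subKr opprB [D - C]addrC addrA addrK.
Qed.

Definition vcls n (v : {malg k[btree E]}) : P n := qcls (free_cls n v).

Lemma vclsP n a v w : lspan (@labelled_trees k E n) v ->
  lspan (@labelled_trees k E n) w -> vcls n (a *: v + w) = a *: vcls n v + vcls n w.
Proof. by move=> nv nw; rewrite /vcls [free_cls n _]cls_lin // qclsP. Qed.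

Lemma vclsD n v w : lspan (@labelled_trees k E n) v ->
  lspan (@labelled_trees k E n) w -> vcls n (v + w) = vcls n v + vcls n w.
Proof. by move=> nv nw; rewrite -[v]scale1r vclsP // !scale1r. Qed.

Lemma vclsB n v w : lspan (@labelled_trees k E n) v ->
  lspan (@labelled_trees k E n) w -> vcls n (v - w) = vcls n v - vcls n w.
Proof. by move=> nv nw; rewrite addrC -scaleN1r vclsP // scaleN1r addrC. Qed.

Lemma vcls_eq0 n v : lspan rels v -> vcls n v = 0.
Proof.
move=> rv; rewrite /vcls [free_cls n v]cls_eq0 //; apply: qcls_eq0.
by have [/(_ n) []] := operad_ideal_is_ideal (@pois_relations k).
Qed.

Lemma tcls_anti n c l t u : count_mem l (bleaves c) = 1%N ->
  perm_eq (bleaves (bplug l (bracket t u) c)) (iota 1 n) ->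
  perm_eq (bleaves (bplug l (bracket u t) c)) (iota 1 n) ->
  tcls n (bplug l (bracket t u) c) = - tcls n (bplug l (bracket u t) c).
Proof.
move=> cl ptu put; apply/eqP; rewrite -addr_eq0; apply/eqP.
by rewrite -[LHS]vclsD ?vcls_eq0 //; [exact: brac_anti|exact: labelledU|exact: labelledU].
Qed.

Lemma tcls_comm n t u : perm_eq (bleaves (times t u)) (iota 1 n) ->
  perm_eq (bleaves (times u t)) (iota 1 n) ->
  tcls n (times t u) = tcls n (times u t).
Proof.
move=> ptu put; apply/eqP; rewrite -subr_eq0; apply/eqP.
rewrite -[LHS]vclsB ?vcls_eq0 //; [|exact: labelledU|exact: labelledU].
have hs : s2swap E vprod = vprod.
  rewrite /= lfunE /=; apply/rowP => j; rewrite !mxE.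
  by case: j => [[|[|//]] Hj] /=; rewrite ?mulr0n ?oppr0.
apply: sub_lspan; right; exists (BLeaf 0), 0%N, vprod, t, u; split=> //.
by rewrite hs.
Qed.

Lemma pois_basic_eq0 v : @pois_basic_relations k (free_cls 3 v) -> vcls 3 v = 0.
Proof.
move=> Rv; apply: qcls_eq0 => I _ RI; apply: RI; apply: sub_lspan.
by exists 1%g, (free_cls 3 v); rewrite free_oact1.
Qed.

Lemma jacobi_tree :
  tcls 3 (bracket x1 (bracket x2 x3)) + tcls 3 (bracket x2 (bracket x3 x1))
  + tcls 3 (bracket x3 (bracket x1 x2)) = 0.
Proof.
rewrite -!vclsD ?pois_basic_eq0 //; try apply: lspanD; try exact: labelledU.
by left; right.
Qed.

Lemma leibniz_tree :
  tcls 3 (bracket x1 (times x2 x3)) =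
  tcls 3 (times x2 (bracket x1 x3)) + tcls 3 (times (bracket x1 x2) x3).
Proof.
apply/eqP; rewrite -subr_eq0 opprD addrA; apply/eqP.
rewrite -!vclsB ?pois_basic_eq0 //; try apply: lspanB; try exact: labelledU.
by right.
Qed.

(** The rotation of the inputs, x1 to x2 to x3 to x1. *)
Definition rot3 : 'S_3 := perm (addIr (1 : 'I_3)).

Lemma pois_oactP n (s : 'S_n) a (p q : P n) :
  oact s (a *: p + q) = a *: oact s p + oact s q.
Proof.
have W (x : P n) : x = qcls (rep x) by rewrite [RHS]cls_repr.
by rewrite (W p) (W q) -qclsP !qcls_oact free_oactP qclsP.
Qed.

Lemma pois_oactD n (s : 'S_n) (p q : P n) : oact s (p + q) = oact s p + oact s q.
Proof. by rewrite -[p]scale1r pois_oactP !scale1r. Qed.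

Lemma brelabel_leaf f l : brelabel f (BLeaf l) = BLeaf (f l) :> btree E.
Proof. by []. Qed.

Lemma brelabel_node f x (t u : btree E) :
  brelabel f (BNode x t u) = BNode x (brelabel f t) (brelabel f u).
Proof. by []. Qed.

Lemma tcls_flip a b c : perm_eq [:: c; b; a] (iota 1 3) ->
  tcls 3 (times (bracket (BLeaf a) (BLeaf b)) (BLeaf c)) =
  - tcls 3 (times (BLeaf c) (bracket (BLeaf b) (BLeaf a))).
Proof.
move=> pcba.
have pcab : perm_eq [:: c; a; b] (iota 1 3).
  by apply: perm_trans pcba; rewrite perm_cons; apply: permEl; apply: (perm_catC [:: a] [:: b]).
have pabc : perm_eq [:: a; b; c] (iota 1 3).
  by apply: perm_trans pcab; apply: permEl; apply: (perm_catC [:: a; b] [:: c]).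
rewrite tcls_comm //.
have := @tcls_anti 3 (times (BLeaf c) (BLeaf c.+1)) c.+1 (BLeaf a) (BLeaf b).
rewrite /bplug [bbind _ _]/= [bbind _ (times _ _)]/= eqxx (ltn_eqF (ltnSn c)).
by apply; rewrite //= eqxx (ltn_eqF (ltnSn c)).
Qed.

Lemma rot3E : (relabel_by rot3 1 = 2)%N * (relabel_by rot3 2 = 3)%N * (relabel_by rot3 3 = 1)%N.
Proof.
by do 2?split; rewrite /relabel_by /= insubT //= permE.
Qed.

Lemma telescope3 (V : zmodType) (a b c : V) : a - b + (b - c) + (c - a) = 0.
Proof. by rewrite [a - b + _]addrA subrK addrA subrK subrr. Qed.

(** By the Leibniz rule [x1, x2 x3] = x2 [x1, x3] - x3 [x2, x1], which is of
    the form a - b with b the rotation of a; the cyclic sum telescopes. *)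
Lemma leibniz_rot : let J := ocomp (1 : 'I_2) pois_brac pois_prod : P 3%N in
  J + oact rot3 J + oact rot3 (oact rot3 J) = 0.
Proof.
move=> J; have -> : J = tcls 3 (bracket x1 (times x2 x3)) by exact: (@tcls_ocomp 1 1 1 (bracket x1 x2) (times x1 x2) isT isT).
rewrite leibniz_tree !pois_oactD !tcls_oact //.
2,3: by rewrite !(brelabel_node, brelabel_leaf, rot3E).
rewrite !(brelabel_node, brelabel_leaf, rot3E) !tcls_flip //.
exact: telescope3.
Qed.

(** This is ad [x1, x2] = [ad x1, ad x2]; for r the transposition of the first
    two inputs the right-hand side is a commutator with respect to composition
    in the last input. *)
Lemma jacobi_cyclic (r : 'S_3) : r (0 : 'I_3) = 1 -> r 1 = 0 -> r (1+1) = 1+1 ->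
  ocomp (0 : 'I_2) pois_brac pois_brac =
  ocomp (1 : 'I_2) pois_brac pois_brac - oact r (ocomp (1 : 'I_2) pois_brac pois_brac)
  :> P 3%N.
Proof.
move=> r0 r1 r2.
have -> : ocomp (1 : 'I_2) pois_brac pois_brac = tcls 3 (bracket x1 (bracket x2 x3)) :> P 3%N.
  by exact: (@tcls_ocomp 1 1 1 (bracket x1 x2) (bracket x1 x2) isT isT).
have -> : ocomp (0 : 'I_2) pois_brac pois_brac = tcls 3 (bracket (bracket x1 x2) x3) :> P 3%N.
  by exact: (@tcls_ocomp 1 1 0 (bracket x1 x2) (bracket x1 x2) isT isT).
have R1 : relabel_by r 1 = 2%N by rewrite (relabel_byS r (0 : 'I_3)) r0.
have R2 : relabel_by r 2 = 1%N by rewrite (relabel_byS r (1 : 'I_3)) r1.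
have R3 : relabel_by r 3 = 3%N by rewrite (relabel_byS r (1 + 1 : 'I_3)) r2.
rewrite !tcls_oact // !(brelabel_node, brelabel_leaf) R1 R2 R3.
have e1 : tcls 3 (bracket (bracket x1 x2) x3) = - tcls 3 (bracket x3 (bracket x1 x2)).
  exact: (@tcls_anti 3 (BLeaf 0) 0 (bracket x1 x2) x3 erefl isT isT).
have e2 : tcls 3 (bracket x2 (bracket x1 x3)) = - tcls 3 (bracket x2 (bracket x3 x1)).
  exact: (@tcls_anti 3 (bracket x2 (BLeaf 0)) 0 x1 x3 erefl isT isT).
rewrite e1 e2 opprK; apply/eqP; rewrite eq_sym -subr_eq0 opprK.
by rewrite jacobi_tree.
Qed.

End PoissonRelations.

(** * Functionals on the Poisson operad *)

Definition equivariant_family (k : fieldType) (P : operad k)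
    (f : forall m, nat -> P m.+2 -> k) : Prop :=
  (forall m r a p q, f m r (a *: p + q) = a * f m r p + f m r q) /\
  (forall m (s : 'S_m.+2) (r : 'I_m.+2) p, f m (s r) (oact s p) = f m r p).

Section PoissonFunctionals.
Variable k : fieldType.
Local Notation E := (pois_gen k).
Local Notation FP := (free_operad E).
Local Notation P := (poisson k).

Definition pcoord n (F : 'I_n -> btree E -> k^o) r (p : P n) : k :=
  free_coord F r (rep p).

Section Coordinate.
Variables (n : nat) (F : 'I_n -> btree E -> k^o).
Hypotheses (cF : coordinates F)
  (kF : forall r (x : FP n), coord_kernel x -> free_coord F r x = 0).

Lemma pcoord_cls r (x : FP n) :
  pcoord F r (qcls (@pois_relations k) x : P n) = free_coord F r x.
Proof.
have /(sub_lspan (V := FP n))/poisson_ideal_kernel := qcls_rep (R := @pois_relations k) x.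
move=> /(kF r); rewrite addrC -scaleN1r free_coordP // mulN1r => /eqP.
by rewrite addrC subr_eq0 => /eqP.
Qed.

Lemma pcoordP r a (p q : P n) : pcoord F r (a *: p + q) = a * pcoord F r p + pcoord F r q.
Proof.
have /poisson_ideal_kernel/(kF r) := rep_lin a p q.
rewrite addrC -scaleN1r !free_coordP // mulN1r => /eqP.
by rewrite addrC subr_eq0 => /eqP.
Qed.

Lemma pcoord_oact (s : 'S_n) r (p : P n) : pcoord F (s r) (oact s p) = pcoord F r p.
Proof. by rewrite pcoord_cls free_coord_oact. Qed.

End Coordinate.

Lemma kernel_coordM r (x : FP 2%N) : coord_kernel x -> free_coord coordM r x = 0.
Proof. by move=> /(_ r)[]. Qed.
Lemma kernel_coordH r (x : FP 2%N) : coord_kernel x -> free_coord coordH r x = 0.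
Proof. by move=> /(_ r)[]. Qed.
Lemma kernel_coordY r (x : FP 3%N) : coord_kernel x -> free_coord coordY r x = 0.
Proof. by move=> /(_ r)[]. Qed.
Lemma kernel_coordD r (x : FP 3%N) : coord_kernel x -> free_coord coordD r x = 0.
Proof. by move=> /(_ r)[]. Qed.

(** The families are indexed by all arities, with zero values outside of the
    relevant one, so that cochains can be defined on trees without dependent
    case analysis; similarly for poisH, poisY and poisD. *)
Definition poisM m (r : nat) : P m.+2 -> k :=
  if m is 0 return P m.+2 -> k then fun p => pcoord coordM (inord r) p else fun=> 0.
Definition poisH m (r : nat) : P m.+2 -> k :=
  if m is 0 return P m.+2 -> k then fun p => pcoord coordH (inord r) p else fun=> 0.
Definition poisY m (r : nat) : P m.+2 -> k :=
  if m is 1 return P m.+2 -> k then fun p => pcoord coordY (inord r) p else fun=> 0.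
Definition poisD m (r : nat) : P m.+2 -> k :=
  if m is 1 return P m.+2 -> k then fun p => pcoord coordD (inord r) p else fun=> 0.

Lemma family_poisM : equivariant_family (P := P) poisM.
Proof.
split=> [[|m] r a p q|[|m] s r p] /=; rewrite ?mulr0 ?addr0 //.
  exact: (pcoordP coordinates_coordM kernel_coordM).
by rewrite !inord_val; apply: (pcoord_oact coordinates_coordM kernel_coordM).
Qed.

Lemma family_poisH : equivariant_family (P := P) poisH.
Proof.
split=> [[|m] r a p q|[|m] s r p] /=; rewrite ?mulr0 ?addr0 //.
  exact: (pcoordP coordinates_coordH kernel_coordH).
by rewrite !inord_val; apply: (pcoord_oact coordinates_coordH kernel_coordH).
Qed.

Lemma family_poisY : equivariant_family (P := P) poisY.
Proof.
split=> [[|[|m]] r a p q|[|[|m]] s r p] /=; rewrite ?mulr0 ?addr0 //.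
  exact: (pcoordP coordinates_coordY kernel_coordY).
by rewrite !inord_val; apply: (pcoord_oact coordinates_coordY kernel_coordY).
Qed.

Lemma family_poisD : equivariant_family (P := P) poisD.
Proof.
split=> [[|[|m]] r a p q|[|[|m]] s r p] /=; rewrite ?mulr0 ?addr0 //.
  exact: (pcoordP coordinates_coordD kernel_coordD).
by rewrite !inord_val; apply: (pcoord_oact coordinates_coordD kernel_coordD).
Qed.

Lemma inord1_max : inord 1 = ord_max :> 'I_2.
Proof. by apply/ord_inj; rewrite inordK. Qed.

Lemma inord1_one : inord 1 = 1 :> 'I_2.
Proof. by apply/ord_inj; rewrite inordK. Qed.

Lemma inord0_min : inord 0 = ord0 :> 'I_2.
Proof. by apply/ord_inj; rewrite inordK. Qed.

Lemma poisD_ocomp (i : 'I_2) r (p q : P 2%N) : (r < 3)%N ->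
  @poisD 1 r (ocomp i p q) = compD k i r * (@poisH 0 1 p * @poisH 0 1 q).
Proof.
move=> r3; rewrite /= inord1_max (pcoord_cls coordinates_coordD kernel_coordD).
by rewrite free_coordD_ocomp inordK.
Qed.

Lemma poisY_ocomp (i : 'I_2) r (p q : P 2%N) : (r < 3)%N ->
  @poisY 1 r (ocomp i p q) =
    compY i r (@poisH 0 1 p * @poisM 0 1 q) (@poisM 0 1 p * @poisH 0 1 q).
Proof.
move=> r3; rewrite /= inord1_max (pcoord_cls coordinates_coordY kernel_coordY).
by rewrite free_coordY_ocomp inordK.
Qed.

Lemma lval_scale (f g : btree E -> k^o) a v :
  (forall t, f t = a * g t) -> lval f v = a * lval g v.
Proof.
move=> fg; rewrite /lval /lext -[RHS]/(a *: _) scaler_sumr.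
apply: eq_bigr => t _; rewrite fg -[a * _]/(a *: _) !scalerA.
by rewrite mulrC.
Qed.

Lemma poisH0 (p : P 2%N) : @poisH 0 0 p = - @poisH 0 1 p.
Proof.
rewrite /= inord1_max -mulN1r; apply: lval_scale => t.
by rewrite inord0_min /coordH !sum_ord2; case: t => [l|x s u] /=; ring.
Qed.

Lemma poisM0 (p : P 2%N) : @poisM 0 0 p = @poisM 0 1 p.
Proof.
rewrite /= inord1_max -[RHS]mul1r; apply: lval_scale => t.
by rewrite inord0_min /coordM !sum_ord2; case: t => [l|x s u] /=; ring.
Qed.

Lemma pois_gen_coords :
  [/\ @poisM 0 1 (pois_prod k) = 1, @poisH 0 1 (pois_prod k) = 0,
      @poisM 0 1 (pois_brac k) = 0 & @poisH 0 1 (pois_brac k) = 1].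
Proof.
rewrite /= inord1_max; split.
all: rewrite ?(pcoord_cls coordinates_coordM kernel_coordM) ?(pcoord_cls coordinates_coordH kernel_coordH).
all: rewrite ?(free_coord_cls coordinates_coordM) ?(free_coord_cls coordinates_coordH);
   try exact: labelledU.
all: rewrite lvalU ?/coordM ?/coordH !sum_ord2 /= /prod_coef /brac_coef !mxE /=; ring.
Qed.

End PoissonFunctionals.

(** * The wheeled completion in arities 1 and 2 *)

Section WheeledPart.
Variable k : fieldType.
Local Notation E := (pois_gen k).
Local Notation FP := (free_operad E).
Local Notation P := (poisson k).
Local Notation W := (completion (poisson k)).

Lemma pois_oact1 n (p : P n) : oact 1%g p = p.
Proof.
have {1}-> : p = qcls (@pois_relations k) (rep p) by rewrite [RHS]cls_repr.
by rewrite qcls_oact free_oact1 [LHS]cls_repr.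
Qed.

Lemma pois_oactN0 n (s : 'S_n) : oact s (0 : P n) = 0.
Proof. by have := pois_oactP s (-1) (0 : P n) 0; rewrite scaler0 addr0 scaleN1r addNr. Qed.

Lemma pois_comp_unit (i : 'I_2) (p : P 2%N) (q : P 1%N) :
  ocomp i p q = free_coord coordA ord0 (rep q) *: p :> P 2%N.
Proof.
have -> : ocomp i p q = qcls (@pois_relations k) (ocomp i (rep p) (rep q)) by [].
rewrite (free_comp_unit i) free_clsZ -[X in qcls _ X]addr0 qclsP.
by rewrite [qcls _ 0]qcls_eq0 ?addr0 ?[qcls _ (rep p)]cls_repr //;
  have [/(_ 2%N) []] := operad_ideal_is_ideal (@pois_relations k).
Qed.

Lemma pois_unit_comp (i : 'I_1) (p : P 2%N) (q : P 1%N) :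
  ocomp i q p = free_coord coordA ord0 (rep q) *: p :> P 2%N.
Proof.
have -> : ocomp i q p = qcls (@pois_relations k) (ocomp i (rep q) (rep p)) by [].
rewrite [ocomp i _ _](free_unit_comp i) -[X in qcls _ X]addr0 qclsP.
by rewrite [qcls _ 0]qcls_eq0 ?addr0 ?[qcls _ (rep p)]cls_repr //;
  have [/(_ 2%N) []] := operad_ideal_is_ideal (@pois_relations k).
Qed.

(** In arity 1 the cyclic property only involves composition with multiples of
    the unit. *)
Lemma cyclic_relation1 (z : P 2%N) : cyclic_relation (P := P) (n := 1) z -> z = 0.
Proof.
move=> [a [b [eab [eba [x [y [r [s [rs ->]]]]]]]]].
have r1 : r = 1%g.
  apply/perm.permP => j; apply/ord_inj; rewrite rs perm1.
  by case: a b eab {eba x y rs} => [|[|a]] [|[|b]] //= _; case: j => [[|[|//]] Hj].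
rewrite {}r1 {rs} pois_oact1 (_ : _ - _ = 0) ?pois_oactN0 //.
case: a b eab eba x y => [|[|a]] [|[|b]] // eab eba x y.
- rewrite (eq_irrelevance eab erefl) (eq_irrelevance eba erefl) /=.
  by rewrite [X in X - _](pois_unit_comp ord_max) [X in _ - X](pois_comp_unit ord_max) subrr.
- rewrite (eq_irrelevance eab erefl) (eq_irrelevance eba erefl) /=.
  by rewrite [X in X - _](pois_comp_unit ord_max) [X in _ - X](pois_unit_comp ord_max) subrr.
Qed.

Lemma lspan_cyclic1 (z : P 2%N) : lspan (cyclic_relation (P := P) (n := 1)) z -> z = 0.
Proof.
apply: (lspan_le (S := [set z | z = 0])); first exact: subspace0.
exact: cyclic_relation1.
Qed.

Definition wcls (p : P 2%N) : wpart W 1%N := cls _ (cyclic_relation (P := P) (n := 1)) p.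

Lemma rep_wcls p : rep (wcls p) = p.
Proof.
apply/eqP; rewrite -subr_eq0; apply/eqP; apply: lspan_cyclic1.
by apply: rep_cls; apply: sub_lspan.
Qed.

(** A functional on the wheeled part that takes the trace of ad to 1 and the
    trace of the multiplications to 0. *)
Definition poisT m : wpart W m.+1 -> k :=
  if m is 0 return wpart W m.+1 -> k then fun u => @poisH k 0 1 (rep u) else fun=> 0.

Lemma poisTP m a (u v : wpart W m.+1) : poisT (a *: u + v) = a * poisT u + poisT v.
Proof.
case: m u v => [|m] u v; last by rewrite /= mulr0 addr0.
have /lspan_cyclic1/eqP := rep_lin a u v; rewrite subr_eq0 => /eqP E1.
by have [fl _] := family_poisH k; rewrite -fl /poisT E1.
Qed.

Lemma poisT_wact m (s : 'S_m.+1) (u : wpart W m.+1) : poisT (wact s u) = poisT u.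
Proof.
case: m s u => [|m] s u //.
have -> : s = 1%g by apply/perm.permP => j; rewrite !ord1.
have -> : wact 1%g u = cls _ (cyclic_relation (P := P) (n := 1))
    (oact (lift_perm ord_max ord_max 1%g) (rep u) : P 2%N) by [].
by rewrite lift_perm1 pois_oact1 cls_repr.
Qed.

Lemma poisT_contraction (i : 'I_2) (p : P 2%N) :
  @poisT 0 (contraction (w := W) i p) = @poisH k 0 i p.
Proof.
have -> : contraction (w := W) i p = wcls (oact (lift_perm i ord_max 1%g) p) by [].
rewrite /poisT rep_wcls; have [_ fe] := family_poisH k.
rewrite -[RHS](fe 0%N (lift_perm i ord_max 1%g)) lift_perm_id //.
Qed.

(** The trace of the commutator [ad x1, ad x2] is zero, by the cyclic property
    for two brackets composed in their last inputs. *)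
Lemma wcomp_brac (i : 'I_1) :
  wcomp i (wcls (pois_brac k)) (pois_brac k) = 0 :> wpart W 2%N.
Proof.
have -> : wcomp i (wcls (pois_brac k)) (pois_brac k) =
  cls _ (cyclic_relation (P := P) (n := 2))
    (ocomp (lift ord_max i) (rep (wcls (pois_brac k))) (pois_brac k) : P 3%N) by [].
rewrite rep_wcls (_ : lift ord_max i = 0); last by apply/ord_inj; rewrite ord1.
apply: cls_eq0; apply: sub_lspan.
pose r : 'S_3 := tperm 0 1.
have r2 : r (1 + 1) = 1 + 1 by rewrite tpermD.
exists 1%N, 1%N, erefl, erefl, (pois_brac k), (pois_brac k), r, 1%g; split.
  move=> j; case: (j =P 0) => [->|/eqP j0]; first by rewrite tpermL.
  case: (j =P 1) => [->|/eqP j1]; first by rewrite tpermR.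
  by rewrite tpermD 1?eq_sym //; case: j j0 j1 => [[|[|[|//]]] Hj].
rewrite lift_perm1 pois_oact1 /=.
have E1 : 1 = ord_max :> 'I_2 by exact/ord_inj.
have := @jacobi_cyclic k r; rewrite E1; apply => //; by rewrite ?tpermL ?tpermR.
Qed.

End WheeledPart.

(** * Decorated trees and graphs *)

Section Graphs.
Variables (k : fieldType) (P : wheeled_operad k).
Local Notation tree := (tree P).
Local Notation wgraph := (wgraph P).
Local Notation leaves := (@leaves k P).
Local Notation names := (@names k P).
Local Notation arity_ok := (@arity_ok k P).
Local Notation "t # i" := (nth (Leaf 0) t i) (at level 10).
Implicit Types (t b c : tree) (ts us : seq tree) (g : wgraph).

Section TreeInduction.
Variable Q : tree -> Prop.
Hypothesis Q_leaf : forall l, Q (Leaf l).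
Hypothesis Q_node : forall e m (p : P m.+2) ts,
  (forall i, (i < size ts)%N -> Q (ts # i)) -> Q (Node e p ts).

Fixpoint tree_nested_ind t : Q t :=
  match t with
  | Leaf l => Q_leaf l
  | Node e m p ts =>
      @Q_node e m p ts
        ((fix all_ind ts : forall i, (i < size ts)%N -> Q (ts # i) :=
           match ts with
           | [::] => fun i (h : (i < 0)%N) => False_ind _ (notF h)
           | t' :: ts' => fun i =>
               match i return (i < (size ts').+1)%N -> Q ((t' :: ts') # i) with
               | 0 => fun _ => tree_nested_ind t'
               | i'.+1 => fun h => all_ind ts' i' h
               end
           end) ts)
  end.
End TreeInduction.

Lemma eq_map_nth (T : Type) (f h : tree -> T) ts :
  (forall i, (i < size ts)%N -> f (ts # i) = h (ts # i)) -> map f ts = map h ts.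
Proof.
elim: ts => //= t ts IH E; rewrite (E 0%N) // IH // => i it.
exact: (E i.+1).
Qed.

Lemma flatten_map_flatten (T : Type) (ss : seq (seq nat)) (f : nat -> seq T) :
  flatten (map f (flatten ss)) = flatten [seq flatten (map f s) | s <- ss].
Proof. by elim: ss => //= s ss IH; rewrite map_cat flatten_cat IH. Qed.

Lemma leaves_bind f t :
  leaves (bind f t) = flatten [seq leaves (f l) | l <- leaves t].
Proof.
elim/tree_nested_ind: t => [l|e m p ts IH] /=; first by rewrite cats0.
rewrite flatten_map_flatten -!map_comp; congr flatten.
exact: eq_map_nth.
Qed.

Lemma arity_bind f t :
  arity_ok (bind f t) = arity_ok t && all (fun l => arity_ok (f l)) (leaves t).
Proof.
elim/tree_nested_ind: t => [l|e m p ts IH] /=; first by rewrite andbT.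
rewrite size_map -andbA; congr (_ && _).
elim: ts IH => //= t ts IHts IH.
rewrite (IH 0%N) // IHts; last by move=> i it; apply: (IH i.+1).
by rewrite all_cat -!andbA; do !bool_congr.
Qed.

Lemma perm_names_bind f t :
  perm_eq (names (bind f t)) (names t ++ flatten [seq names (f l) | l <- leaves t]).
Proof.
elim/tree_nested_ind: t => [l|e m p ts IH] /=; first by rewrite cats0.
rewrite perm_cons; elim: ts IH => //= t ts IHts IH.
have := perm_cat (IH 0%N isT) (IHts (fun i it => IH i.+1 it)).
rewrite map_cat flatten_cat => /perm_trans; apply; rewrite -!catA perm_cat2l !catA perm_cat2r.
by rewrite permEl //; apply: perm_catC.
Qed.

Lemma perm_flatten_map (f h : nat -> seq nat) s :
  (forall l, perm_eq (f l) (h l)) -> perm_eq (flatten (map f s)) (flatten (map h s)).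
Proof. by move=> fh; elim: s => //= l s IH; apply: perm_cat. Qed.

(** What graph_ok sees of a tree. *)
Definition sim b b' : Prop :=
  [/\ perm_eq (leaves b) (leaves b'), perm_eq (names b) (names b')
    & arity_ok b = arity_ok b'].

Lemma sim_plug l b b' c : sim b b' -> sim (plug l b c) (plug l b' c).
Proof.
move=> [sl sn sa]; split.
- by rewrite !leaves_bind; apply: perm_flatten_map => j; case: eqP.
- apply: perm_trans (perm_names_bind _ _) _; rewrite perm_sym.
  apply: perm_trans (perm_names_bind _ _) _; rewrite perm_cat2l.
  by apply: perm_flatten_map => j; case: eqP => // _; rewrite perm_sym.
- rewrite !arity_bind; congr (_ && _); apply: eq_all => j; by case: eqP.
Qed.

Lemma size_names_plug l b c :
  size (names (plug l b c)) = (size (names c) + count_mem l (leaves c) * size (names b))%N.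
Proof.
rewrite (perm_size (perm_names_bind _ _)) size_cat; congr addn.
by elim: (leaves c) => //= j s IH; rewrite size_cat IH mulnDl; case: eqP; rewrite ?mul1n.
Qed.

Lemma nth_permute m (s : 'S_m) ts (j : 'I_m) : (permute s ts) # j = ts # (s j).
Proof.
rewrite /permute /image_mem (nth_map j) ?size_enum_ord //.
by rewrite nth_ord_enum.
Qed.

Lemma perm_permute m (s : 'S_m) ts : size ts = m ->
  exists ss : seq nat, perm_eq ss (iota 0 m) /\ permute s ts = [seq ts # i | i <- ss].
Proof.
move=> sz; exists [seq val (s i) | i : 'I_m]; split; last by rewrite -map_comp.
rewrite -val_enum_ord /image_mem (map_comp val s); apply: perm_map; apply: uniq_perm.
- by rewrite map_inj_uniq ?enum_uniq //; apply: perm_inj.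
- exact: enum_uniq.
move=> i; rewrite mem_enum; apply/mapP; exists (perm_inv s i); rewrite ?mem_enum //.
by rewrite permKV.
Qed.

Lemma perm_map_permute (T : eqType) (f : tree -> T) m (s : 'S_m) ts : size ts = m ->
  perm_eq (map f (permute s ts)) (map f ts).
Proof.
move=> sz; have [ss [pss ->]] := perm_permute s sz.
have -> : map f ts = [seq f (ts # i) | i <- iota 0 m].
  by rewrite -{1}(mkseq_nth (Leaf 0) ts) /mkseq -map_comp sz.
by rewrite -map_comp; apply: perm_map.
Qed.

Lemma size_permute m (s : 'S_m) ts : size (permute s ts) = m.
Proof. by rewrite /permute /image_mem size_map size_enum_ord. Qed.

Lemma sim_permute e m (p q : P m.+2) (s : 'S_m.+2) ts : size ts = m.+2 ->
  sim (Node e p ts) (Node e q (permute s ts)).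
Proof.
move=> sz; split=> /=.
- by rewrite perm_sym; apply: perm_flatten; apply: perm_map_permute.
- by rewrite perm_cons perm_sym; apply: perm_flatten; apply: perm_map_permute.
- rewrite size_permute sz; congr (_ && _).
  have aE us : all arity_ok us = all id (map arity_ok us) by rewrite all_map.
  by rewrite !aE; apply/esym; apply: perm_all; apply: perm_map_permute.
Qed.

Definition wsim g g' : Prop :=
  match g, g' with
  | Wheel t, Wheel t' => sim t t'
  | Outputless m _ ts, Outputless m' _ ts' =>
      [/\ m = m', size ts = size ts', perm_eq (flatten (map leaves ts)) (flatten (map leaves ts')),
          perm_eq (flatten (map names ts)) (flatten (map names ts'))
        & all arity_ok ts = all arity_ok ts']
  | _, _ => False
  end.

Lemma wsim_graph_ok n g g' o : wsim g g' -> graph_ok n g o = graph_ok n g' o.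
Proof.
case: g g' => [t|m w ts] [t'|m' w' ts'] //= => [[sl sn sa]|[em sz sl sn sa]].
  by rewrite /graph_ok /= sa (permPl sl) (perm_uniq sn) (permPl sn).
by rewrite /graph_ok /= sa sz em (permPl sl) (perm_uniq sn) (permPl sn).
Qed.

Lemma wsim_plug l b b' g : sim b b' -> wsim (wplug l b g) (wplug l b' g).
Proof.
move=> sb; case: g => [t|m w ts] /=; first exact: sim_plug.
split; rewrite ?size_map //; elim: ts => //= t ts IH;
  have [sl sn sa] := sim_plug l t sb; rewrite -?/(plug _ _ _).
- exact: perm_cat.
- exact: perm_cat.
- by rewrite sa IH.
Qed.

End Graphs.

Section MoreGraphs.
Variables (k : fieldType) (P : wheeled_operad k).
Local Notation tree := (tree P).
Local Notation leaves := (@leaves k P).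
Local Notation names := (@names k P).
Local Notation arity_ok := (@arity_ok k P).
Local Notation "t # i" := (nth (Leaf 0) t i) (at level 10).
Local Notation rename := (@rename k P).
Implicit Types (t b c : tree).

Lemma head_names_plug l b b' c :
  head 0%N (names b) = head 0%N (names b') ->
  head 0%N (names (plug l b c)) = head 0%N (names (plug l b' c)).
Proof. by case: c => // l' hb; rewrite /plug /=; case: (l' == l). Qed.

Lemma count_leaves_plug (a : pred nat) l b c :
  (count a (leaves (plug l b c)) =
   count a (filter (predC1 l) (leaves c)) + count_mem l (leaves c) * count a (leaves b))%N.
Proof.
rewrite leaves_bind; elim: (leaves c) => //= j s IH.
rewrite count_cat {}IH; case: (eqVneq j l) => _ /=; lia.
Qed.

Lemma perm_names_plug l b c : count_mem l (leaves c) = 1%N ->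
  perm_eq (names (plug l b c)) (names c ++ names b).
Proof.
move=> cl; apply: perm_trans (perm_names_bind _ _) _; rewrite perm_cat2l.
suff -> : flatten [seq names (if j == l then b else Leaf j) | j <- leaves c]
    = flatten (nseq (count_mem l (leaves c)) (names b)) by rewrite cl /= cats0.
by elim: (leaves c) => //= j s ->; case: (eqVneq j l).
Qed.

Lemma arity_plug l b c : count_mem l (leaves c) = 1%N ->
  arity_ok (plug l b c) = arity_ok c && arity_ok b.
Proof.
move=> cl; rewrite arity_bind; congr (_ && _).
suff -> : all (fun j => arity_ok (if j == l then b else Leaf j)) (leaves c)
    = (count_mem l (leaves c) == 0%N) || arity_ok b by rewrite cl.
elim: (leaves c) => //= j s ->; case: (eqVneq j l) => //= _.
by case: (arity_ok b); rewrite ?orbT ?orbF.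
Qed.

Lemma sim_plug_plug l t t' : count_mem l (leaves t) = 1%N -> count_mem l (leaves t') = 1%N ->
  sim (plug l t t') (plug l t' t).
Proof.
move=> ct ct'; split.
- apply/permP => a; rewrite !count_leaves_plug ct ct' !mul1n.
  have E s : count a s = (count a (filter (predC1 l) s) + count_mem l s * a l)%N.
    by elim: s => //= j s ->; case: (eqVneq j l) => [->|_] /=; lia.
  by rewrite (E (leaves t)) (E (leaves t')) ct ct' !mul1n addnCA.
- apply: perm_trans (perm_names_plug _ ct') _; rewrite perm_sym.
  apply: perm_trans (perm_names_plug _ ct) _.
  by rewrite permEl //; apply: perm_catC.
- by rewrite !arity_plug // andbC.
Qed.

Lemma leaves_rename f t : leaves (rename f t) = leaves t.
Proof.
elim/tree_nested_ind: t => //= e m p ts IH.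
by rewrite -map_comp; congr flatten; apply: eq_map_nth.
Qed.

Lemma names_rename f t : names (rename f t) = map f (names t).
Proof.
elim/tree_nested_ind: t => //= e m p ts IH; congr cons.
by rewrite map_flatten -!map_comp; congr flatten; apply: eq_map_nth.
Qed.

Lemma arity_rename f t : arity_ok (rename f t) = arity_ok t.
Proof.
elim/tree_nested_ind: t => //= e m p ts IH; rewrite size_map; congr (_ && _).
have aE us : all arity_ok us = all id (map arity_ok us) by rewrite all_map.
by rewrite !aE -map_comp; congr (all _ _); apply: eq_map_nth.
Qed.

Lemma nth_rename f (ts : seq tree) i : (map (rename f) ts) # i = rename f (ts # i).
Proof.
have [it|it] := ltnP i (size ts); first by rewrite (nth_map (Leaf 0)).
by rewrite !nth_default ?size_map.
Qed.

End MoreGraphs.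

(** * Functionals of trees with two vertices *)

Section TwoVertexFunctionals.
Variables (k : fieldType) (P : wheeled_operad k).
Local Notation tree := (tree P).
Local Notation leaves := (@leaves k P).
Local Notation names := (@names k P).
Local Notation arity_ok := (@arity_ok k P).
Local Notation "t # i" := (nth (Leaf 0) t i) (at level 10).

Variable g : forall m, P m.+2 -> nat -> tree -> k.

(** Conditions on a function of a vertex p, of one of its inputs j and of the
    tree attached there, under which its sum over the edges at the root is
    multilinear and equivariant on trees with two vertices. *)
Record vertex_pairing : Prop := VertexPairing {
  pairing_leaf : forall m (p : P m.+2) j l, g p j (Leaf l) = 0;
  pairing_linl : forall m a (p q : P m.+2) j t,
    g (a *: p + q) j t = a * g p j t + g q j t;
  pairing_linr : forall m (r : P m.+2) j e n a (p q : P n.+2) ts,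
    g r j (Node e (a *: p + q) ts) = a * g r j (Node e p ts) + g r j (Node e q ts);
  pairing_actl : forall m (s : 'S_m.+2) (p : P m.+2) (j : 'I_m.+2) t,
    g (oact s p) (s j) t = g p j t;
  pairing_actr : forall m (r : P m.+2) j e n (s : 'S_n.+2) (p : P n.+2) ts,
    size ts = n.+2 ->
    g r j (Node e (oact s p) ts) = g r j (Node e p (permute s ts)) }.

Hypothesis pg : vertex_pairing.

Definition edge_sum (t : tree) : k :=
  match t with
  | Leaf _ => 0
  | Node _ m p ts => \sum_(j < m.+2) g p j (ts # j)
  end.

Lemma names_nil t : names t = [::] -> exists l, t = Leaf l.
Proof. by case: t => // l _; exists l. Qed.

(** A context with room for a single further vertex is either empty or has a
    single vertex.  The predicate J tells the inputs of the vertex at which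
    the hole is. *)
Lemma edge_sum_context l c (b : tree) : count_mem l (leaves c) = 1%N ->
  (0 < size (names b))%N -> (size (names (plug l b c)) <= 2)%N ->
  c = Leaf l \/ exists e m (p : P m.+2) ts (J : pred nat), c = Node e p ts /\
    forall b' j, g p j (map (plug l b') ts # j) = if J j then g p j b' else 0.
Proof.
move=> cl b0; rewrite size_names_plug cl mul1n.
case: c cl => [l' /=|e m p ts _] /=.
  by case: eqP => // -> _ _; left.
rewrite addSn ltnS => sz; right; exists e, m, p, ts.
exists (fun j => (j < size ts)%N && (if ts # j is Leaf l' then l' == l else false)).
split=> // b' j.
have [jts|jts] := ltnP j (size ts); last by rewrite nth_default ?size_map ?pairing_leaf.
rewrite (nth_map (Leaf 0)) //.
have [l' ->] : exists l', ts # j = Leaf l'.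
  apply: names_nil; apply/nilP; rewrite /nilp -leqn0.
  have {sz b0} : (size (flatten (map names ts)) <= 0)%N.
    case: (size (names b)) sz b0 => // n; rewrite addnS ltnS => h _.
    exact: leq_trans (leq_addr _ _) h.
  apply: leq_trans; elim: (ts) j jts => // t us IH [|j] jus /=.
    by rewrite size_cat leq_addr.
  by rewrite size_cat (leq_trans (IH j jus)) // leq_addl.
by rewrite /plug /=; case: eqP => // _; rewrite pairing_leaf.
Qed.

Lemma edge_sum_lin c l e m a (p q : P m.+2) ts :
  count_mem l (leaves c) = 1%N ->
  (size (names (plug l (Node e (a *: p + q) ts) c)) <= 2)%N ->
  edge_sum (plug l (Node e (a *: p + q) ts) c) =
  a * edge_sum (plug l (Node e p ts) c) + edge_sum (plug l (Node e q ts) c).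
Proof.
move=> cl sz; have b0 : (0 < size (names (Node e (a *: p + q) ts)))%N by [].
have [->|[f [n [r [us [J [-> H]]]]]]] := edge_sum_context cl b0 sz.
  rewrite /plug /= eqxx /= mulr_sumr -big_split; apply: eq_bigr => j _.
  exact: pairing_linl.
rewrite /plug /= -!/(plug l _) mulr_sumr -big_split; apply: eq_bigr => j _.
rewrite !H /=; case: (J j); last by rewrite mulr0 addr0.
by rewrite (pairing_linr pg).
Qed.

Lemma edge_sum_act c l e m (s : 'S_m.+2) (p : P m.+2) ts :
  count_mem l (leaves c) = 1%N -> size ts = m.+2 ->
  (size (names (plug l (Node e (oact s p) ts) c)) <= 2)%N ->
  edge_sum (plug l (Node e (oact s p) ts) c) =
  edge_sum (plug l (Node e p (permute s ts)) c).
Proof.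
move=> cl szt sz; have b0 : (0 < size (names (Node e (oact s p) ts)))%N by [].
have [->|[f [n [r [us [J [-> H]]]]]]] := edge_sum_context cl b0 sz.
  rewrite /plug /= eqxx /= (reindex_inj (@perm_inj _ s)); apply: eq_bigr => j _.
  by rewrite nth_permute pairing_actl.
rewrite /plug /= -!/(plug l _); apply: eq_bigr => j _.
by rewrite !H; case: (J j) => //; rewrite (pairing_actr pg).
Qed.

End TwoVertexFunctionals.

(** * A cochain on graphs with two vertices *)

(** All that the cocycle needs to know of the Poisson operad: functionals M, H
    on P(2), Y, D on P(3) and T on P_w(1), with the composition table.  An
    abstract operad is used so that contractions of graphs can be computed
    without unfolding the operations of the Poisson operad. *)
Record functionals (k : fieldType) (P : wheeled_operad k) := Functionals {
  fM : forall m, nat -> P m.+2 -> k;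
  fH : forall m, nat -> P m.+2 -> k;
  fY : forall m, nat -> P m.+2 -> k;
  fD : forall m, nat -> P m.+2 -> k;
  fT : forall m, wpart P m.+1 -> k;
  fME : equivariant_family fM;
  fHE : equivariant_family fH;
  fYE : equivariant_family fY;
  fDE : equivariant_family fD;
  fM0 : forall p, @fM 0 0 p = @fM 0 1 p;
  fH0 : forall p, @fH 0 0 p = - @fH 0 1 p;
  fMS : forall m r p, @fM m.+1 r p = 0;
  fHS : forall m r p, @fH m.+1 r p = 0;
  fTS : forall m u, @fT m.+1 u = 0;
  fTP : forall m a u v, @fT m (a *: u + v) = a * fT u + fT v;
  fT_wact : forall m (s : 'S_m.+1) u, @fT m (wact s u) = fT u;
  fT_contraction : forall (i : 'I_2) (p : P 2%N),
    @fT 0 (contraction i p) = @fH 0 i p;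
  fD_ocomp : forall (i : 'I_2) r (p q : P 2%N), (r < 3)%N ->
    @fD 1 r (ocomp i p q) = compD k i r * (@fH 0 1 p * @fH 0 1 q);
  fY_ocomp : forall (i : 'I_2) r (p q : P 2%N), (r < 3)%N ->
    @fY 1 r (ocomp i p q) =
      compY i r (@fH 0 1 p * @fM 0 1 q) (@fM 0 1 p * @fH 0 1 q) }.

Arguments fM {k P} F m r p : rename.
Arguments fH {k P} F m r p : rename.
Arguments fY {k P} F m r p : rename.
Arguments fD {k P} F m r p : rename.
Arguments fT {k P} F m u : rename.

Section Cochain.
Variables (k : fieldType) (W : wheeled_operad k) (F : functionals W).
Local Notation tree := (tree W).
Local Notation wgraph := (wgraph W).
Local Notation leaves := (@leaves k W).
Local Notation names := (@names k W).
Local Notation arity_ok := (@arity_ok k W).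
Local Notation "t # i" := (nth (Leaf 0) t i) (at level 10).

(** The value on a wheel whose cycle consists of a binary vertex p and a
    ternary vertex q, with i and j their inputs on the cycle and the edge
    below q first in the wedge product; it is 0 in all other arities. *)
Definition cycle_half m (p : W m.+2) (i : nat) n (q : W n.+2) (j : nat) : k :=
  fH F m i p * fY F n j q - (fM F m 1 p * fD F n j q) *+ 2.

(** Antisymmetric, since rotating a wheel with two vertices exchanges its two
    edges in the wedge product. *)
Definition cycle_pairing m (p : W m.+2) (j : nat) n (q : W n.+2) (i : nat) : k :=
  cycle_half q i p j - cycle_half p j q i.

(** For a binary p and a ternary t outside of the cycle both terms vanish for
    reasons of arity. *)
Definition wheel_pairing m (p : W m.+2) (j : nat) (t : tree) : k :=
  match t with
  | Leaf _ => 0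
  | Node _ n q us =>
      if 0%N \in leaves t
      then \sum_(i < n.+2 | 0%N \in leaves (us # i)) cycle_pairing p j q i
      else (fD F m j p * fM F n 1 q) *+ 2
  end.

Definition root_pairing m (p : W m.+2) (j : nat) (t : tree) : k :=
  match t with
  | Leaf _ => 0
  | Node _ n q us => - (fH F m j p * fM F n 1 q) *+ 2
  end.

Lemma fM_oact m (s : 'S_m.+2) p : fM F m 1 (oact s p) = fM F m 1 p.
Proof.
case: m s p => [|m] s p; last by rewrite !fMS.
have [_ fe] := fME F.
have := fe 0%N s ord0 p; rewrite [fM F 0 ord0 p]fM0 => <-.
by case: (s ord0) => [[|[|//]] Hi] //; apply/esym/fM0.
Qed.

Lemma cycle_half_linl m a (p p' : W m.+2) i n (q : W n.+2) j :
  cycle_half (a *: p + p') i q j = a * cycle_half p i q j + cycle_half p' i q j.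
Proof.
have [hM _] := fME F; have [hH _] := fHE F.
by rewrite /cycle_half hM hH; ring.
Qed.

Lemma cycle_half_linr m (p : W m.+2) i n a (q q' : W n.+2) j :
  cycle_half p i (a *: q + q') j = a * cycle_half p i q j + cycle_half p i q' j.
Proof.
have [hY _] := fYE F; have [hD _] := fDE F.
by rewrite /cycle_half hY hD; ring.
Qed.

Lemma cycle_half_actl m (s : 'S_m.+2) (p : W m.+2) (i : 'I_m.+2) n (q : W n.+2) j :
  cycle_half (oact s p) (s i) q j = cycle_half p i q j.
Proof.
by have [_ hH] := fHE F; rewrite /cycle_half fM_oact hH.
Qed.

Lemma cycle_half_actr m (p : W m.+2) i n (s : 'S_n.+2) (q : W n.+2) (j : 'I_n.+2) :
  cycle_half p i (oact s q) (s j) = cycle_half p i q j.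
Proof.
have [_ hY] := fYE F; have [_ hD] := fDE F.
by rewrite /cycle_half hY hD.
Qed.

Lemma wheel_pairingP : vertex_pairing wheel_pairing.
Proof.
have [hM _] := fME F; have [hD aD] := fDE F.
split=> [//|m a p q j [l|e n r us]|m r j e n a p q us|m s p j [l|e n r us]|m r j e n s p us sz] /=.
- by rewrite mulr0 addr0.
- case: ifP => _; last by rewrite hD; ring.
  rewrite mulr_sumr -big_split; apply: eq_bigr => i _ /=.
  by rewrite /cycle_pairing cycle_half_linl cycle_half_linr; ring.
- case: ifP => _; last by rewrite hM; ring.
  rewrite mulr_sumr -big_split; apply: eq_bigr => i _ /=.
  by rewrite /cycle_pairing cycle_half_linl cycle_half_linr; ring.
- by [].
- case: ifP => _; last by rewrite aD.
  by apply: eq_bigr => i _; rewrite /cycle_pairing cycle_half_actl cycle_half_actr.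
- have -> : (0%N \in flatten (map leaves (permute s us))) = (0%N \in flatten (map leaves us)).
    by apply: perm_mem; apply: perm_flatten; apply: perm_map_permute.
  case: ifP => _; last by rewrite fM_oact.
  rewrite (reindex_inj (@perm_inj _ s)); apply: eq_big => [i|i _].
    by rewrite nth_permute.
  by rewrite /cycle_pairing cycle_half_actl cycle_half_actr.
Qed.

Lemma root_pairingP : vertex_pairing root_pairing.
Proof.
have [hM _] := fME F; have [hH aH] := fHE F.
split=> [//|m a p q j [l|e n r us]|m r j e n a p q us|m s p j [l|e n r us]|m r j e n s p us sz] /=.
- by rewrite mulr0 addr0.
- by rewrite hH; ring.
- by rewrite hM; ring.
- by [].
- by rewrite aH.
- by rewrite fM_oact.
Qed.

Definition graph_value (g : wgraph) : k :=
  match g with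
  | Wheel t => edge_sum wheel_pairing t
  | Outputless m w ts => fT F m w * edge_sum root_pairing (ts # 0)
  end.

Definition first_name (g : wgraph) : nat :=
  match g with
  | Wheel t => head 0%N (names t)
  | Outputless m w ts => head 0%N (names (ts # 0))
  end.

(** A graph with two edges has two orderings of them, distinguished by the
    first one; the reference ordering begins with the edge of the root vertex.
    *)
Definition phi : graph_cochain W := fun g o =>
  if graph_ok 3 g o && (size o == 2)
  then (-1) ^+ (head 0%N o != first_name g) * graph_value g else 0.

End Cochain.

(** * The cochain is a graph cochain *)

Section CochainAxioms.
Variables (k : fieldType) (W : wheeled_operad k) (F : functionals W).
Local Notation tree := (tree W).
Local Notation wgraph := (wgraph W).
Local Notation leaves := (@leaves k W).
Local Notation names := (@names k W).
Local Notation arity_ok := (@arity_ok k W).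
Local Notation "t # i" := (nth (Leaf 0) t i) (at level 10).

Lemma phiE g o : graph_ok 3 g o -> size o = 2%N ->
  phi F g o = (-1) ^+ (head 0%N o != first_name g) * graph_value F g.
Proof. by move=> gok so; rewrite /phi gok so. Qed.

Lemma wnames_size n (g : wgraph) o : graph_ok n g o -> size (wnames g) = size o.
Proof. by move=> /and3P[_ _ /perm_size]. Qed.

Lemma first_name_plug l b b' (g : wgraph) :
  head 0%N (names b) = head 0%N (names b') ->
  first_name (wplug l b g) = first_name (wplug l b' g).
Proof.
move=> hb; case: g => [t|m w [|t ts]] //=; exact: head_names_plug.
Qed.

Lemma outputless1 m w ts n o : graph_ok n (@Outputless k W m w ts) o ->
  m = 0%N -> ts = [:: ts # 0].
Proof.
move=> /and3P[/and3P[/eqP sz _ _] _ _] m0; rewrite m0 in sz.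
by case: ts sz => [|t [|]].
Qed.

Lemma graph_value_lin c l e m (a : k) (p q : W m.+2) ts o :
  count_mem l (wleaves c) = 1%N -> graph_ok 3 (wplug l (Node e (a *: p + q) ts) c) o ->
  size o = 2%N ->
  graph_value F (wplug l (Node e (a *: p + q) ts) c) =
  a * graph_value F (wplug l (Node e p ts) c) + graph_value F (wplug l (Node e q ts) c).
Proof.
move=> cl gok so; have := wnames_size gok; rewrite so.
case: c cl gok => [t|[|n] w us] cl gok sz.
- by apply: (edge_sum_lin (wheel_pairingP F)) => //; rewrite sz.
- have := @outputless1 0 w _ 3 o gok erefl; case: us cl {gok} sz => [//|u [|//]] cl sz _.
  have {}cl : count_mem l (leaves u) = 1%N by rewrite -cl /= cats0.
  have {}sz : (size (names (plug l (Node e (a *: p + q) ts) u)) <= 2)%N.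
    by rewrite -sz /= cats0.
  have E := edge_sum_lin (root_pairingP F) cl sz.
  by rewrite -[LHS]/(_ * edge_sum _ _) E mulrDr mulrCA.
- by rewrite /= !fTS !mul0r mulr0 addr0.
Qed.

Lemma graph_value_act c l e m (s : 'S_m.+2) (p : W m.+2) ts o :
  count_mem l (wleaves c) = 1%N -> size ts = m.+2 ->
  graph_ok 3 (wplug l (Node e (oact s p) ts) c) o -> size o = 2%N ->
  graph_value F (wplug l (Node e (oact s p) ts) c) =
  graph_value F (wplug l (Node e p (permute s ts)) c).
Proof.
move=> cl szt gok so; have := wnames_size gok; rewrite so.
case: c cl gok => [t|[|n] w us] cl gok sz.
- by apply: (edge_sum_act (wheel_pairingP F)) => //; rewrite sz.
- have := @outputless1 0 w _ 3 o gok erefl; case: us cl {gok} sz => [//|u [|//]] cl sz _.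
  have {}cl : count_mem l (leaves u) = 1%N by rewrite -cl /= cats0.
  have {}sz : (size (names (plug l (Node e (oact s p) ts) u)) <= 2)%N.
    by rewrite -sz /= cats0.
  have E := edge_sum_act (root_pairingP F) cl szt sz.
  by rewrite -[LHS]/(_ * edge_sum _ _) E.
- by rewrite /= !fTS !mul0r.
Qed.

Lemma phi_lin c l e m (a : k) (p q : W m.+2) ts o :
  count_mem l (wleaves c) = 1%N ->
  phi F (wplug l (Node e (a *: p + q) ts) c) o =
  a * phi F (wplug l (Node e p ts) c) o + phi F (wplug l (Node e q ts) c) o.
Proof.
move=> cl.
have sp (r : W m.+2) : sim (Node e (a *: p + q) ts : tree) (Node e r ts) by split.
rewrite /phi -!(wsim_graph_ok _ _ (wsim_plug l _ (sp _))).
have [|_] := boolP (graph_ok _ _ _); last by rewrite mulr0 addr0.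
have [/eqP so gok|_ _] := boolP (size o == 2%N); last by rewrite mulr0 addr0.
rewrite (graph_value_lin cl gok so) -!(first_name_plug l _ (b := Node e (a *: p + q) ts)) //.
by rewrite mulrDr mulrCA.
Qed.

Lemma phi_act c l e m (s : 'S_m.+2) (p : W m.+2) ts o :
  count_mem l (wleaves c) = 1%N -> size ts = m.+2 ->
  phi F (wplug l (Node e (oact s p) ts) c) o =
  phi F (wplug l (Node e p (permute s ts)) c) o.
Proof.
move=> cl szt.
have sp : sim (Node e (oact s p) ts : tree) (Node e p (permute s ts)) by apply: sim_permute.
rewrite /phi -(wsim_graph_ok _ _ (wsim_plug l _ sp)).
have [|_] := boolP (graph_ok _ _ _); last by [].
have [/eqP so gok|_ _] := boolP (size o == 2%N); last by [].
by rewrite (graph_value_act cl szt gok so) (first_name_plug l (b' := Node e p (permute s ts))).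
Qed.

Lemma phi_root_lin m (a : k) (u v : wpart W m.+1) ts o :
  phi F (Outputless (a *: u + v) ts) o =
  a * phi F (Outputless u ts) o + phi F (Outputless v ts) o.
Proof.
rewrite /phi -!(@wsim_graph_ok _ _ 3 (Outputless (a *: u + v) ts)) //.
case: ifP => _; last by rewrite mulr0 addr0.
by rewrite /graph_value fTP mulrDl mulrDr -mulrA mulrCA.
Qed.

Lemma phi_root_act m (s : 'S_m.+1) (u : wpart W m.+1) ts o : size ts = m.+1 ->
  phi F (Outputless (wact s u) ts) o = phi F (Outputless u (permute s ts)) o.
Proof.
move=> sz; case: m s u sz => [|m] s u sz; last first.
  by rewrite /phi /= !fTS !mul0r !mulr0 !if_same.
have -> : permute s ts = ts.
  apply: (@eq_from_nth _ (Leaf 0)); first by rewrite size_permute sz.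
  rewrite size_permute => -[|//] _.
  by have := nth_permute s ts ord0; rewrite (ord1 (s ord0)).
rewrite /phi -(@wsim_graph_ok _ _ 3 (Outputless (wact s u) ts)) //.
by rewrite /graph_value fT_wact.
Qed.

End CochainAxioms.

Section CochainSymmetries.
Variables (k : fieldType) (W : wheeled_operad k) (F : functionals W).
Local Notation tree := (tree W).
Local Notation wgraph := (wgraph W).
Local Notation leaves := (@leaves k W).
Local Notation names := (@names k W).
Local Notation arity_ok := (@arity_ok k W).
Local Notation rename := (@rename k W).
Local Notation "t # i" := (nth (Leaf 0) t i) (at level 10).

Lemma plug_leaf l (t : tree) : plug l (Leaf l) t = t.
Proof.
elim/tree_nested_ind: t => [j|e m p ts IH]; rewrite /plug /=.
  by case: eqP => [->|].
congr Node; rewrite -[RHS]map_id; exact: eq_map_nth.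
Qed.

(** For two vertices on a cycle the sum over edges only sees the two inputs on
    the cycle. *)
Lemma edge_sum_two_cycle e m (p : W m.+2) ts f n (q : W n.+2) us :
  names (Node e p ts) = [:: e] -> names (Node f q us) = [:: f] ->
  size us = n.+2 -> count_mem 0%N (leaves (Node e p ts)) = 1%N ->
  edge_sum (wheel_pairing F) (plug 0 (Node e p ts) (Node f q us)) =
  \sum_(j < n.+2 | 0%N \in leaves (us # j))
    \sum_(i < m.+2 | 0%N \in leaves (ts # i)) cycle_pairing F q j p i.
Proof.
move=> _ Nq szu ct.
have h0 : 0%N \in leaves (Node e p ts) by rewrite -has_pred1 has_count ct.
rewrite /plug /= -/(plug 0 _) [RHS]big_mkcond.
apply: eq_bigr => j _; rewrite (nth_map (Leaf 0)) ?szu //.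
have [l El] : exists l, us # j = Leaf l.
  apply: names_nil; case: Nq; elim: (us) (nat_of_ord j) => [|u us' IH] [|i] //=.
    by case: (names u).
  by case: (names u) => //= /IH; apply.
rewrite El /plug /= inE eq_sym; case: eqP => // _.
by rewrite /wheel_pairing h0.
Qed.

Lemma cycle_pairing_anti m (p : W m.+2) j n (q : W n.+2) i :
  cycle_pairing F p j q i = - cycle_pairing F q i p j.
Proof. by rewrite /cycle_pairing [RHS]opprB. Qed.

Lemma perm_pair (x y : nat) o : perm_eq o [:: x; y] -> o = [:: x; y] \/ o = [:: y; x].
Proof.
move=> po; have := perm_size po; case: o po => [|a [|b [|]]] // po _.
have := perm_mem po a; rewrite !inE eqxx /= => /esym/orP[/eqP ax|/eqP ay].
  left; rewrite ax in po *; move: po; rewrite perm_cons => /perm_mem/(_ b).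
  by rewrite !inE eqxx => /esym/eqP->.
right; rewrite ay in po *.
have : perm_eq [:: y; b] [:: y; x].
  by apply: perm_trans po _; apply: permEl; apply: (perm_catC [:: x] [:: y]).
by rewrite perm_cons => /perm_mem/(_ b); rewrite !inE eqxx => /esym/eqP->.
Qed.

Lemma phi_rotate t t' o :
  count_mem 0%N (leaves t) = 1%N -> count_mem 0%N (leaves t') = 1%N ->
  phi F (Wheel (plug 0 t t')) o = phi F (Wheel (plug 0 t' t)) o.
Proof.
move=> ct ct'; rewrite /phi.
rewrite -(@wsim_graph_ok _ _ 3 (Wheel (plug 0 t t')) (Wheel (plug 0 t' t))); last exact: sim_plug_plug.
have [gok|//] := boolP (graph_ok _ _ _).
have [/eqP so|//] := boolP (size o == 2%N).
have sz := wnames_size gok; rewrite so /= size_names_plug ct' mul1n in sz.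
case: t t' ct ct' gok sz => [l|e m p ts] [l'|f n q us] ct ct' gok sz.
- rewrite /= in ct ct'; move: ct ct'.
  by case: (l =P 0%N) => // -> _; case: (l' =P 0%N) => // ->.
- by rewrite /= in ct; move: ct; case: (l =P 0%N) => // -> _; rewrite plug_leaf.
- by rewrite /= in ct'; move: ct'; case: (l' =P 0%N) => // -> _; rewrite plug_leaf.
have [Np Nq] : names (Node e p ts) = [:: e] /\ names (Node f q us) = [:: f].
  move: sz => /=; rewrite addSn addnS => -[] /eqP; rewrite addn_eq0 => /andP[].
  by rewrite !size_eq0 => /eqP-> /eqP->.
have := perm_names_plug (Node e p ts) ct'; rewrite Np Nq => Pn.
have /and3P[/andP[ar _] un po] := gok.
rewrite arity_plug // in ar; case/andP: ar => /= /andP[/eqP szu _] /andP[/eqP szt _].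
have {un} ef : f != e by move: un; rewrite [uniq _](perm_uniq Pn) /= inE andbT.
have Po : perm_eq o [:: f; e] by apply: perm_trans Pn; rewrite perm_sym.
have E1 := edge_sum_two_cycle Np Nq szu ct; have E2 := edge_sum_two_cycle Nq Np szt ct'.
rewrite -[LHS]/((-1) ^+ (head 0%N o != f) *
  edge_sum (wheel_pairing F) (plug 0 (Node e p ts) (Node f q us))) {}E1.
rewrite -[RHS]/((-1) ^+ (head 0%N o != e) *
  edge_sum (wheel_pairing F) (plug 0 (Node f q us) (Node e p ts))) {}E2.
rewrite [in RHS]exchange_big /=.
under [in RHS]eq_bigr => j _ do under eq_bigr => i _ do rewrite cycle_pairing_anti.
under [in RHS]eq_bigr => j _ do rewrite sumrN.
rewrite sumrN.
case: (perm_pair Po) => -> /=; rewrite eqxx.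
  by rewrite ef expr0 expr1 mul1r mulN1r opprK.
by rewrite eq_sym ef expr0 expr1 mul1r mulN1r.
Qed.

Lemma edge_sum_rename (g : forall m, W m.+2 -> nat -> tree -> k) f t :
  (forall m (p : W m.+2) j t', g m p j (rename f t') = g m p j t') ->
  edge_sum g (rename f t) = edge_sum g t.
Proof.
move=> gf; case: t => //= e m p ts; apply: eq_bigr => j _.
by rewrite nth_rename gf.
Qed.

Lemma wheel_pairing_rename f m (p : W m.+2) j t :
  wheel_pairing F p j (rename f t) = wheel_pairing F p j t.
Proof.
case: t => // e n q us; have := leaves_rename f (Node e q us).
rewrite /wheel_pairing [rename _ _]/= => ->; case: ifP => // _.
by apply: eq_bigl => i; rewrite nth_rename leaves_rename.
Qed.

Lemma root_pairing_rename f m (p : W m.+2) j t :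
  root_pairing F p j (rename f t) = root_pairing F p j t.
Proof. by case: t. Qed.

Lemma phi_rename f (g : wgraph) o : injective f -> phi F (wrename f g) (map f o) = phi F g o.
Proof.
move=> fI; have gokE : graph_ok 3 (wrename f g) (map f o) = graph_ok 3 g o.
  have mp (s s' : seq nat) : perm_eq (map f s) (map f s') = perm_eq s s'.
    by apply/idP/idP => [|/(perm_map f)//]; apply: perm_map_inj.
  rewrite /graph_ok; case: g => [t|m w ts] /=.
    by rewrite arity_rename leaves_rename names_rename map_inj_uniq // mp.
  have -> : flatten (map names (map (rename f) ts)) = map f (flatten (map names ts)).
    by rewrite map_flatten -!map_comp; congr flatten; apply: eq_map => t; apply: names_rename.
  rewrite size_map map_inj_uniq // mp all_map -map_comp.
  rewrite (eq_all (a2 := arity_ok)); last by move=> t; apply: arity_rename.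
  by rewrite (eq_map (g := leaves)) // => t; apply: leaves_rename.
rewrite /phi gokE size_map; case: ifP => // /andP[gok /eqP so].
have sz := wnames_size gok; rewrite so in sz.
have hm s : (0 < size s)%N -> head 0%N (map f s) = f (head 0%N s) by case: s.
suff [E|E] : graph_value F g = 0 /\ graph_value F (wrename f g) = 0 \/
    graph_value F (wrename f g) = graph_value F g /\
    first_name (wrename f g) = f (first_name g).
- by case: E => -> ->; rewrite !mulr0.
- by case: E => -> ->; rewrite hm ?so // (inj_eq fI).
case: g gok {gokE} sz => [t|[|m] w ts] gok sz; last by left; rewrite /= !fTS !mul0r.
  right; split; first exact: (edge_sum_rename _ (wheel_pairing_rename f)).
  by rewrite -[LHS]/(head 0%N (names (rename f t))) names_rename hm // [size _]sz.
right; have tsE := @outputless1 k W 0 w _ 3 o gok erefl; rewrite tsE in sz *; split.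
  congr (_ * _); exact: (edge_sum_rename _ (root_pairing_rename f)).
rewrite -[LHS]/(head 0%N (names (rename f (ts # 0)))) names_rename hm //.
by move: sz; rewrite /= cats0 => ->.
Qed.

(** The sign in phi depends on the ordering only if the reference edge is one
    of the two edges of the graph, which may fail only for an outputless graph
    whose root has several inputs. *)
Lemma first_name_in (g : wgraph) o : graph_ok 3 g o -> size o = 2%N ->
  graph_value F g = 0 \/ first_name g \in o.
Proof.
move=> gok so; have sz := wnames_size gok; rewrite so in sz.
have hin (s : seq nat) : (0 < size s)%N -> head 0%N s \in s by case: s => // x s _; rewrite inE eqxx.
have /and3P[_ _ /perm_mem no] := gok.
case: g gok sz no => [t|[|m] w ts] gok sz no; last by left; rewrite /= !fTS !mul0r.
  by right; rewrite -no; apply: hin; rewrite [size _]sz.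
right; have tsE := @outputless1 k W 0 w _ 3 o gok erefl; rewrite tsE in sz no *.
by rewrite -no /= cats0; apply: hin; move: sz; rewrite /= cats0 => ->.
Qed.

Lemma reorder_sign2 (a b c d : nat) : a != b -> perm_eq [:: c; d] [:: a; b] ->
  reorder_sign k [:: c; d] [:: a; b] = (-1) ^+ (c != a).
Proof.
move=> ab /perm_pair[] [-> ->]; rewrite /reorder_sign /= !eqxx /= ?(negbTE ab) ?(eq_sym b a) ?(negbTE ab) //=.
Qed.

Lemma phi_reorder (g : wgraph) o o' : perm_eq o o' ->
  phi F g o = reorder_sign k o o' * phi F g o'.
Proof.
move=> oo'; rewrite /phi.
have gE : graph_ok 3 g o = graph_ok 3 g o' by rewrite /graph_ok (permPr oo').
rewrite gE (perm_size oo'); case: ifP => [/andP[gok /eqP so']|_]; last by rewrite mulr0.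
have so : size o = 2%N by rewrite (perm_size oo').
case: o so oo' {gE} => [|c [|d []]] // _; case: o' so' gok => [|a [|b []]] // _ gok cd.
have ab : a != b.
  by case/and3P: gok => _ un po; move: un; rewrite (perm_uniq po) /= inE andbT.
rewrite reorder_sign2 //; have [->|] := first_name_in gok erefl; first by rewrite !mulr0.
rewrite !inE mulrA => n_ab; congr (_ * _).
case: (perm_pair cd) => -[-> _]; rewrite ?eqxx ?expr0 ?mul1r // [b == a]eq_sym ab expr1.
by case/orP: n_ab => /eqP->; rewrite eqxx ?[b == a]eq_sym ab /= ?expr0 ?expr1 ?mulr1 // mulrNN mulr1.
Qed.

End CochainSymmetries.

(** * Wheeled binary trees with three vertices *)

Section Cocycle.
Variables (k : fieldType) (W : wheeled_operad k) (F : functionals W).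
Local Notation tree := (tree W).
Local Notation wgraph := (wgraph W).
Local Notation leaves := (@leaves k W).
Local Notation names := (@names k W).
Local Notation arity_ok := (@arity_ok k W).
Local Notation "t # i" := (nth (Leaf 0) t i) (at level 10).

(** Each vertex has at least two inputs. *)
Lemma names_lt_leaves (t : tree) : arity_ok t -> (size (names t) < size (leaves t))%N.
Proof.
elim/tree_nested_ind: t => // e m p ts IH /= /andP[/eqP sz ar].
suff : (size (flatten (map names ts)) + size ts <= size (flatten (map leaves ts)))%N.
  by rewrite sz; lia.
elim: ts IH ar {sz} => //= t ts IHts IH /andP[at_ ats].
have := IH 0%N isT at_; have := IHts (fun i h => IH i.+1 h) ats.
by rewrite !size_cat /=; lia.
Qed.

(** The bound of names_lt_leaves is attained exactly by the binary trees. *)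
Definition binary (t : tree) := arity_ok t /\ (size (leaves t) <= (size (names t)).+1)%N.

Lemma binary_node e m (p : W m.+2) ts : binary (Node e p ts) ->
  exists (q : W 2%N) t1 t2, [/\ Node e p ts = @Node k W e 0 q [:: t1; t2],
    binary t1 & binary t2].
Proof.
case=> /= /andP[/eqP sz ar] le.
have lt us : all arity_ok us ->
    (size (flatten (map names us)) + size us <= size (flatten (map leaves us)))%N.
  elim: us => //= u us IH /andP[/names_lt_leaves au /IH]; rewrite !size_cat; lia.
have m0 : m = 0%N by have := lt _ ar; rewrite sz; lia.
subst m; case: ts sz ar le => [|t1 [|t2 []]] //= _ /and3P[a1 a2 _].
rewrite !cats0 !size_cat => le; exists p, t1, t2; split=> //; split=> //.
  by have := names_lt_leaves a2; lia.
by have := names_lt_leaves a1; lia.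
Qed.

Lemma binary_names0 t : binary t -> size (names t) = 0%N -> exists l, t = Leaf l.
Proof. by case: t => [l|] // _ _; exists l. Qed.

Lemma binary_names1 t : binary t -> size (names t) = 1%N ->
  exists e (p : W 2%N) a b, t = @Node k W e 0 p [:: Leaf a; Leaf b].
Proof.
case: t => [l|e m p ts] // /binary_node[q [t1 [t2 [-> b1 b2]]]] /=.
rewrite cats0 size_cat => -[] /eqP; rewrite addn_eq0 => /andP[/eqP s1 /eqP s2].
have [a ->] := binary_names0 b1 s1; have [b ->] := binary_names0 b2 s2.
by exists e, q, a, b.
Qed.

Local Notation N2 e p t u := (@Node k W e 0 p [:: t; u]).

Lemma binary_names2 t : binary t -> size (names t) = 2%N ->
  exists e f (p q : W 2%N) a b c,
    t = N2 e p (N2 f q (Leaf a) (Leaf b)) (Leaf c) \/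
    t = N2 e p (Leaf a) (N2 f q (Leaf b) (Leaf c)).
Proof.
case: t => [l|e m p ts] // /binary_node[q [t1 [t2 [-> b1 b2]]]] /=.
rewrite cats0 size_cat => -[].
case s1 : (size (names t1)) => [|[|n]] //=.
- rewrite add0n => s2; have [a ->] := binary_names0 b1 s1.
  have [f [r [b [c ->]]]] := binary_names1 b2 s2.
  by exists e, f, q, r, a, b, c; right.
- case=> s2; have [c ->] := binary_names0 b2 s2.
  have [f [r [a [b ->]]]] := binary_names1 b1 s1.
  by exists e, f, q, r, a, b, c; left.
Qed.

(** The planar binary trees with three vertices, whose edges are named in
    prefix order. *)
Definition shape3 (i : nat) (e f h : nat) (p q r : W 2%N) (a b c d : nat) : tree :=
  match i with
  | 0 => N2 e p (Leaf a) (N2 f q (Leaf b) (N2 h r (Leaf c) (Leaf d)))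
  | 1 => N2 e p (Leaf a) (N2 f q (N2 h r (Leaf b) (Leaf c)) (Leaf d))
  | 2 => N2 e p (N2 f q (Leaf a) (N2 h r (Leaf b) (Leaf c))) (Leaf d)
  | 3 => N2 e p (N2 f q (N2 h r (Leaf a) (Leaf b)) (Leaf c)) (Leaf d)
  | _ => N2 e p (N2 f q (Leaf a) (Leaf b)) (N2 h r (Leaf c) (Leaf d))
  end.

Lemma binary_names3 t : binary t -> size (names t) = 3%N ->
  exists2 i, (i < 5)%N & exists e f h p q r a b c d, t = shape3 i e f h p q r a b c d.
Proof.
case: t => [l|e m p ts] // /binary_node[q [t1 [t2 [-> b1 b2]]]] /=.
rewrite cats0 size_cat => -[].
case s1 : (size (names t1)) => [|[|[|n]]] //=.
- rewrite add0n => s2; have [a ->] := binary_names0 b1 s1.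
  have [f [g [r [s [b [c [d [->|->]]]]]]]] := binary_names2 b2 s2.
    by exists 1%N => //; exists e, f, g, q, r, s, a, b, c, d.
  by exists 0%N => //; exists e, f, g, q, r, s, a, b, c, d.
- case=> s2; have [f [r [a [b ->]]]] := binary_names1 b1 s1.
  have [g [s [c [d ->]]]] := binary_names1 b2 s2.
  by exists 4%N => //; exists e, f, g, q, r, s, a, b, c, d.
- rewrite !addSn => -[] s2; have [d ->] := binary_names0 b2 s2.
  have [f [g [r [s [a [b [c [->|->]]]]]]]] := binary_names2 b1 s1.
    by exists 3%N => //; exists e, f, g, q, r, s, a, b, c, d.
  by exists 2%N => //; exists e, f, g, q, r, s, a, b, c, d.
Qed.

Definition alternating_sum (g : wgraph) x y z : k :=
  phi F (wcontract x g) [:: y; z] - phi F (wcontract y g) [:: x; z]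
  + phi F (wcontract z g) [:: x; y].

(** Contracting an edge removes one vertex and phi is supported on graphs with
    two of them. *)
Lemma d_phi_sum g o : graph_ok 3 g o -> size o <> 3 -> d_w 3 (phi F) g o = 0.
Proof.
move=> gok so; rewrite /d_w gok big1 // => j _; rewrite /phi.
rewrite ifN ?mulr0 // negb_and; apply/orP; right; apply/eqP => sj; apply: so.
move: sj; rewrite /omit size_cat size_take size_drop ltn_ord.
by have := ltn_ord j; lia.
Qed.

Lemma d_phi3 g x y z : graph_ok 3 g [:: x; y; z] ->
  d_w 3 (phi F) g [:: x; y; z] = alternating_sum g x y z.
Proof.
move=> gok; rewrite /d_w gok !big_ord_recl big_ord0.
rewrite [nth _ _ _]/= [omit _ _]/= expr0 mul1r.
rewrite [nth _ _ (lift ord0 ord0)]/= [omit (lift ord0 ord0) _]/= /bump /= expr1.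
rewrite [omit 2 _]/= /omit /= sqrrN expr1n addr0 mulN1r mul1r.
by rewrite addrA.
Qed.

Lemma phi_swap g x y : x != y -> phi F g [:: x; y] = - phi F g [:: y; x].
Proof.
move=> xy; rewrite (@phi_reorder _ _ F g [:: x; y] [:: y; x]); last first.
  by apply: permEl; apply: (perm_catC [:: x] [:: y]).
have yx : y != x by rewrite eq_sym.
rewrite reorder_sign2 //; first by rewrite xy expr1 mulN1r.
by apply: permEl; apply: (perm_catC [:: x] [:: y]).
Qed.

Lemma perm_graph_ok n (g : wgraph) o o' : perm_eq o o' -> graph_ok n g o = graph_ok n g o'.
Proof. by move=> oo'; rewrite /graph_ok (permPr oo'). Qed.

Lemma hook_unique a b c d : perm_eq [:: a; b; c; d] (iota 0 4) ->
  ((a == 0) + ((b == 0) + ((c == 0) + (d == 0))) = 1)%N.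
Proof. by move=> /permP/(_ (pred1 0%N)); rewrite /= !addn0. Qed.

Lemma alternating_swap12 g x y z : x != y ->
  alternating_sum g y x z = - alternating_sum g x y z.
Proof. by move=> xy; rewrite /alternating_sum (phi_swap _ xy); ring. Qed.

Lemma alternating_swap23 g x y z : y != z ->
  alternating_sum g x z y = - alternating_sum g x y z.
Proof. by move=> yz; rewrite /alternating_sum (phi_swap _ yz); ring. Qed.

(** An alternating sum is alternating in the ordering of the three edges, so a
    single ordering has to be checked. *)
Lemma alternating_perm g x y z o : uniq [:: x; y; z] -> perm_eq o [:: x; y; z] ->
  alternating_sum g x y z = 0 ->
  exists a b c, o = [:: a; b; c] /\ alternating_sum g a b c = 0.
Proof.
rewrite /= !inE negb_or => /and3P[/andP[xy xz] yz _] po A0.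
have := perm_size po; case: o po => [|a o] // po _.
have pc u v (s : seq nat) : perm_eq [:: u, v & s] [:: v, u & s].
  by rewrite -[[:: u, v & s]]/([:: u; v] ++ s) -[[:: v, u & s]]/([:: v; u] ++ s)
    perm_cat2r; apply: permEl; apply: (perm_catC [:: u] [:: v]).
have := perm_mem po a; rewrite inE eqxx /= !inE => /esym/or3P[] /eqP ea;
  rewrite ea in po *.
- move: po; rewrite perm_cons => /perm_pair[] ->.
    by exists x, y, z.
  by exists x, z, y; rewrite alternating_swap23 // A0 oppr0.
- have A1 : alternating_sum g y x z = 0 by rewrite alternating_swap12 // A0 oppr0.
  have := perm_trans po (pc _ _ _); rewrite perm_cons => /perm_pair[] ->.
    by exists y, x, z.
  by exists y, z, x; rewrite alternating_swap23 // A1 oppr0.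
- have A1 : alternating_sum g x z y = 0 by rewrite alternating_swap23 // A0 oppr0.
  have A2 : alternating_sum g z x y = 0 by rewrite alternating_swap12 // A1 oppr0.
  have : perm_eq [:: z & o] [:: z; x; y].
    by apply: perm_trans po _; apply: perm_trans (pc _ _ _); rewrite perm_cons; apply: pc.
  rewrite perm_cons => /perm_pair[] ->.
    by exists z, x, y.
  by exists z, y, x; rewrite alternating_swap23 // A2 oppr0.
Qed.

End Cocycle.

(** * The cocycle equation *)

Section CocycleShapes.
Variables (k : fieldType) (W : wheeled_operad k) (F : functionals W).
Local Notation tree := (tree W).
Local Notation leaves := (@leaves k W).
Local Notation names := (@names k W).
Local Notation N2 e p t u := (@Node k W e 0 p [:: t; u]).

(** For each of the five shapes and the four places of the hook, the three
    contractions are computed and the composition table turns the equation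
    into a polynomial identity in the coordinates of p, q and r. *)
Lemma shape3_cocycle i e f h (p q r : W 2%N) a b c d : (i < 5)%N ->
  graph_ok 3 (Wheel (shape3 i e f h p q r a b c d)) [:: e; f; h] ->
  alternating_sum F (Wheel (shape3 i e f h p q r a b c d)) e f h = 0.
Proof.
move=> i5 /and3P[/andP[_ pl] un _].
have {un} : uniq [:: e; f; h] by case: i i5 pl un => [|[|[|[|[|]]]]].
rewrite /= !inE negb_or => /and3P[/andP[/negbTE ef /negbTE eh] /negbTE fh _].
have fe : (f == e) = false by rewrite eq_sym.
have he : (h == e) = false by rewrite eq_sym.
have hf : (h == f) = false by rewrite eq_sym.
have {}pl : perm_eq [:: a; b; c; d] (iota 0 4) by case: i i5 pl => [|[|[|[|[|]]]]].
have := hook_unique pl; move: pl.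
case: a => [|a]; case: b => [|b]; case: c => [|c]; case: d => [|d] // pl _;
  case: i i5 => [|[|[|[|[|//]]]]] _; rewrite /alternating_sum /shape3;
  do 4 rewrite /= ?(eqxx, ef, eh, fh, fe, he, hf);
  rewrite !phiE //.
all: try by [rewrite /graph_ok /= !inE ?(eqxx, ef, eh, fh, fe, he, hf) /=;
  apply/andP; split; last (by apply/permP => x /=; lia);
  (apply: (perm_trans _ pl) || (rewrite -(perm_cons 0%N); apply: (perm_trans _ pl)));
  apply/permP => x /=; lia].
all: rewrite /= ?sum_ord3 ?sum_ord2 /= ?sum_ord3 ?sum_ord2 /=.
all: do 2 rewrite ?(eqxx, ef, eh, fh, fe, he, hf) /=.
all: rewrite /cycle_pairing /cycle_half ?fT_contraction ?fD_ocomp ?fY_ocomp //.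
all: rewrite ?fMS ?fHS ?inordK // /compD /compY /= ?fM0 ?fH0.
all: try ring.
Qed.

(** An outputless graph with three leaves has less than three edges, so the
    only graphs to consider are wheels, and counting leaves shows that these
    are binary. *)
Lemma phi_cocycle : d_w 3 (phi F) = 0.
Proof.
apply/funext => g; apply/funext => o.
have [gok|/negbTE gok] := boolP (graph_ok 3 g o); last by rewrite /d_w gok.
have [so|so] := eqVneq (size o) 3; last by apply: d_phi_sum => //; apply/eqP.
have sz := wnames_size gok; rewrite so in sz.
case: g gok sz => [t|m w ts] gok sz; last first.
  case/and3P: gok => /and3P[/eqP s1 ar /perm_size s2] _ _; move: s2 sz.
  rewrite size_iota /=.
  suff : (size (flatten (map names ts)) + size ts <= size (flatten (map leaves ts)))%N.
    by rewrite s1; lia.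
  elim: ts ar {s1} => //= t ts IH /andP[/names_lt_leaves at_ /IH].
  by rewrite !size_cat; lia.
have bt : binary t.
  case/and3P: (gok) => /andP[ar /perm_size sl] _ _.
  by split=> //; rewrite [size (names t)]sz sl.
have [i i5 [e [f [h [p [q [r [a [b [c [d Et]]]]]]]]]]] := binary_names3 bt sz.
have Nt : names t = [:: e; f; h].
  by rewrite Et; case: i i5 {Et} => [|[|[|[|[|]]]]].
have /and3P[_ un po] := gok; rewrite /= Nt in un po.
have A0 : alternating_sum F (Wheel t) e f h = 0.
  rewrite Et; apply: shape3_cocycle => //; rewrite -Et.
  by rewrite (perm_graph_ok 3 _ po).
have [x [y [z [Eo Axyz]]]] := alternating_perm un (perm_trans (eqbRL (perm_sym _ _) po) (perm_refl _)) A0.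
by rewrite Eo in gok *; rewrite d_phi3.
Qed.

Lemma phi_cobar : cobar_w 3 (phi F).
Proof.
split; first by move=> g o; rewrite /phi; case: (graph_ok 3 g o) => //; rewrite eqxx.
split.
  split; [exact: phi_lin|exact: phi_root_lin|exact: phi_act|exact: phi_root_act].
split; [exact: phi_rotate|exact: phi_rename|exact: phi_reorder].
Qed.

End CocycleShapes.

(** * A cycle of outputless trees *)

Section TestCycle.
Variables (k : fieldType) (P : wheeled_operad k).
Variables (w : wpart P 1%N) (x y : P 2%N).
Local Notation J := (ocomp (inord 1 : 'I_2) x y : P 3%N).
Hypothesis wx : wcomp (inord 0 : 'I_1) w x = 0 :> wpart P 2%N.
Hypothesis xy : J + oact rot3 J + oact rot3 (oact rot3 J) = 0.

Definition test_graph a b c : wgraph P :=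
  @Outputless k P 0 w [:: @Node k P 0 0 x [:: Leaf a; @Node k P 1 0 y [:: Leaf b; Leaf c]]].

Definition coef (chi : graph_cochain P) g o : k := chi g o.

Definition test_cycle (chi : graph_cochain P) : k :=
  coef chi (test_graph 1 2 3) [:: 0%N; 1%N] + coef chi (test_graph 2 3 1) [:: 0%N; 1%N]
  + coef chi (test_graph 3 1 2) [:: 0%N; 1%N].

Lemma test_cycleP a chi chi' :
  test_cycle (a *: chi + chi') = a * test_cycle chi + test_cycle chi'.
Proof.
have E g o : coef (a *: chi + chi') g o = a * coef chi g o + coef chi' g o by [].
by rewrite /test_cycle !E; ring.
Qed.

(** Contracting the lower edge gives w o x, which is zero. *)
Lemma d_test_graph chi a b c : cobar_w 3 chi -> perm_eq [:: a; b; c] (iota 1 3) ->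
  coef (d_w 3 chi) (test_graph a b c) [:: 0%N; 1%N] =
  - coef chi (@Outputless k P 0 w [:: @Node k P 0 1 J [:: Leaf a; Leaf b; Leaf c]]) [:: 0%N].
Proof.
move=> [_ [[_ clin _ _] _]] pabc.
rewrite /coef /d_w /graph_ok /= pabc /= !big_ord_recl big_ord0 /= wx.
have -> : chi (@Outputless k P 1 0 [:: Leaf a; @Node k P 1 0 y [:: Leaf b; Leaf c]]) [:: 1%N] = 0.
  have := clin 1%N (-1) 0 0 [:: Leaf a; @Node k P 1 0 y [:: Leaf b; Leaf c]] [:: 1%N].
  by rewrite scaler0 addr0 mulN1r addNr.
by rewrite mulr0 add0r addr0 /bump /= expr1 mulN1r.
Qed.

Lemma rot3_permute (a b c : nat) :
  permute rot3 [:: Leaf a; Leaf b; Leaf c : tree P] = [:: Leaf b; Leaf c; Leaf a].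
Proof.
apply: (@eq_from_nth _ (Leaf 0)); first by rewrite size_permute.
rewrite size_permute => -[|[|[|//]]] i3.
- by have := nth_permute rot3 [:: Leaf a; Leaf b; Leaf c : tree P] (Ordinal i3); rewrite permE /=.
- by have := nth_permute rot3 [:: Leaf a; Leaf b; Leaf c : tree P] (Ordinal i3); rewrite permE /=.
- by have := nth_permute rot3 [:: Leaf a; Leaf b; Leaf c : tree P] (Ordinal i3); rewrite permE /=.
Qed.

(** The three ternary vertices left after contracting the upper edges carry
    rotated leaves; moving the rotations to the decoration by equivariance
    leaves the cyclic sum of x o_2 y, which is zero. *)
Lemma test_cycle_coboundary chi : cobar_w 3 chi -> test_cycle (d_w 3 chi) = 0.
Proof.
move=> cchi; rewrite /test_cycle !d_test_graph //.
have [_ [[clin _ cact _] _]] := cchi.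
pose X (p : P 3%N) := coef chi (@Outputless k P 0 w
  [:: @Node k P 0 1 p [:: Leaf 1; Leaf 2; Leaf 3]]) [:: 0%N].
pose ctx : wgraph P := @Outputless k P 0 w [:: Leaf 0].
have XD p q : X (p + q) = X p + X q.
  have := clin ctx 0%N 0%N 1%N 1 p q [:: Leaf 1; Leaf 2; Leaf 3] [:: 0%N] erefl.
  by rewrite scale1r mul1r.
have Xact p a b c : perm_eq [:: a; b; c] (iota 1 3) ->
   coef chi (@Outputless k P 0 w [:: @Node k P 0 1 (oact rot3 p) [:: Leaf a; Leaf b; Leaf c]]) [:: 0%N] =
   coef chi (@Outputless k P 0 w [:: @Node k P 0 1 p [:: Leaf b; Leaf c; Leaf a]]) [:: 0%N].
  move=> _.
  have := cact ctx 0%N 0%N 1%N rot3 p [:: Leaf a; Leaf b; Leaf c] [:: 0%N] erefl erefl.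
  by rewrite rot3_permute.
have X0 : X 0 = 0 by have := XD 0 0; rewrite addr0 => /eqP; rewrite -subr_eq0 opprD addNKr oppr_eq0 => /eqP.
have : X (J + oact rot3 J + oact rot3 (oact rot3 J)) = 0 by rewrite xy.
rewrite !XD /X !Xact // => E.
by rewrite -!opprD E oppr0.
Qed.

End TestCycle.

(** * The cohomology class is not a contraction *)

Section Surjectivity.
Variables (k : fieldType) (E : S2module k).
Variables (Ro : set (free_wheeled E 3%N)) (Rw : set (wpart (free_wheeled E) 1%N)).

(** In a wheeled completion the wheeled part of arity n is a quotient of the
    operadic part of arity n+1, the contraction at the last input being the
    projection. *)
Lemma quadratic_contraction_surjective n (q : wpart (quadratic_wheeled Ro Rw) n) :
  exists x : quadratic_wheeled Ro Rw n.+1, q = contraction ord_max x.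
Proof.
pose FW := free_wheeled E.
have cE (z : FW n.+1) : contraction ord_max z = cls _ (cyclic_relation (P := free_operad E) (n := n)) z.
  by rewrite -[LHS]/(cls _ _ (oact (lift_perm ord_max ord_max 1%g) (z : free_operad E n.+1)))
    lift_perm1 free_oact1.
have [u _ ->] := clsW q; have [y _ ->] := clsW u.
exists (cls [set: FW n.+1] (wheeled_ideal_o Ro Rw (n := n.+1)) y).
rewrite -[RHS]/(cls _ _ (contraction ord_max (rep (cls [set: FW n.+1] (wheeled_ideal_o Ro Rw (n := n.+1)) y)))).
rewrite -cE; apply: cls_eq; [exact: sub_lspan|exact: sub_lspan|].
set z := rep _.
have zy : lspan (wheeled_ideal_o Ro Rw (n := n.+1)) (y - z).
  have : lspan (wheeled_ideal_o Ro Rw (n := n.+1)) (z - y).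
    by apply: rep_cls; apply: sub_lspan.
  by move=> /(lspanZ (-1)); rewrite scaleN1r opprB.
rewrite !cE.
have -> : cls [set: FW n.+1] (cyclic_relation (P := free_operad E) (n := n)) y
   - cls _ (cyclic_relation (P := free_operad E) (n := n)) z = contraction (w := FW) ord_max (y - z : FW n.+1).
  by rewrite cE addrC -scaleN1r -cls_lin ?scaleN1r 1?addrC //; apply: sub_lspan.
apply: sub_lspan => I J IJ RI RJ.
have [[subI _ _ _] [_ _ _ _ cIJ]] := IJ; apply: cIJ.
exact: (lspan_le (subI n.+1) (fun x h => h I J IJ RI RJ) zy).
Qed.
End Surjectivity.

Lemma test_cycle_value (k : fieldType) (W : wheeled_operad k) (F : functionals W)
    (w : wpart W 1%N) (x y : W 2%N) :
  test_cycle w x y (phi F) = - (fT F 0 w * fH F 0 1 x * fM F 0 1 y) *+ 6.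
Proof.
have E a b c : perm_eq [:: a; b; c] (iota 1 3) ->
  coef (phi F) (test_graph w x y a b c) [:: 0%N; 1%N] =
  - (fT F 0 w * fH F 0 1 x * fM F 0 1 y) *+ 2.
  move=> pabc; rewrite /coef phiE //; last by rewrite /graph_ok /= pabc.
  by rewrite /= !big_ord_recl big_ord0 /=; ring.
by rewrite /test_cycle !E //; ring.
Qed.

Section PoissonFunctionalsInstance.
Variable k : fieldType.
Local Notation W := (completion (poisson k)).

Definition poisson_functionals : functionals W :=
  @Functionals k W (@poisM k) (@poisH k) (@poisY k) (@poisD k) (@poisT k)
    (family_poisM k) (family_poisH k) (family_poisY k) (family_poisD k)
    (@poisM0 k) (@poisH0 k) (fun _ _ _ => erefl) (fun _ _ _ => erefl) (fun _ _ => erefl)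
    (@poisTP k) (@poisT_wact k) (@poisT_contraction k)
    (@poisD_ocomp k) (@poisY_ocomp k).

Lemma test_cycle_phi :
  test_cycle (P := W) (wcls (pois_brac k)) (pois_brac k) (pois_prod k)
    (phi poisson_functionals) = - 6%:R.
Proof.
have [Mp _ _ Hb] := pois_gen_coords k.
have Tw : fT poisson_functionals 0 (wcls (pois_brac k)) = 1.
  by rewrite -[LHS]/(@poisH k 0 1 (rep (wcls (pois_brac k)))) rep_wcls.
by rewrite test_cycle_value Tw (Hb : fH poisson_functionals 0 1 _ = 1)
  (Mp : fM poisson_functionals 0 1 _ = 1) !mulr1 mulNrn.
Qed.

End PoissonFunctionalsInstance.

Theorem mainTheorem1 (k : fieldType) (char_k : [pchar k]%R =i pred0) :
  ~ wheeled_koszul (completion (poisson k)) (completion_dual (@pois_relations k)).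
Proof.
set W := completion (poisson k).
move=> [f [g [bf [bg [_ fg_contraction]]]]].
pose F := poisson_functionals k.
(* Pairing with the cycle of outputless trees. *)
pose Z := test_cycle (P := W) (wcls (pois_brac k)) (pois_brac k) (pois_prod k).
have wx : wcomp (inord 0 : 'I_1) (wcls (pois_brac k)) (pois_brac k) = 0 by exact: wcomp_brac.
have Z_coboundary chi : lspan (coboundaries_w (P := W) 3) chi -> Z chi = 0.
  apply: (lspan_le (S := [set chi | Z chi = 0])).
    split=> [|a u v /= Zu Zv] /=.
      by have := test_cycleP (wcls (pois_brac k)) (pois_brac k) (pois_prod k) (-1) 0 0;
        rewrite scaler0 addr0 mulN1r addNr.
    by rewrite /Z test_cycleP -!/(Z _) Zu Zv mulr0 addr0.
  move=> _ [psi cpsi <-] /=; apply: test_cycle_coboundary => //.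
  by have := leibniz_rot k; rewrite -inord1_one.
have cocycle_phi : cocycles_w (P := W) 3 (phi F).
  by split; [exact: phi_cobar|exact: phi_cocycle].
pose q : wpart (cobar_cohomology W) 3 := cls _ (coboundaries_w (P := W) 3) (phi F).
have [x gx] := quadratic_contraction_surjective (g 3%N q).
have [f' _ ff'] := bf 3%N; rewrite -(ff' x) -fg_contraction in gx.
have {gx} := bij_inj (bg 3%N) gx.
move=> /(cls_eq_inv (sub_lspan cocycle_phi)) boundary.
have Zphi : Z (phi F) = 0.
  case: boundary => [|/Z_coboundary//].
  (* A contraction is supported on wheeled trees. *)
  set psi := cobar_contraction _ _ => /Z_coboundary.
  have Zpsi : Z psi = 0.
    have E a b c : coef psi (test_graph (P := W) (wcls (pois_brac k)) (pois_brac k)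
        (pois_prod k) a b c) [:: 0%N; 1%N] = 0.
      by rewrite /coef /psi /cobar_contraction /test_graph; case: (graph_ok _ _ _).
    by rewrite /Z /test_cycle !E !addr0.
  rewrite addrC -scaleN1r /Z test_cycleP -!/(Z _) Zpsi.
  by rewrite mulr0 add0r.
have := test_cycle_phi k; rewrite -/(Z _) -/F Zphi => /esym/eqP; rewrite oppr_eq0.
by rewrite (pcharf0P k).1.
Qed.
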